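(* Let $w>0$ and let $P\in\Psi^w(\mathbb{T}^n_\theta)$ be an elliptic pseudodifferential operator with $\Theta(P)\ne\emptyset$. Let $L_\phi=\{\arg\lambda=\phi\}$ be a ray contained in $\check\Theta(P)$, and let $\Gamma$ be the contour coming from $\infty$ along $L_\phi$ to $re^{i\phi}$, then following the circle $|\lambda|=r$ clockwise from argument $\phi$ to argument $\phi-2\pi$, then going back to $\infty$ along $L_\phi$, where $0<r<r_0:=\inf\{|\lambda|:\lambda\in\mathrm{Sp}(P),\lambda\neq0\}$. Then $$\log_\phi(P)=\frac{i}{2\pi}\int_\Gamma\log_\phi(\lambda)\,\lambda^{-1}P(P-\lambda)^{-1}\,d\lambda,$$ where the integral converges in $\mathscr{L}(C^\infty(\mathbb{T}^n_\theta))$.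
   Context: Noncommutative torus. Let $n\ge 2$ and let $\theta=(\theta_{jk})$ be a real antisymmetric $n\times n$ matrix. $C(\mathbb{T}^n_\theta)$ is the universal $C^*$-algebra (norm $\|\cdot\|$) generated by unitaries $U_1,\dots,U_n$ with $U_kU_j=e^{2i\pi\theta_{jk}}U_jU_k$. Put $U^k=U_1^{k_1}\cdots U_n^{k_n}$, $k\in\mathbb{Z}^n$. $\tau$ is the trace with $\tau(U^k)=1$ if $k=0$ and $0$ otherwise. $L_2(\mathbb{T}^n_\theta)$ is the Hilbert space completion for $(u|v)=\tau(uv^* )$; $(U^k)_{k}$ is an orthonormal basis, and $C(\mathbb{T}^n_\theta)$ acts by left multiplication. $C^\infty(\mathbb{T}^n_\theta)=\{\sum_k u_kU^k:\ (u_k)\text{ rapidly decaying}\}$ is a Fréchet $*$-algebra with semi-norms $\|\delta^\beta u\|$, where $\delta_j(U^k)=k_jU^k$ and $\delta^\beta=\delta_1^{\beta_1}\cdots\delta_n^{\beta_n}$. For $s\ge0$, $W_2^s(\mathbb{T}^n_\theta)=\{\sum u_kU^k\in L_2:\ \sum_k(1+|k|^2)^s|u_k|^2<\infty\}$. $\mathscr{L}(C^\infty(\mathbb{T}^n_\theta))$ carries the topology of uniform convergence on bounded sets. Symbols and operators. $C^\infty(\mathbb{T}^n_\theta\times V)=C^\infty(V;C^\infty(\mathbb{T}^n_\theta))$ for $V\subseteq\mathbb{R}^n$ open. $S_q(\mathbb{T}^n_\theta\times\mathbb{R}^n)$, $q\in\mathbb{C}$: $\rho\in C^\infty(\mathbb{T}^n_\theta\times(\mathbb{R}^n\setminus0))$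 with $\rho(t\xi)=t^q\rho(\xi)$, $t>0$. $S^q(\mathbb{T}^n_\theta\times\mathbb{R}^n)$: $\rho\in C^\infty(\mathbb{T}^n_\theta\times\mathbb{R}^n)$ for which there are $\rho_{q-j}\in S_{q-j}$, $j\ge0$, such that for all $N,\alpha,\beta$ there is $C$ with $\|\delta^\alpha\partial_\xi^\beta(\rho-\sum_{j<N}\rho_{q-j})(\xi)\|\le C|\xi|^{\Re q-N-|\beta|}$ for $|\xi|\ge1$. $P_\rho(\sum_ku_kU^k)=\sum_ku_k\rho(k)U^k$; $\Psi^q(\mathbb{T}^n_\theta)=\{P_\rho:\rho\in S^q\}$. $\rho_q$ (depending only on $P_\rho$) is the principal symbol; $P_\rho$ is elliptic if $\rho_q(\xi)$ is invertible for all $\xi\ne0$. Elliptic parameter set. $P$ is regarded as a closed operator on $L_2(\mathbb{T}^n_\theta)$ with domain $W_2^w(\mathbb{T}^n_\theta)$. $\Theta(P)=\{\lambda\in\mathbb{C}^*:\rho_w(\xi)-\lambda\text{ invertible for all }\xi\ne0\}$, $\rho_w$ the principal symbol of $P$. When $\Theta(P)\neq\emptyset$ the spectrum of $P$ is discrete; $\check\Theta(P)=\Theta(P)\setminus\{t\lambda:t>0,\lambda\in\mathrm{Sp}(P)\}$. Complex powers and logarithm. For $\lambda\in\mathbb{C}^*\setminus L_\phi$ let $\arg_\phi\lambda\in(\phi-2\pi,\phi)$ be the continuous argument, $\lambda_\phi^z=|\lambda|^ze^{iz\arg_\phi\lambda}$ and $\log_\phi(\lambda)=\log|\lambda|+i\arg_\phi\lambda$.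 On the incoming part of $\Gamma$ along $L_\phi$ the convention is $\lambda_\phi^z=|\lambda|^ze^{iz\phi}$, $\log_\phi\lambda=\log|\lambda|+i\phi$; on the outgoing part it is $\lambda_\phi^z=|\lambda|^ze^{iz(\phi-2\pi)}$, $\log_\phi\lambda=\log|\lambda|+i\phi-2i\pi$. For $\Re z<0$, $P_\phi^z=\frac{i}{2\pi}\int_\Gamma\lambda_\phi^z(P-\lambda)^{-1}d\lambda$ (convergent in $\mathscr{L}(C^\infty(\mathbb{T}^n_\theta))$); for general $z$, $P_\phi^z=P^kP_\phi^{z-k}$ for any integer $k\ge0$, $k>\Re z$. This is a holomorphic family in $\mathscr{L}(C^\infty(\mathbb{T}^n_\theta))$, and $\log_\phi(P):=\frac{d}{dz}\big|_{z=0}P_\phi^z$ in $\mathscr{L}(C^\infty(\mathbb{T}^n_\theta))$. Convergence of $\int_\Gamma u(\lambda)d\lambda$ means that the integrals over the truncations of the two rays converge as the truncation goes to infinity. *)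

(* Defs.v *)
From HB Require Import structures.
From mathcomp Require Import all_boot all_order all_algebra finmap complex.
From mathcomp Require Import all_classical all_reals all_analysis.
From mathcomp Require Export complex.
From mathcomp.analysis Require Import showcase.summability.
Set Implicit Arguments.
Unset Strict Implicit.
Unset Printing Implicit Defensive.
Import Order.TTheory GRing.Theory Num.Theory.
Import numFieldNormedType.Exports.
Local Open Scope classical_set_scope.
Local Open Scope ring_scope.
Local Open Scope complex_scope.

(* Unital nonzero C*-algebras. The operations are bundled over a Banach space,
   and the ring and algebra structures are then declared on the carrier. *)
Record cstarType (R : realType) := CStarType {
  cs_space : completeNormedModType R[i] ;
  cs_mul : cs_space -> cs_space -> cs_space ;
  cs_one : cs_space ;
  cs_star : cs_space -> cs_space ;
  cs_mulA : associative cs_mul ;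
  cs_mul1l : left_id cs_one cs_mul ;
  cs_mul1r : right_id cs_one cs_mul ;
  cs_mulDl : left_distributive cs_mul +%R ;
  cs_mulDr : right_distributive cs_mul +%R ;
  cs_one_neq0 : cs_one != 0 ;
  cs_scaleAl : forall (c : R[i]) a b, c *: cs_mul a b = cs_mul (c *: a) b ;
  cs_scaleAr : forall (c : R[i]) a b, c *: cs_mul a b = cs_mul a (c *: b) ;
  cs_starK : involutive cs_star ;
  cs_star_antilinear : forall (c : R[i]) a b,
    cs_star (c *: a + b) = c^* *: cs_star a + cs_star b ;
  cs_starM : forall a b, cs_star (cs_mul a b) = cs_mul (cs_star b) (cs_star a) ;
  cs_normM : forall a b, `|cs_mul a b| <= `|a| * `|b| ;
  cs_norm_star : forall a, `|cs_mul (cs_star a) a| = `|a| ^+ 2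
}.

Definition cs_sort (R : realType) (A : cstarType R) : Type := cs_space A.
Coercion cs_sort : cstarType >-> Sortclass.

Section CStarInstances.
Variables (R : realType) (A : cstarType R).
HB.instance Definition _ := CompleteNormedModule.on (cs_sort A).
HB.instance Definition _ := GRing.Zmodule_isNzRing.Build (cs_sort A)
  (@cs_mulA R A) (@cs_mul1l R A) (@cs_mul1r R A) (@cs_mulDl R A) (@cs_mulDr R A)
  (@cs_one_neq0 R A).
HB.instance Definition _ :=
  GRing.Lmodule_isLalgebra.Build R[i] (cs_sort A) (@cs_scaleAl R A).
HB.instance Definition _ :=
  GRing.Lalgebra_isAlgebra.Build R[i] (cs_sort A) (@cs_scaleAr R A).
Definition star (a : cs_sort A) : cs_sort A := cs_star a.
End CStarInstances.

(* The norms of the library are [R[i]]-valued on complex spaces. *)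
Definition nrm (R : realType) (V : normedZmodType R[i]) (x : V) : R :=
  complex.Re `|x|.

Definition cexp (R : realType) (z : R[i]) : R[i] :=
  (expR (complex.Re z))%:C * (cos (complex.Im z) +i* sin (complex.Im z)).

Section Euclidean.
Variables (R : realType) (n : nat).

Definition enorm (xi : 'rV[R]_n) : R := Num.sqrt (\sum_j xi 0 j ^+ 2).

Definition lattice (k : 'rV[int]_n) : 'rV[R]_n := \row_j (k 0 j)%:~R.

End Euclidean.

Section Generators.
Variables (R : realType) (n : nat) (A : cstarType R).

Definition unitary (a : A) : Prop := star a * a = 1 /\ a * star a = 1.

Definition torus_relations (theta : 'M[R]_n) (U : 'I_n -> A) : Prop :=
  (forall j, unitary (U j)) /\
  (forall j k,
     U k * U j = cexp (0 +i* (2 * pi * theta j k)) *: (U j * U k)).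

Definition upow (a : A) (m : int) : A :=
  match m with Posz p => a ^+ p | Negz p => star a ^+ p.+1 end.

Definition monomial (U : 'I_n -> A) (k : 'rV[int]_n) : A :=
  \prod_(j < n) upow (U j) (k 0 j).

Definition generated_by (U : 'I_n -> A) : Prop :=
  forall S : set A, closed S -> S 1 -> (forall j, S (U j)) ->
    (forall (c : R[i]) a b, S a -> S b -> S (c *: a + b)) ->
    (forall a b, S a -> S b -> S (a * b)) ->
    (forall a, S a -> S (star a)) ->
    S = setT.

End Generators.

(* Every C*-algebra here is unital and nonzero, so [theta] antisymmetric is
   needed for the structure below to be inhabited. *)
Record ncTorus (R : realType) (n : nat) (theta : 'M[R]_n) := NCTorus {
  alg :> cstarType R ;
  gen : 'I_n -> alg ;
  gen_rel : torus_relations theta gen ;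
  gen_dense : generated_by gen ;
  gen_univ : forall (B : cstarType R) (V : 'I_n -> B),
    torus_relations theta V ->
    exists f : {lrmorphism alg -> B},
      (forall a, f (star a) = star (f a)) /\ (forall j, f (gen j) = V j) ;
  tau : {scalar alg} ;
  tau_continuous : continuous (tau : alg -> R[i]^o) ;
  tau_ge0 : forall a, 0 <= tau (a * star a) ;
  tau_tracial : forall a b, tau (a * b) = tau (b * a) ;
  tau_monomial : forall k, tau (monomial gen k) = (k == 0)%:R ;
  (* the Hilbert space completion [L2] for [tau (u * star v)] *)
  L2 : completeNormedModType R[i] ;
  ip : L2 -> L2 -> R[i] ;
  ip_linear : forall (c : R[i]) x y z, ip (c *: x + y) z = c * ip x z + ip y z ;
  ip_conj : forall x y, ip y x = (ip x y)^* ;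
  ip_norm : forall x, ip x x = `|x| ^+ 2 ;
  emb : {linear alg -> L2} ;
  emb_ip : forall u v, ip (emb u) (emb v) = tau (u * star v) ;
  emb_dense : closure (range emb) = setT
}.

Section Torus.
Variables (R : realType) (n : nat) (theta : 'M[R]_n) (T : ncTorus theta).
Local Notation C := R[i].
Local Notation monom := (monomial (@gen _ _ _ T)).

Definition coef (u : T) (k : 'rV[int]_n) : C := tau T (u * star (monom k)).

Definition rapid_decay (c : 'rV[int]_n -> C) : Prop :=
  forall N : nat, exists M : R, forall k,
    (1 + enorm (lattice R k)) ^+ N * nrm (c k) <= M.

Definition Cinf : set T := [set u | exists c, rapid_decay c /\
  partial_sum (fun k : 'rV[int]_n => c k *: monom k) @ totally --> u].

Definition delta1 (j : 'I_n) (u : T) : T :=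
  summability.sum (fun k : 'rV[int]_n => ((k 0 j)%:~R * coef u k) *: monom k).

Definition multi := {ffun 'I_n -> nat}.
Definition msize (b : multi) : nat := (\sum_j b j)%N.

Definition mcompose (X : Type) (D : 'I_n -> X -> X) (b : multi) (x : X) : X :=
  foldr (fun j y => iter (b j) (D j) y) x (enum 'I_n).

Definition delta (b : multi) : T -> T := mcompose delta1 b.

Definition cvg_Cinf (I : Type) (F : set_system I) (f : I -> T) (l : T) : Prop :=
  [/\ \forall i \near F, Cinf (f i), Cinf l &
      forall (b : multi) (e : R), 0 < e ->
        \forall i \near F, nrm (delta b (f i - l)) < e].

Definition bounded_Cinf (B : set T) : Prop :=
  B `<=` Cinf /\
  forall b : multi, exists M : R, forall u, B u -> nrm (delta b u) <= M.

(* Operators are total functions on [T]; only their values on [Cinf] matter,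
   and operators agreeing on [Cinf] are identified. *)
Definition LCinf (S : T -> T) : Prop :=
  [/\ forall u, Cinf u -> Cinf (S u),
      forall (c : C) u v, Cinf u -> Cinf v -> S (c *: u + v) = c *: S u + S v &
      forall (b : multi) (e : R), 0 < e -> exists (N : nat) (d : R), 0 < d /\
        forall u, Cinf u ->
          (forall g : multi, (msize g <= N)%N -> nrm (delta g u) < d) ->
          nrm (delta b (S u)) < e].

Definition cvg_LCinf (I : Type) (F : set_system I) (S : I -> T -> T)
    (L : T -> T) : Prop :=
  [/\ \forall i \near F, LCinf (S i), LCinf L &
      forall B, bounded_Cinf B -> forall (b : multi) (e : R), 0 < e ->
        \forall i \near F, forall u, B u -> nrm (delta b (S i u - L u)) < e].

(* Symbols *)

Definition pderiv (j : 'I_n) (f : 'rV[R]_n -> T) (xi : 'rV[R]_n) : T :=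
  lim ((h^-1)%:C *: (f (xi + h *: delta_mx 0 j) - f xi) @[h --> (0 : R)^']).

Definition mderiv (b : multi) : ('rV[R]_n -> T) -> 'rV[R]_n -> T :=
  mcompose pderiv b.

Definition smooth_on (V : set 'rV[R]_n) (f : 'rV[R]_n -> T) : Prop :=
  forall (s : seq 'I_n) xi, V xi ->
    let g := foldr pderiv f s in
    cvg_Cinf (nbhs xi) g (g xi) /\
    forall j, cvg_Cinf (0 : R)^'
      (fun h => (h^-1)%:C *: (g (xi + h *: delta_mx 0 j) - g xi))
      (pderiv j g xi).

Definition homogeneous (q : C) (f : 'rV[R]_n -> T) : Prop :=
  smooth_on [set xi | xi != 0] f /\
  forall (t : R) xi, 0 < t -> xi != 0 ->
    f (t *: xi) = cexp (q * (ln t)%:C) *: f xi.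

Definition symbol (q : C) (rho : 'rV[R]_n -> T) (rhoh : nat -> 'rV[R]_n -> T) :
    Prop :=
  [/\ smooth_on setT rho,
      forall j : nat, homogeneous (q - j%:R) (rhoh j) &
      forall (N : nat) (a b : multi), exists M : R, forall xi, 1 <= enorm xi ->
        nrm (delta a (mderiv b (fun z => rho z - \sum_(j < N) rhoh j z) xi))
          <= M * enorm xi `^ (complex.Re q - N%:R - (msize b)%:R)].

Definition Pop (rho : 'rV[R]_n -> T) (u : T) : T :=
  summability.sum (fun k : 'rV[int]_n => coef u k *: (rho (lattice R k) * monom k)).

Definition quantizes (q : C) (P : T -> T) (rho : 'rV[R]_n -> T)
    (rhoh : nat -> 'rV[R]_n -> T) : Prop :=
  symbol q rho rhoh /\ forall u, Cinf u -> P u = Pop rho u.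

Definition Psi (q : C) : set (T -> T) :=
  [set P | exists rho rhoh, quantizes q P rho rhoh].

(* Only the values at [xi != 0] are determined by [P]. *)
Definition principal_symbol (q : C) (P : T -> T) : 'rV[R]_n -> T :=
  xget (fun=> 0) [set sigma | exists rho rhoh,
    quantizes q P rho rhoh /\ sigma = rhoh 0%N].

Definition invertible_Cinf (a : T) : Prop :=
  exists2 b, Cinf b & a * b = 1 /\ b * a = 1.

Definition elliptic (q : C) (P : T -> T) : Prop :=
  forall xi, xi != 0 -> invertible_Cinf (principal_symbol q P xi).

(* The closed operator on L2 and its spectrum *)

Definition coefL2 (x : L2 T) (k : 'rV[int]_n) : C := ip x (emb T (monom k)).

Definition sobolev (s : R) : set (L2 T) := [set x |
  (\esum_(k in setT)
     ((1 + enorm (lattice R k) ^+ 2) `^ s * nrm (coefL2 x k) ^+ 2)%:E < +oo)%E].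

Definition opL2 (P : T -> T) (x : L2 T) : L2 T :=
  summability.sum (fun k : 'rV[int]_n => coefL2 x k *: emb T (P (monom k))).

Definition is_resolvent (w : R) (P : T -> T) (l : C) (B : L2 T -> L2 T) : Prop :=
  [/\ forall (c : C) x y, B (c *: x + y) = c *: B x + B y,
      exists M : R, forall x, nrm (B x) <= M * nrm x,
      forall x, sobolev w (B x) /\ opL2 P (B x) - l *: B x = x &
      forall x, sobolev w x -> B (opL2 P x - l *: x) = x].

Definition Sp (w : R) (P : T -> T) : set C :=
  [set l | ~ exists B, is_resolvent w P l B].

Definition resolventL2 (w : R) (P : T -> T) (l : C) : L2 T -> L2 T :=
  xget (fun=> 0) [set B | is_resolvent w P l B].

(* [(P - l)^-1] on [Cinf], seen inside [L2] through [emb]. *)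
Definition resolvent (w : R) (P : T -> T) (l : C) (u : T) : T :=
  xget 0 [set v | Cinf v /\ emb T v = resolventL2 w P l (emb T u)].

Definition Theta (w : R) (P : T -> T) : set C := [set l | l != 0 /\
  forall xi, xi != 0 -> invertible_Cinf (principal_symbol w%:C P xi - l%:A)].

Definition checkTheta (w : R) (P : T -> T) : set C :=
  Theta w P `\` [set m | exists (t : R) (l : C),
    [/\ 0 < t, Sp w P l & m = t%:C * l]].

(* The point of modulus [t] and argument [a]. *)
Definition polar (t a : R) : C := t%:C * cexp (0 +i* a).

Definition ray (phi : R) : set C := [set polar t phi | t in [set t | 0 < t]].

Definition gap_radius (w : R) (P : T -> T) : \bar R :=
  ereal_inf [set (nrm l)%:E | l in [set l | Sp w P l /\ l != 0]].

(* Contour integrals in [LCinf] *)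

Record tagged_partition := TaggedPartition {
  tp_size : nat ; tp_point : nat -> R ; tp_tag : nat -> R }.

Definition mesh_below (a b eta : R) (p : tagged_partition) : Prop :=
  [/\ tp_point p 0 = a, tp_point p (tp_size p) = b &
      forall i, (i < tp_size p)%N ->
        tp_point p i <= tp_tag p i <= tp_point p i.+1 /\
        tp_point p i.+1 - tp_point p i < eta].

Definition mesh_filter (a b : R) : set_system tagged_partition :=
  filter_from [set eta | 0 < eta] (mesh_below a b).

Definition riemann_sum (G : R -> T -> T) (p : tagged_partition) (u : T) : T :=
  \sum_(i < tp_size p)
    (tp_point p i.+1 - tp_point p i)%:C *: G (tp_tag p i) u.

Definition is_integral (G : R -> T -> T) (a b : R) (I : T -> T) : Prop :=
  cvg_LCinf (mesh_filter a b) (riemann_sum G) I.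

Definition is_improper_integral (G : R -> T -> T) (a : R) (I : T -> T) : Prop :=
  exists J : R -> T -> T,
    (forall b, a <= b -> is_integral G a b (J b)) /\
    cvg_LCinf +oo J I.

(* [G t a] is the integrand at [l = polar t a], where the argument [a] also
   selects the branch: [a = phi] on the incoming ray, [phi - 2 pi <= a <= phi]
   on the circle and [a = phi - 2 pi] on the outgoing ray. The integrals are
   pulled back along [t |-> polar t a] and [a |-> polar r a]. *)
Definition is_contour_integral (phi r : R) (G : R -> R -> T -> T)
    (I : T -> T) : Prop :=
  exists Iin Iarc Iout : T -> T,
  [/\ is_improper_integral (fun t u => polar 1 phi *: G t phi u) r Iin,
      is_integral (fun a u => ('i * polar r a) *: G r a u)
        (phi - 2 * pi) phi Iarc,
      is_improper_integral
        (fun t u => polar 1 phi *: G t (phi - 2 * pi) u) r Iout &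
      forall u, Cinf u -> I u = - Iin u - Iarc u + Iout u].

Definition clog (t a : R) : C := ln t +i* a.
Definition cpow (z : C) (t a : R) : C := cexp (z * clog t a).

(* Complex powers and logarithm, for the contour whose circle has radius [r].
   As with [lim], [xget] gives a default value if the limit does not exist. *)

Definition i_over_2pi : C := 'i / (2 * pi)%:C.

Definition neg_power (w : R) (P : T -> T) (phi r : R) (z : C) : T -> T :=
  xget (fun=> 0) [set S | exists I,
    is_contour_integral phi r
      (fun t a u => cpow z t a *: resolvent w P (polar t a) u) I /\
    S = (fun u => i_over_2pi *: I u)].

(* The least integer [k >= 0] with [k > Re z]; the complex power does not
   depend on the choice of such a [k]. *)
Definition power_shift (z : C) : nat :=
  if complex.Re z < 0 then 0%N else (Num.truncn (complex.Re z)).+1.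

Definition complex_power (w : R) (P : T -> T) (phi r : R) (z : C) (u : T) : T :=
  let k := power_shift z in
  iter k P (neg_power w P phi r (z - k%:R) u).

Definition log_phi (w : R) (P : T -> T) (phi r : R) : T -> T :=
  xget (fun=> 0) [set L | cvg_LCinf (0 : C^o)^'
    (fun h u => h^-1 *: (complex_power w P phi r h u
                         - complex_power w P phi r 0 u)) L].

End Torus.

(* Main.v *)
(** Smooth elements are handled through weighted l1 norms of their Fourier
    coefficients, which define the topology of the smooth algebra. On the ray, the
    pointwise inverse of the principal symbol minus l is bounded by
    1/(|xi|^w + |l|) in each of these norms (compactness of the sphere and
    homogeneity), and gives a parametrix whose remainder is as small as desired
    when |l| is large. Hence a priori estimates: any solution with temperate Fourier
    coefficients of (P - l) u = f is bounded by f, uniformly in l. Applied to the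
    L2-resolvent, this bounds (P - l)^-1 on the smooth algebra uniformly on the
    contour, and P (P - l)^-1 = (P - l)^-1 P = O(1/|l|) as operators.

    For |h| small, the complex power of exponent h is i/(2 pi) times the integral
    of l^(h-1) P (P - l)^-1, whatever the sign of Re h, because the integral of
    l^(h-1) alone vanishes for Re h < 0. The difference quotient at h = 0 of this
    integrand differs from log(l) l^-1 P (P - l)^-1 by
    O(|h| |log l|^2 |l|^(|h|-2)), so the integrals converge. *)

Require Import Defs.
From HB Require Import structures.
From mathcomp Require Import all_boot all_order all_algebra finmap complex.
From mathcomp Require Import all_classical all_reals all_analysis.
From mathcomp Require Import lra ring.
From mathcomp.analysis Require Import showcase.summability.
Set Implicit Arguments.
Unset Strict Implicit.
Unset Printing Implicit Defensive.
Import Order.TTheory GRing.Theory Num.Theory.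
Import numFieldNormedType.Exports.
Local Open Scope classical_set_scope.
Local Open Scope ring_scope.
Local Open Scope complex_scope.

(** * Unconditional sums *)

(** The estimates must start from what the definitions provide: an L2-resolvent selected by [xget],
    whose values are first controlled only through bounded Fourier coefficients, hence in the
    negative weight [- 2 n]. So the parametrix is a family of columns rather than an operator to be
    composed, and [(P - l) u = f] is a system on coefficients whose sums are limits along finite
    sets. Three obstacles follow. Absorbing the remainder requires a norm already known to be
    finite, so the weights are truncated first. When [l] stays bounded the remainder is not small,
    so the equation is rewritten at a fixed far point of the ray, the difference goes to the
    right-hand side, and [w] orders of regularity are gained at each turn. Finally, coefficients are
    not known to determine an element of the algebra or a vector of [L2], so equalities are proved
    between sums of Fourier series, or read off the equation itself. Integrals are likewise taken
    coefficient by coefficient and reassembled. *)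

Section NormReal.
Variable R : realType.
Local Notation C := R[i].

Lemma nrmE (V : normedZmodType C) (x : V) : `|x| = (nrm x)%:C.
Proof.
rewrite /nrm; have /complex_realP [y ->] // : `|x| \is Num.real.
exact: normr_real.
Qed.

Lemma nrm_ge0 (V : normedZmodType C) (x : V) : 0 <= nrm x.
Proof. by rewrite -(@lecR R) -nrmE normr_ge0. Qed.

Lemma nrm0 (V : normedZmodType C) : nrm (0 : V) = 0.
Proof. by rewrite /nrm normr0. Qed.

Lemma nrmD (V : normedZmodType C) (x y : V) : nrm (x + y) <= nrm x + nrm y.
Proof. by rewrite -lecR rmorphD /= -!nrmE ler_normD. Qed.

Lemma nrmN (V : normedZmodType C) (x : V) : nrm (- x) = nrm x.
Proof. by rewrite /nrm normrN. Qed.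

Lemma nrmB (V : normedZmodType C) (x y : V) : nrm (x - y) <= nrm x + nrm y.
Proof. by rewrite -(nrmN y) nrmD. Qed.

Lemma nrmC (V : normedZmodType C) (x y : V) : nrm (x - y) = nrm (y - x).
Proof. by rewrite -nrmN opprB. Qed.

Lemma nrmZ (V : normedModType C) (c : C) (x : V) : nrm (c *: x) = nrm c * nrm x.
Proof.
have : `|c *: x| = `|c| * `|x| by rewrite normrZ.
by rewrite !nrmE -rmorphM => -[].
Qed.

Lemma nrm_eq0 (V : normedZmodType C) (x : V) : nrm x = 0 -> x = 0.
Proof. by move=> h; apply/eqP; rewrite -normr_eq0 nrmE h. Qed.

Lemma nrm_sum (V : normedZmodType C) (I : Type) (s : seq I) (f : I -> V) :
  nrm (\sum_(i <- s) f i) <= \sum_(i <- s) nrm (f i).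
Proof.
elim: s => [|i s IH]; first by rewrite !big_nil nrm0.
by rewrite !big_cons (le_trans (nrmD _ _)) // lerD2l.
Qed.

Lemma nrm_mul (c d : C) : nrm (c * d) = nrm c * nrm d.
Proof. by have := normrM c d; rewrite !nrmE -rmorphM => -[]. Qed.

Lemma nrm_real (x : R) : nrm (x%:C) = `|x|.
Proof. by rewrite /nrm normc_def /= expr0n /= addr0 sqrtr_sqr. Qed.

Lemma nrm1 : nrm (1 : C) = 1.
Proof. by rewrite /nrm normr1. Qed.

Lemma nrm_inv (c : C) : nrm c^-1 = (nrm c)^-1.
Proof. by have := normfV c; rewrite !nrmE -fmorphV => -[]. Qed.

Lemma nrm_sqr (c : C) : nrm c ^+ 2 = complex.Re c ^+ 2 + complex.Im c ^+ 2.
Proof.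
have := add_Re2_Im2 c; rewrite nrmE -rmorphXn /= => -[]->//.
Qed.

Lemma nrm_Re (c : C) : `|complex.Re c| <= nrm c.
Proof. by have := normc_ge_Re c; rewrite nrmE lecR. Qed.

Lemma nrm_Im (c : C) : `|complex.Im c| <= nrm c.
Proof.
rewrite -(ler_pXn2r (ltn0Sn 1)) ?nnegrE ?nrm_ge0 // nrm_sqr.
by rewrite real_normK ?num_real // lerDr sqr_ge0.
Qed.

Lemma nrm_le_ReIm (c : C) : nrm c <= `|complex.Re c| + `|complex.Im c|.
Proof.
rewrite -(ler_pXn2r (ltn0Sn 1)) ?nnegrE ?nrm_ge0 ?addr_ge0 // nrm_sqr.
rewrite sqrrD !real_normK ?num_real // lerD2r lerDl.
by rewrite mulrn_wge0 // mulr_ge0.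
Qed.

(** Positivity in [R[i]] forces a zero imaginary part, so the complex epsilons of the normed space
    reduce to real ones. *)
Lemma cvg_nrmP (V : normedModType C) (I : Type) (F : set_system I)
  {FF : Filter F} (f : I -> V) (l : V) :
  f @ F --> l <-> forall e : R, 0 < e -> \forall x \near F, nrm (l - f x) < e.
Proof.
split=> [cf e e0|h].
  have e0' : (0 : C) < e%:C by rewrite ltcR.
  apply: filterS (cvgr_dist_lt _ _ cf _ e0') => x.
  by rewrite nrmE ltcR.
apply/cvgrPdist_lt => e e0.
have er : e = (complex.Re e)%:C.
  by case: e e0 => a b; rewrite ltcE /= => /andP[/eqP -> _].
move: e0; rewrite er ltcR => e0.
by apply: filterS (h _ e0) => x; rewrite nrmE ltcR.
Qed.

End NormReal.

Section EsumExtra.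
Variable R : realType.
Implicit Types (I J : choiceType).
Local Open Scope ereal_scope.

Lemma esum_fset_le I (a : I -> \bar R) (F : {fset I}) :
  (\sum_(i <- F) a i)%R <= \esum_(i in setT) a i.
Proof.
apply: esum_ge; exists [set` F]; first by split.
by rewrite fsbig_finite //= set_fsetK.
Qed.

Lemma esum_leP I (a : I -> \bar R) (x : \bar R) :
  (forall F : {fset I}, (\sum_(i <- F) a i)%R <= x) ->
  \esum_(i in setT) a i <= x.
Proof.
move=> h; apply: ge_ereal_sup => _ [F [finF _]] <-.
by rewrite fsbig_finite //=.
Qed.

Lemma esum_ge1 I (a : I -> \bar R) i : a i <= \esum_(i in setT) a i.
Proof. by have := esum_fset_le a [fset i]%fset; rewrite big_seq_fset1. Qed.

Lemma esumT_ge0 I (a : I -> \bar R) : (forall i, 0 <= a i) ->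
  0 <= \esum_(i in setT) a i.
Proof. by move=> h; apply: esum_ge0 => i _. Qed.

Lemma le_esumT I (a b : I -> \bar R) : (forall i, a i <= b i) ->
  \esum_(i in setT) a i <= \esum_(i in setT) b i.
Proof. by move=> h; apply: le_esum => i _. Qed.

(** Tonelli, through the sum over pairs and the swap of the two coordinates. *)
Lemma esumT_exchange I J (a : I -> J -> \bar R) : (forall i j, 0 <= a i j) ->
  \esum_(i in setT) \esum_(j in setT) a i j =
  \esum_(j in setT) \esum_(i in setT) a i j.
Proof.
move=> a0; rewrite esum_esum // esum_esum //.
rewrite (reindex_esum ([set: J] `*`` (fun=> [set: I])) ([set: I] `*`` (fun=> [set: J]))
  (fun x => (x.2, x.1))) //.
split=> //=.
- by move=> x y _ _ /= [h1 h2]; case: x y h1 h2 => [? ?] [? ?] /= -> ->.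
- by move=> [i j] _; exists (j, i).
Qed.

Lemma esumTZ I (c : R) (a : I -> \bar R) : (0 <= c)%R -> (forall i, 0 <= a i) ->
  \esum_(i in setT) (c%:E * a i) = c%:E * \esum_(i in setT) a i.
Proof.
move=> c0 a0; apply/le_anti/andP; split.
  apply: esum_leP => F; rewrite -ge0_sume_distrr //.
  by rewrite lee_wpmul2l ?lee_fin // esum_fset_le.
have [->|cn0] := eqVneq c 0%R.
  by rewrite mul0e esumT_ge0 // => i; rewrite mul0e.
have {cn0} c0 : (0 < c)%R by rewrite lt_def cn0.
rewrite -lee_pdivlMl //; apply: esum_leP => F.
rewrite lee_pdivlMl // ge0_sume_distrr //.
exact: (esum_fset_le (fun i => c%:E * a i)).
Qed.

Lemma esumTD I (a b : I -> \bar R) : (forall i, 0 <= a i) -> (forall i, 0 <= b i) ->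
  \esum_(i in setT) (a i + b i) = \esum_(i in setT) a i + \esum_(i in setT) b i.
Proof. by move=> a0 b0; apply: esumD => i _. Qed.

(** A finite set whose sum is within [e] of the supremum leaves at most [e] outside: whatever a
    finite set [G] adds to it still fits below the supremum. *)
Lemma esumT_tail I (a : I -> \bar R) (e : R) : (forall i, 0 <= a i) ->
  \esum_(i in setT) a i < +oo -> (0 < e)%R ->
  exists F0 : {fset I}, \esum_(i in setT) (if i \in F0 then 0 else a i) <= e%:E.
Proof.
move=> a0 afin e0.
have afn : \esum_(i in setT) a i \is a fin_num by rewrite ge0_fin_numE // esumT_ge0.
have [_ [F [finF _]] <-] := ub_ereal_sup_adherent e0 afn.
rewrite fsbig_finite //= => Fe; exists (fset_set F).
apply: esum_leP => G.
have : (\sum_(i <- fset_set F) a i + \sum_(i <- G) (if i \in fset_set F then 0 else a i))%R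
   <= \esum_(i in setT) a i.
  apply: le_trans (esum_fset_le a (fset_set F `|` G)%fset).
  rewrite (big_fsetID _ (mem (fset_set F)) (fset_set F `|` G)%fset) /=.
  apply: leeD.
    rewrite le_eqVlt; apply/orP; left; apply/eqP; apply: eq_fbigl => i.
    by rewrite !inE; case: (i \in fset_set F); rewrite ?orbT ?andbF ?andbT ?orTb.
  rewrite (eq_bigr (fun i => if i \notin fset_set F then a i else 0)); last first.
    by move=> i _; case: (i \in fset_set F).
  rewrite -big_mkcond /= -[X in X <= _]big_filter -[X in _ <= X]big_filter.
  rewrite le_eqVlt; apply/orP; left; apply/eqP; apply: perm_big.
  apply: uniq_perm; rewrite ?filter_uniq ?fset_uniq // => i.
  by rewrite !mem_filter /= !inE; case: (i \in fset_set F); rewrite ?andbF ?andbT //=.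
have Ffin : (\sum_(i <- fset_set F) a i)%R \is a fin_num.
  rewrite ge0_fin_numE ?sume_ge0 //.
  exact: le_lt_trans (esum_fset_le a _) afin.
move=> h; move: Fe; rewrite EFinN lteBlDr // => /ltW Fe.
have := le_trans h Fe; rewrite leeD2lE //.
Qed.

End EsumExtra.

Section Sums.
Variables (R : realType).
Local Notation C := R[i].
Implicit Types (I J : choiceType).

Lemma psumE I (V : zmodType) (f : I -> V) (A : {fset I}) :
  partial_sum f A = \sum_(i <- A) f i.
Proof. by rewrite /partial_sum big_seq_fsetE. Qed.

Lemma sum_fsubset I (V : zmodType) (f : I -> V) (A B : {fset I}) :
  (A `<=` B)%fset ->
  \sum_(i <- B) f i = \sum_(i <- A) f i + \sum_(i <- (B `\` A)%fset) f i.
Proof.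
move=> AB; rewrite (big_fsetID _ (mem A) B) /=; congr (_ + _).
  by apply: eq_fbigl => i; rewrite !inE andb_idl // => /(fsubsetP AB).
by apply: eq_fbigl => i; rewrite !inE andbC.
Qed.

Lemma sum_fset_disj I (V : zmodType) (f : I -> V) (A B : {fset I}) :
  (forall i, i \in B -> i \notin A) ->
  \sum_(i <- B) f i = \sum_(i <- B) (if i \in A then 0 else f i).
Proof.
move=> h; rewrite big_seq [RHS]big_seq; apply: eq_bigr => i iB.
by rewrite (negbTE (h _ iB)).
Qed.

Definition nsum I (V : normedModType C) (f : I -> V) : \bar R :=
  \esum_(i in setT) (nrm (f i))%:E.

Section Cauchy.
Variables (V : completeNormedModType C).

(** A partial sum beyond [F0] differs from the one on [F0] by a sum over indices outside [F0]. This
    form does not ask for absolute convergence: [opL2_cvg] applies it to a series controlled by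
    orthogonality. *)
Lemma psum_cauchy I (f : I -> V) :
  (forall e : R, 0 < e -> exists F0 : {fset I}, forall F : {fset I},
     (forall i, i \in F -> i \notin F0) -> nrm (\sum_(i <- F) f i) <= e) ->
  partial_sum f @ totally --> summability.sum f.
Proof.
move=> h; rewrite /summability.sum.
have PF : ProperFilter (partial_sum f @ totally) by apply: fmap_proper_filter; exact: totally_filter.
apply: cauchy_cvg; apply: cauchy_exP => e e0.
have er : e = (complex.Re e)%:C.
  by case: e e0 => a b; rewrite ltcE /= => /andP[/eqP -> _].
move: e0; rewrite er ltcR => e0.
have [F0 hF0] := h (complex.Re e / 2) (divr_gt0 e0 (ltr0Sn _ _)).
exists (partial_sum f F0), F0 => //= B /= F0B.
rewrite -ball_normE /= nrmE ltcR nrmC !psumE (sum_fsubset _ F0B) addrAC subrr add0r.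
apply: le_lt_trans (hF0 _ _) _; last by rewrite ltr_pdivrMr // ltr_pMr // ltr1n.
by move=> i; rewrite inE => /andP[].
Qed.

Lemma nsum_cvg I (f : I -> V) : (nsum f < +oo)%E ->
  partial_sum f @ totally --> summability.sum f.
Proof.
move=> hf; apply: psum_cauchy => e e0.
have [|F0 hF0] := esumT_tail _ hf e0; first by move=> i; rewrite lee_fin nrm_ge0.
exists F0 => F hF; rewrite -lee_fin; apply: le_trans hF0.
apply: le_trans (esum_fset_le _ F).
rewrite (@eq_bigr _ _ _ _ _ _ _ (fun i => (if i \in F0 then 0 else nrm (f i))%:E)); last first.
  by move=> i _; case: ifP.
rewrite sumEFin lee_fin (le_trans (nrm_sum _ _)) //.
by rewrite (sum_fset_disj _ hF).
Qed.

End Cauchy.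

Section Limits.
Variables (V : normedModType C).

Lemma psum_uniq I (f : I -> V) (v w : V) :
  partial_sum f @ totally --> v -> partial_sum f @ totally --> w -> v = w.
Proof.
move=> fv fw; have := totally_filter; move/(_ I) => PF.
exact: (cvg_unique (@norm_hausdorff _ V) fv fw).
Qed.

Lemma psum_sum I (f : I -> V) (v : V) :
  partial_sum f @ totally --> v -> summability.sum f = v.
Proof.
move=> fv; have FT := @totally_filter I.
exact: (cvg_lim (@norm_hausdorff _ V) fv).
Qed.

(** The constant [K] serves to pass to the limit and is absent from the bound, which only sees the
    images of the terms. With [phi] a single coefficient, these are far smaller than [K] times the
    norms. *)
Lemma psum_phi_le I (f : I -> V) (v : V) (W : normedZmodType C) (phi : V -> W) (K : R) :
  (forall x y, phi (x + y) = phi x + phi y) -> phi 0 = 0 ->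
  (forall x, nrm (phi x) <= K * nrm x) ->
  partial_sum f @ totally --> v ->
  ((nrm (phi v))%:E <= \esum_(i in setT) (nrm (phi (f i)))%:E)%E.
Proof.
move=> phiD phi0 phiK fv; set S := (X in (_ <= X)%E).
have S0 : (0 <= S)%E by apply: esumT_ge0 => i; rewrite lee_fin nrm_ge0.
have [|] := leP (+oo%E) S.
  by rewrite leye_eq => /eqP ->; rewrite leey.
move=> hS; have hSn : S \is a fin_num by rewrite ge0_fin_numE.
rewrite -(fineK hSn) lee_fin; apply/ler_addgt0Pr => e e0.
have FT := @totally_filter I.
have K0 : 0 < `|K| + 1 by rewrite ltr_wpDl.
move/cvg_nrmP: fv => /(_ (e / (`|K| + 1)) (divr_gt0 e0 K0)) [A _ hA].
have := hA A; rewrite /= fsubset_refl => /(_ isT).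
rewrite psumE ltr_pdivlMr // => h; rewrite -(subrK (\sum_(i <- A) f i) v) addrC phiD.
apply: le_trans (nrmD _ _) _; rewrite lerD //; last first.
  rewrite (le_trans (phiK _)) // ltW // (le_lt_trans _ h) // mulrC.
  by rewrite ler_wpM2l ?nrm_ge0 // (le_trans (ler_norm _)) // lerDl.
rewrite -lee_fin fineK //; apply: le_trans (esum_fset_le _ A).
by rewrite sumEFin lee_fin (big_morph phi phiD phi0) nrm_sum.
Qed.

Lemma psum_nrm_le I (f : I -> V) (v : V) :
  partial_sum f @ totally --> v -> ((nrm v)%:E <= nsum f)%E.
Proof. by apply: (@psum_phi_le _ _ _ V id 1) => // x; rewrite mul1r. Qed.

Lemma psum_lin I (f : I -> V) (v : V) (W : normedModType C) (phi : V -> W) (K : R) :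
  (forall x y, phi (x + y) = phi x + phi y) -> phi 0 = 0 ->
  (forall x, nrm (phi x) <= K * nrm x) ->
  partial_sum f @ totally --> v ->
  partial_sum (fun i => phi (f i)) @ totally --> phi v.
Proof.
move=> phiD phi0 phiK fv.
have phiN x : phi (- x) = - phi x.
  by apply/eqP; rewrite -addr_eq0 -phiD addNr phi0.
have FT := @totally_filter I.
apply/cvg_nrmP => e e0.
have K0 : 0 < `|K| + 1 by rewrite ltr_wpDl.
move/cvg_nrmP: fv => /(_ (e / (`|K| + 1)) (divr_gt0 e0 K0)).
apply: filterS => A; rewrite !psumE ltr_pdivlMr // => h.
rewrite -(big_morph phi phiD phi0) -phiN -phiD (le_lt_trans (phiK _)) //.
apply: le_lt_trans h; rewrite mulrC ler_wpM2l ?nrm_ge0 //.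
by rewrite (le_trans (ler_norm _)) // lerDl.
Qed.

Lemma psum_lincomb I (f g : I -> V) (v w : V) (c : C) :
  partial_sum f @ totally --> v -> partial_sum g @ totally --> w ->
  partial_sum (fun i => c *: f i + g i) @ totally --> c *: v + w.
Proof.
move=> fv gw; have FT := @totally_filter I.
have -> : partial_sum (fun i => c *: f i + g i) =
   (fun A => c *: partial_sum f A + partial_sum g A).
  by apply/funext => A; rewrite !psumE big_split /= -scaler_sumr.
by apply: cvgD => //; apply: cvgZr.
Qed.

Lemma psum_zero I : partial_sum (fun _ : I => 0 : V) @ totally --> (0 : V).
Proof.
have FT := @totally_filter I; apply/cvg_nrmP => e e0; exists fset0 => //= A _.
by rewrite psumE big1 // subr0 nrm0.
Qed.

Lemma psum_bigsum I (K : Type) (s : seq K) (f : K -> I -> V) (v : K -> V) :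
  (forall k, partial_sum (f k) @ totally --> v k) ->
  partial_sum (fun i => \sum_(k <- s) f k i) @ totally --> \sum_(k <- s) v k.
Proof.
move=> h; elim: s => [|k s IH].
  rewrite big_nil (_ : (fun i => _) = fun=> 0); first exact: psum_zero.
  by apply/funext => i; rewrite big_nil.
rewrite big_cons (_ : (fun i => _) = fun i => 1 *: f k i + \sum_(k <- s) f k i).
  by rewrite -[v k]scale1r; apply: psum_lincomb.
by apply/funext => i; rewrite big_cons scale1r.
Qed.

Lemma psum_reindex I J (h : I -> J) (f : J -> V) (v : V) :
  bijective h -> partial_sum f @ totally --> v ->
  partial_sum (fun i => f (h i)) @ totally --> v.
Proof.
move=> [g hg gh] fv; have FJ := @totally_filter J; have FI := @totally_filter I.
apply/cvg_nrmP => e e0; move/cvg_nrmP: fv => /(_ e e0)[A _ hA].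
exists [fset g j | j in A]%fset => //= B /= AB.
have := hA [fset h i | i in B]%fset; rewrite /= !psumE.
rewrite big_imfset /=; last by move=> i j _ _ /(can_inj hg).
apply; apply/fsubsetP => j jA; apply/imfsetP; exists (g j) => //=.
by apply: (fsubsetP AB); apply/imfsetP; exists j.
Qed.

End Limits.

End Sums.

Lemma inv_le_ratio (R : realType) (a b c d : R) : 0 < a -> 0 < b ->
  b <= a * c -> c <= d -> a^-1 <= d * b^-1.
Proof.
move=> a0 b0 h cd; rewrite ler_pdivlMr // mulrC ler_pdivrMr // (le_trans h) //.
by rewrite mulrC ler_wpM2r // ltW.
Qed.

(** * Polynomial weights on the lattice *)

Section Weights.
Variables (R : realType) (n : nat).
Local Notation Zn := 'rV[int]_n.
Implicit Types (k l p : Zn).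

(** The norm is the sup norm of matrices, which is directly comparable with each coordinate; [enorm]
    is compared with it where the statement imposes the Euclidean norm. *)
Definition wt k : R := 1 + `|lattice R k|.
Definition jp (s : R) k : R := wt k `^ s.

Lemma wt_ge1 k : 1 <= wt k. Proof. by rewrite lerDl. Qed.
Lemma wt_gt0 k : 0 < wt k. Proof. exact: lt_le_trans ltr01 (wt_ge1 k). Qed.

Lemma latticeD k l : lattice R (k + l) = lattice R k + lattice R l.
Proof. by apply/rowP => j; rewrite !mxE rmorphD. Qed.

Lemma latticeN k : lattice R (- k) = - lattice R k.
Proof. by apply/rowP => j; rewrite !mxE rmorphN. Qed.

Lemma lattice0 : lattice R (0 : Zn) = 0.
Proof. by apply/rowP => j; rewrite !mxE. Qed.

Lemma wt0 : wt 0 = 1. Proof. by rewrite /wt lattice0 normr0 addr0. Qed.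

Lemma wtN k : wt (- k) = wt k. Proof. by rewrite /wt latticeN normrN. Qed.

Lemma wtD k l : wt (k + l) <= wt k * wt l.
Proof.
rewrite /wt latticeD mulrDl mul1r mulrDr mulr1 addrACA -addrA lerD2l.
apply: (le_trans (ler_normD _ _)); rewrite [X in _ <= X]addrCA addrA -[X in X <= _]addr0.
by rewrite lerD // ?mulr_ge0 // addrC.
Qed.

Lemma coord_le (x : 'rV[R]_n) j : `|x 0 j| <= `|x|.
Proof.
rewrite [leRHS]/Num.norm /= mx_normrE.
by rewrite (le_trans _ (le_bigmax _ _ (0, j))).
Qed.

Lemma jp_gt0 s k : 0 < jp s k. Proof. by rewrite powR_gt0 // wt_gt0. Qed.
Lemma jp_ge0 s k : 0 <= jp s k. Proof. exact/ltW/jp_gt0. Qed.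
Lemma jp0 k : jp 0 k = 1. Proof. by rewrite /jp powRr0. Qed.
Lemma jpz s : jp s 0 = 1. Proof. by rewrite /jp wt0 powR1. Qed.
Lemma jpA s t k : jp (s + t) k = jp s k * jp t k.
Proof. by rewrite /jp powRD // (gt_eqF (wt_gt0 k)) implybT. Qed.
Lemma jp_le s t k : s <= t -> jp s k <= jp t k.
Proof. by move=> st; rewrite /jp ler_powR // wt_ge1. Qed.
Lemma jp_ge1 s k : 0 <= s -> 1 <= jp s k.
Proof. by move=> s0; rewrite -(jp0 k) jp_le. Qed.
Lemma jpN s k : jp (- s) k = (jp s k)^-1. Proof. by rewrite /jp powRN. Qed.

(** Peetre's inequality: for [t >= 0] it is the submultiplicativity of [wt]; for [t < 0] the same is
    applied to [l = (p + l) - p] and the weights are inverted. *)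
Lemma peetre t N p l : `|t| <= N -> jp t (p + l) <= jp N p * jp t l.
Proof.
move=> tN; have [t0|t0] := leP 0 t.
  have h : jp t (p + l) <= jp t p * jp t l.
    rewrite /jp -powRM ?(ltW (wt_gt0 _)) //.
    by rewrite ge0_ler_powR ?nnegrE ?mulr_ge0 ?(ltW (wt_gt0 _)) ?wtD.
  apply: le_trans h _; rewrite ler_wpM2r ?jp_ge0 // jp_le //.
  by apply: le_trans tN; rewrite ler_norm.
have h : jp (- t) l <= jp (- t) (p + l) * jp (- t) p.
  rewrite /jp -powRM ?(ltW (wt_gt0 _)) //.
  rewrite ge0_ler_powR ?nnegrE ?mulr_ge0 ?(ltW (wt_gt0 _)) //; first by rewrite oppr_ge0 ltW.
  by have := wtD (p + l) (- p); rewrite wtN addrAC subrr add0r.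
have h2 : jp (- t) p <= jp N p by rewrite jp_le // -(ltr0_norm t0).
have E k : jp t k = (jp (- t) k)^-1 by rewrite jpN invrK.
rewrite (E l) (E (p + l)); exact: inv_le_ratio (jp_gt0 _ _) (jp_gt0 _ _) h h2.
Qed.

Lemma sum_inv_sqr_nat (A : {fset nat}) :
  \sum_(m <- A) ((1 + m%:R : R) ^- 2) <= 2.
Proof.
(* Telescoping comparison: [(1 + x) ^- 2] is at most [2 / ((1 + x) * (2 + x))], which is
   [2 / (1 + x) - 2 / (2 + x)]. *)
have key (x : R) : 0 <= x -> - (2 / (1 + x)) + (1 + x) ^- 2 <= - (2 / (1 + (x + 1))).
  move=> x0; rewrite -subr_ge0.
  have -> : - (2 / (1 + (x + 1))) - (- (2 / (1 + x)) + (1 + x) ^- 2)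
      = x / ((2 + x) * (1 + x) ^+ 2).
    by field; apply/andP; split; apply: lt0r_neq0; lra.
  by rewrite divr_ge0 // mulr_ge0 // ?exprn_ge0 // addr_ge0.
have h M : \sum_(m < M) ((1 + m%:R : R) ^- 2) <= 2 - 2 / (1 + M%:R).
  elim: M => [|M IH]; first by rewrite big_ord0 addr0 divr1 subrr.
  rewrite big_ord_recr /=; apply: (le_trans (lerD IH (lexx _))).
  rewrite -addrA lerD2l -[M.+1%:R]natr1.
  exact: key.
pose M := (\max_(m <- A) m)%N.+1.
have -> : \sum_(m <- A) ((1 + m%:R : R) ^- 2) =
    \sum_(m <- iota 0 M | m \in A) ((1 + m%:R : R) ^- 2).
  rewrite -[RHS]big_filter; apply: perm_big; apply: uniq_perm.
  - exact: fset_uniq.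
  - by rewrite filter_uniq // iota_uniq.
  move=> m; rewrite mem_filter; case mA: (m \in A) => //.
  by rewrite andTb mem_iota leq0n add0n ltnS; exact/esym/(@leq_bigmax_seq _ _ xpredT id m mA).
apply: (@le_trans _ _ (2 - 2 / (1 + M%:R))); last by rewrite gerBl divr_ge0 // addr_ge0.
apply: le_trans (h M).
rewrite -(big_mkord xpredT (fun m => (1 + m%:R : R) ^- 2)) /index_iota subn0 big_mkcond.
by apply: ler_sum => m _; case: ifP => // _; rewrite invr_ge0 exprn_ge0 // addr_ge0.
Qed.

(** On each sign [absz] is injective, so each half is a sum over distinct naturals. *)
Lemma sum_inv_sqr_int (A : {fset int}) :
  \sum_(m <- A) ((1 + `|m%:~R| : R) ^- 2) <= 4.
Proof.
have half (B : {fset int}) : {in B &, injective absz} ->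
    \sum_(m <- B) ((1 + `|m%:~R| : R) ^- 2) <= 2.
  move=> inj; apply: le_trans (sum_inv_sqr_nat [fset absz m | m in B]%fset).
  rewrite big_imfset //= le_eqVlt; apply/orP; left; apply/eqP; apply: eq_bigr => m _.
  by rewrite natr_absz intr_norm.
rewrite (big_fsetID _ (fun m => 0 <= m) A) /= (_ : 4 = 2 + 2 :> R); last by lra.
apply: lerD; apply: half => x y; rewrite !inE /= => /andP[_ hx] /andP[_ hy] hxy.
  by rewrite -(gez0_abs hx) -(gez0_abs hy) hxy.
have hx' : x <= 0 by rewrite ltW // ltNge.
have hy' : y <= 0 by rewrite ltW // ltNge.
by rewrite -[x]opprK -[y]opprK -(lez0_abs hx') -(lez0_abs hy') hxy.
Qed.

(** This is where the exponent [2 * n] of the whole proof comes from: the weight is dominated by the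
    product of the [(1 + |k_j|) ^- 2], and the sum of such a product over a box is a product of
    one-dimensional sums. *)
Lemma esum_jp_fin : (\esum_(k in [set: Zn]) (jp (- (2 * n%:R)) k)%:E < +oo)%E.
Proof.
apply: (@le_lt_trans _ _ (4 ^+ n)%:E); last by rewrite ltry.
apply: esum_leP => F; rewrite sumEFin lee_fin.
pose X := [fset (k : Zn) 0 j | k in F, j in 'I_n]%fset.
pose g (x : int) : R := (1 + `|x%:~R|) ^- 2.
have g0 x : 0 <= g x by rewrite invr_ge0 exprn_ge0 // addr_ge0.
apply: (@le_trans _ _ (\sum_(k <- F) \prod_(j < n) g (k 0 j))).
  apply: ler_sum => k _.
  have -> : jp (- (2 * n%:R)) k = \prod_(j < n) (wt k ^+ 2)^-1.
    have w0 := ltW (wt_gt0 k).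
    by rewrite prodr_const card_ord jpN /jp powRrM !powR_mulrn ?exprVn ?exprn_ge0.
  apply: ler_prod => j _; apply/andP; split.
    by rewrite invr_ge0 exprn_ge0 // ltW // wt_gt0.
  have g1 : 0 < 1 + `|(k 0 j)%:~R| :> R by rewrite ltr_wpDr.
  rewrite /g lef_pV2 ?posrE ?exprn_gt0 ?wt_gt0 //.
  rewrite ler_pXn2r ?nnegrE ?(ltW g1) ?(ltW (wt_gt0 k)) // lerD2l.
  by have := coord_le (lattice R k) j; rewrite mxE.
apply: (@le_trans _ _ (\prod_(j < n) \sum_(x : X) g (val x))).
  rewrite bigA_distr_bigA /=.
  have kX (k : F) j : val k 0 j \in X.
    by apply/imfset2P; exists (val k); [exact: valP | exists j].
  pose h (k : F) : {ffun 'I_n -> X} := [ffun j => [` kX k j]%fset].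
  have hinj : injective h.
    move=> k k' /ffunP hk; apply/val_inj/rowP => j; have := hk j.
    by rewrite !ffunE => /(congr1 val).
  rewrite big_seq_fsetE /=.
  have -> : \sum_(k : F) \prod_(j < n) g (val k 0 j) =
      \sum_(f in h @: predT) \prod_(j < n) g (val (f j)).
    rewrite big_imset /=; last by move=> x y _ _; exact: hinj.
    apply: eq_big => [k|k _]; first by rewrite inE.
    apply: eq_bigr => j _.
    by rewrite ffunE.
  rewrite [leRHS](bigID (mem (h @: predT))) /= lerDl sumr_ge0 // => f _.
  exact: prodr_ge0.
rewrite prodr_const card_ord lerXn2r ?nnegrE ?sumr_ge0 //.
by have := sum_inv_sqr_int X; rewrite big_seq_fsetE.
Qed.

End Weights.

(** * Fourier coefficients and weighted norms *)

Section CStar.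
Variables (R : realType) (A : cstarType R).
Local Notation C := R[i].
Implicit Types (a b : A).

Lemma starK a : star (star a) = a. Proof. exact: cs_starK. Qed.
Lemma starM a b : star (a * b) = star b * star a. Proof. exact: cs_starM. Qed.
Lemma starD a b : star (a + b) = star a + star b.
Proof.
have := @cs_star_antilinear R A 1 a b.
by rewrite rmorph1 !scale1r.
Qed.
Lemma star0 : star (0 : A) = 0.
Proof. by apply/(@addrI _ (star 0)); rewrite -starD !addr0. Qed.
Lemma starZ (c : C) a : star (c *: a) = c^* *: star a.
Proof.
have := @cs_star_antilinear R A c a 0.
by rewrite [cs_star 0]star0 !addr0.
Qed.
Lemma star1 : star (1 : A) = 1.
Proof. by have := starM (star 1) 1; rewrite mulr1 starK mulr1. Qed.

Lemma nrmM a b : nrm (a * b) <= nrm a * nrm b.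
Proof. by rewrite -lecR rmorphM /= -!nrmE; exact: cs_normM. Qed.

Lemma nrm_star_mul a : nrm (star a * a) = nrm a ^+ 2.
Proof.
by have := @cs_norm_star R A a; rewrite !nrmE -rmorphXn /= => -[].
Qed.

Lemma nrm_one : nrm (1 : A) = 1.
Proof.
have := nrm_star_mul 1; rewrite star1 mulr1 => h.
have n0 : nrm (1 : A) != 0.
  by apply: contra_neq (oner_neq0 A); exact: nrm_eq0.
by apply: (mulfI n0); rewrite mulr1 -expr2 -h.
Qed.

Lemma nrm_unitary a : unitary a -> nrm a = 1.
Proof.
move=> [h _]; have := nrm_star_mul a; rewrite h nrm_one => /esym/eqP.
by rewrite -[X in _ == X](expr1n _ 2) eqrXn2 ?nrm_ge0 // => /eqP.
Qed.

Lemma nrm_unitary_mulr a b : unitary b -> nrm (a * b) <= nrm a.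
Proof. by move=> ub; rewrite (le_trans (nrmM _ _)) // (nrm_unitary ub) mulr1. Qed.

Lemma unitary1 : unitary (1 : A).
Proof. by rewrite /unitary star1 mulr1. Qed.

Lemma unitary_star a : unitary a -> unitary (star a).
Proof. by move=> [h1 h2]; split; rewrite starK. Qed.

Lemma unitaryM a b : unitary a -> unitary b -> unitary (a * b).
Proof.
move=> [a1 a2] [b1 b2]; split; rewrite starM.
  by rewrite mulrA -(mulrA (star b)) a1 mulr1.
by rewrite mulrA -(mulrA a) b2 mulr1.
Qed.

Lemma unitaryX a p : unitary a -> unitary (a ^+ p).
Proof.
move=> ua; elim: p => [|p IH]; first by rewrite expr0; exact: unitary1.
by rewrite exprS; apply: unitaryM.
Qed.

Lemma unitary_upow a m : unitary a -> unitary (upow a m).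
Proof.
by move=> ua; case: m => p /=; apply: unitaryX => //; exact: unitary_star.
Qed.

Lemma upow_succ a m : unitary a -> upow a (m + 1) = upow a m * a.
Proof.
move=> [h1 h2]; case: m => [p|[|p]].
- by rewrite -PoszD addn1 /= exprSr.
- by rewrite NegzE addNr /= expr1 h1.
- have -> : Negz p.+1 + 1 = Negz p by rewrite !NegzE -(addn1 p.+1) PoszD opprD addrNK.
  by rewrite /= [in RHS]exprSr -mulrA h1 mulr1.
Qed.

Lemma upow_pred a m : unitary a -> upow a (m - 1) = upow a m * star a.
Proof.
move=> ua; rewrite -{2}(subrK 1 m) upow_succ // -mulrA.
by case: ua => _ ->; rewrite mulr1.
Qed.

Lemma upowD a m p : unitary a -> upow a (m + p) = upow a m * upow a p.
Proof.
move=> ua; elim/int_rec: p => [|p IH|p IH].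
- by rewrite addr0 /= mulr1.
- by rewrite -addn1 PoszD addrA !upow_succ // IH mulrA.
- by rewrite -addn1 PoszD opprD addrA !upow_pred // IH mulrA.
Qed.

(** Equality up to a phase. Monomials commute and multiply only up to phases, but only the moduli of
    coefficients enter the estimates, so the phases are never computed. *)
Definition peq a b := exists2 z : C, nrm z = 1 & a = z *: b.

Lemma peq_refl a : peq a a.
Proof. by exists 1; rewrite ?nrm1 ?scale1r. Qed.

Lemma peq_sym a b : peq a b -> peq b a.
Proof.
move=> [z z1 ->]; exists z^-1; first by rewrite nrm_inv z1 invr1.
rewrite scalerA mulVf ?scale1r //.
by apply: contra_eq_neq z1 => ->; rewrite nrm0 eq_sym oner_neq0.
Qed.

Lemma peq_trans a b c : peq a b -> peq b c -> peq a c.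
Proof.
move=> [z z1 ->] [y y1 ->]; exists (z * y); last by rewrite scalerA.
by rewrite nrm_mul z1 y1 mulr1.
Qed.

Lemma peqM a b c d : peq a b -> peq c d -> peq (a * c) (b * d).
Proof.
move=> [z z1 ->] [y y1 ->]; exists (z * y).
  by rewrite nrm_mul z1 y1 mulr1.
by rewrite -scalerAl -scalerAr scalerA.
Qed.

Lemma peq_star a b : peq a b -> peq (star a) (star b).
Proof.
move=> [z z1 ->]; exists z^*; last by rewrite starZ.
by rewrite -z1 /nrm normcJ.
Qed.

Lemma pcomm_expr a b p : peq (a * b) (b * a) -> peq (a ^+ p * b) (b * a ^+ p).
Proof.
move=> h; elim: p => [|p IH]; first by rewrite !expr0 mul1r mulr1; exact: peq_refl.
rewrite !exprS -mulrA; apply: peq_trans (peqM (peq_refl a) IH) _.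
by rewrite !mulrA; apply: peqM h (peq_refl _).
Qed.

Lemma pcomm_star a b : unitary a -> peq (a * b) (b * a) ->
  peq (star a * b) (b * star a).
Proof.
move=> [h1 h2] h; apply: peq_sym.
have := peqM (peqM (peq_refl (star a)) h) (peq_refl (star a)).
by rewrite mulrA h1 mul1r -!mulrA h2 mulr1.
Qed.

Lemma pcomm_upow a b m : unitary a -> peq (a * b) (b * a) ->
  peq (upow a m * b) (b * upow a m).
Proof.
move=> ua h; case: m => p /=; apply: pcomm_expr => //.
exact: pcomm_star.
Qed.

Lemma pcomm_prod (I : Type) (s : seq I) (x : I -> A) b :
  (forall i, peq (x i * b) (b * x i)) ->
  peq ((\prod_(i <- s) x i) * b) (b * \prod_(i <- s) x i).
Proof.
move=> h; elim: s => [|i s IH]; first by rewrite !big_nil mul1r mulr1; exact: peq_refl.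
rewrite !big_cons -mulrA; apply: peq_trans (peqM (peq_refl _) IH) _.
by rewrite !mulrA; apply: peqM (h i) (peq_refl _).
Qed.

Lemma pprod_split (I : Type) (s : seq I) (x y : I -> A) :
  (forall i j, peq (x i * y j) (y j * x i)) ->
  peq (\prod_(i <- s) (x i * y i)) ((\prod_(i <- s) x i) * \prod_(i <- s) y i).
Proof.
move=> h; elim: s => [|i s IH]; first by rewrite !big_nil mulr1; exact: peq_refl.
rewrite !big_cons; apply: peq_trans (peqM (peq_refl _) IH) _.
rewrite -!mulrA; apply: peqM (peq_refl _) _; rewrite !mulrA.
apply: peqM _ (peq_refl _); apply: peq_sym; apply: pcomm_prod => j; exact: h.
Qed.

End CStar.

Lemma nrm_cexp (R : realType) (z : R[i]) : nrm (cexp z) = expR (complex.Re z).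
Proof.
rewrite /cexp nrm_mul nrm_real ger0_norm ?expR_ge0 //.
suff -> : nrm (cos (complex.Im z) +i* sin (complex.Im z)) = 1 by rewrite mulr1.
apply/eqP; rewrite -(@eqrXn2 _ 2) ?nrm_ge0 // nrm_sqr expr1n /=.
by rewrite cos2Dsin2.
Qed.

Section TorusBasics.
Variables (R : realType) (n : nat) (theta : 'M[R]_n) (T : ncTorus theta).
Local Notation C := R[i].
Local Notation Zn := 'rV[int]_n.
Local Notation monom := (monomial (@gen _ _ _ T)).
Implicit Types (k l p : Zn) (u v : T).

Lemma gen_unitary j : unitary (gen T j). Proof. by case: (gen_rel T). Qed.

Lemma gen_pcomm i j : peq (gen T i * gen T j) (gen T j * gen T i).
Proof.
have [_ h] := gen_rel T; rewrite (h j i).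
by exists (cexp (0 +i* (2 * pi * theta j i))) => //; rewrite nrm_cexp /= expR0.
Qed.

Lemma monom_unitary k : unitary (monom k).
Proof.
rewrite /monomial; elim/big_ind: _; [exact: unitary1|exact: unitaryM|].
by move=> j _; apply/unitary_upow/gen_unitary.
Qed.

Lemma monom0 : monom 0 = 1.
Proof. by rewrite /monomial big1 // => j _; rewrite mxE. Qed.

Lemma monomD k l : peq (monom (k + l)) (monom k * monom l).
Proof.
rewrite /monomial (eq_bigr (fun j => upow (gen T j) (k 0 j) * upow (gen T j) (l 0 j))).
  2: by move=> j _; rewrite mxE upowD //; exact: gen_unitary.
apply: pprod_split => i j; apply: pcomm_upow; first exact: gen_unitary.
by apply/peq_sym/pcomm_upow; [exact: gen_unitary|exact: gen_pcomm].
Qed.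

Lemma monom_star k : peq (star (monom k)) (monom (- k)).
Proof.
have h := monomD (- k) k; rewrite addNr monom0 in h.
have := peqM h (peq_refl (star (monom k))).
by rewrite mul1r -mulrA (monom_unitary k).2 mulr1.
Qed.

Lemma monom_mul_star k l : peq (monom k * star (monom l)) (star (monom (l - k))).
Proof.
have h := peq_star (monomD (l - k) k); rewrite subrK starM in h.
apply: peq_trans (peqM (peq_refl _) h) _.
by rewrite mulrA (monom_unitary k).2 mul1r; exact: peq_refl.
Qed.

Lemma monom_star_mul k l : peq (star (monom l) * monom k) (star (monom (l - k))).
Proof.
have h := peq_star (monomD k (l - k)); rewrite addrC subrK starM in h.
apply: peq_trans (peqM h (peq_refl _)) _.
by rewrite -mulrA (monom_unitary k).1 mulr1; exact: peq_refl.
Qed.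

Lemma tauD u v : tau T (u + v) = tau T u + tau T v.
Proof. by rewrite raddfD. Qed.

Lemma tauZ (c : C) u : tau T (c *: u) = c * tau T u.
Proof. by rewrite linearZ. Qed.

Lemma tau_bound : exists2 K : R, 0 <= K & forall u, nrm (tau T u) <= K * nrm u.
Proof.
have := @tau_continuous _ _ _ T 0.
move/cvg_nrmP => /(_ 1 ltr01) /=; rewrite nearE => /nbhs_ballP [d d0 hd].
have dr : d = (complex.Re d)%:C.
  by case: d d0 {hd} => a b; rewrite /= ltcE /= => /andP[/eqP -> _].
move: d0 hd; rewrite dr /= ltcR => d0 hd.
exists (2 / complex.Re d) => [|u]; first by rewrite divr_ge0 // ltW.
have [->|u0] := eqVneq u 0; first by rewrite raddf0 !nrm0 mulr0.
have nu : 0 < nrm u.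
  by rewrite lt_def nrm_ge0 andbT; apply: contra_neq u0; exact: nrm_eq0.
pose c := complex.Re d / (2 * nrm u).
have c0 : 0 < c by rewrite divr_gt0 // mulr_gt0.
have : ball (0 : T) (complex.Re d)%:C (c%:C *: u).
  rewrite -ball_normE /= sub0r normrN nrmE ltcR nrmZ nrm_real gtr0_norm //.
  by rewrite /c invfM mulrA mulfVK ?gt_eqF // ltr_pdivrMr // ltr_pMr // ltr1n.
move=> /hd /=; rewrite raddf0 sub0r nrmN tauZ nrm_mul nrm_real gtr0_norm // => /ltW h.
have := ler_wpM2l (ltW c0) ; rewrite -ler_pdivlMl // mulr1 in h.
move=> _; apply: le_trans h _; rewrite /c invf_div mulrAC lexx //.
Qed.

End TorusBasics.

Section Fourier.
Variables (R : realType) (n : nat) (theta : 'M[R]_n) (T : ncTorus theta).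
Local Notation C := R[i].
Local Notation Zn := 'rV[int]_n.
Local Notation monom := (monomial (@gen _ _ _ T)).
Implicit Types (k l p : Zn) (u v w : T) (c d : Zn -> C) (s t : R).

Lemma coefD u v k : coef (u + v) k = coef u k + coef v k.
Proof. by rewrite /coef mulrDl tauD. Qed.

Lemma coefZ (z : C) u k : coef (z *: u) k = z * coef u k.
Proof. by rewrite /coef -scalerAl tauZ. Qed.

Lemma coef0 k : coef (0 : T) k = 0.
Proof. by rewrite /coef mul0r raddf0. Qed.

Lemma coefN u k : coef (- u) k = - coef u k.
Proof. by rewrite -scaleN1r coefZ mulN1r. Qed.

Lemma coefB u v k : coef (u - v) k = coef u k - coef v k.
Proof. by rewrite coefD coefN. Qed.

Lemma coef_sum (I : Type) (r : seq I) (f : I -> T) k :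
  coef (\sum_(i <- r) f i) k = \sum_(i <- r) coef (f i) k.
Proof.
apply: (big_morph (fun u => coef u k)) => [u v|]; [exact: coefD|exact: coef0].
Qed.

Lemma coef_bound : exists2 K : R, 0 <= K & forall u k, nrm (coef u k) <= K * nrm u.
Proof.
have [K K0 hK] := tau_bound T; exists K => // u k.
apply: le_trans (hK _) _; rewrite ler_wpM2l // nrm_unitary_mulr //.
exact/unitary_star/monom_unitary.
Qed.

Lemma nrm_tau_peq u v : peq u v -> nrm (tau T u) = nrm (tau T v).
Proof. by move=> [z z1 ->]; rewrite tauZ nrm_mul z1 mul1r. Qed.

Lemma tau1 : tau T 1 = 1.
Proof. by have := tau_monomial T 0; rewrite monom0 eqxx. Qed.

Lemma coef_monom k l : coef (monom k) l = (l == k)%:R.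
Proof.
rewrite /coef; have [->|lk] := eqVneq l k; first by rewrite (monom_unitary T k).2 tau1.
apply: nrm_eq0; have := peq_trans (monom_mul_star T k l) (monom_star T (l - k)).
move=> /nrm_tau_peq ->; rewrite tau_monomial oppr_eq0 subr_eq0 (negbTE lk).
exact: nrm0.
Qed.

Lemma nrm_coef_mulr u k l : nrm (coef (u * monom k) l) = nrm (coef u (l - k)).
Proof.
rewrite /coef -mulrA; apply: nrm_tau_peq; apply: peqM; first exact: peq_refl.
exact: monom_mul_star.
Qed.

(** The trace property carries [monom k] to the right of [u], so multiplication by a monomial on
    either side translates the moduli of the coefficients. *)
Lemma nrm_coef_mull u k l : nrm (coef (monom k * u) l) = nrm (coef u (l - k)).
Proof.
rewrite /coef -mulrA tau_tracial -mulrA; apply: nrm_tau_peq.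
by apply: peqM; [exact: peq_refl|exact: monom_star_mul].
Qed.

Definition fourier_sums c := partial_sum (fun k : Zn => c k *: monom k).

Lemma coef_fourier c (A : {fset Zn}) l :
  coef (fourier_sums c A) l = if l \in A then c l else 0.
Proof.
rewrite /fourier_sums psumE coef_sum.
rewrite (eq_bigr (fun k => if k == l then c l else 0)); last first.
  move=> k _; rewrite coefZ coef_monom [l == k]eq_sym.
  by case: eqP => [->|_]; rewrite ?mulr1 ?mulr0.
case: ifPn => lA; last first.
  rewrite big_seq big1 // => k kA; case: eqP => // kl.
  by rewrite -kl kA in lA.
by rewrite (big_fsetD1 l) //= eqxx big_seq big1 ?addr0 // => k; rewrite !inE => /andP[/negbTE ->].
Qed.

Lemma coef_cvg c u : fourier_sums c @ totally --> u -> coef u = c.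
Proof.
move=> cu; apply/funext => l; have [K K0 hK] := coef_bound.
apply/eqP; rewrite -subr_eq0; apply/eqP/nrm_eq0/le_anti; rewrite nrm_ge0 andbT.
apply/ler_addgt0Pr => e e0; rewrite add0r.
have FT := @totally_filter Zn.
have K1 : 0 < K + 1 by rewrite ltr_wpDl.
move/cvg_nrmP: cu => /(_ (e / (K + 1)) (divr_gt0 e0 K1)) [A _ hA].
have := hA (l |` A)%fset; rewrite /= fsubsetU1 => /(_ isT).
rewrite ltr_pdivlMr // => h.
have := hK (u - fourier_sums c (l |` A)%fset) l.
rewrite coefB coef_fourier fset1U1 => h2; apply: le_trans h2 _.
by apply/ltW/(le_lt_trans _ h); rewrite mulrC ler_wpM2l ?nrm_ge0 // lerDl.
Qed.

(** Faithfulness of [tau] is not among the axioms of the torus, so [coef] is not known to be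
    injective. Elements are compared through [fsummable_inj], once both are known to be the sums of
    their Fourier series. *)
Definition fsummable u := fourier_sums (coef u) @ totally --> u.

Lemma fsummable_cvg c u : fourier_sums c @ totally --> u -> fsummable u.
Proof. by move=> h; rewrite /fsummable (coef_cvg h). Qed.

Lemma fsummable_inj u v : fsummable u -> fsummable v -> coef u = coef v -> u = v.
Proof. by rewrite /fsummable => hu hv uv; rewrite uv in hu; apply: psum_uniq hu hv. Qed.

Lemma fsummable_lin (z : C) u v : fsummable u -> fsummable v -> fsummable (z *: u + v).
Proof.
move=> hu hv; apply: (@fsummable_cvg (fun k => z * coef u k + coef v k)).
have := psum_lincomb (c := z) hu hv; rewrite /fourier_sums.
rewrite (_ : (fun k => _) = (fun k => (z * coef u k + coef v k) *: monom k)) //.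
by apply/funext => k; rewrite scalerDl scalerA.
Qed.

Lemma fsummableB u v : fsummable u -> fsummable v -> fsummable (u - v).
Proof. by move=> hu hv; rewrite addrC -scaleN1r; apply: fsummable_lin. Qed.

Lemma fsummable0 : fsummable 0.
Proof.
apply: (@fsummable_cvg (fun=> 0)).
rewrite /fourier_sums (_ : (fun k => _) = fun=> 0); first exact: psum_zero.
by apply/funext => k; rewrite scale0r.
Qed.

Lemma fsummable_monom l : fsummable (monom l).
Proof.
rewrite /fsummable; have FT := @totally_filter Zn.
apply/cvg_nrmP => e e0; exists [fset l]%fset => //= A /=; rewrite fsub1set => lA.
rewrite /fourier_sums psumE (big_fsetD1 l) //= coef_monom eqxx scale1r.
rewrite big_seq big1 ?addr0 ?subrr ?nrm0 // => k; rewrite !inE => /andP[kl _].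
by rewrite coef_monom (negbTE kl) scale0r.
Qed.

(* The weighted l1 norms stand in for the norms of the derivations: they control
   the C*-norm, and left multiplication is a convolution for them. *)
Definition wn s c : \bar R := \esum_(k in setT) (jp s k * nrm (c k))%:E.

Lemma wn_ge0 s c : (0 <= wn s c)%E.
Proof. by apply: esumT_ge0 => k; rewrite lee_fin mulr_ge0 ?jp_ge0 ?nrm_ge0. Qed.

Lemma wn_coord s c k : ((jp s k * nrm (c k))%:E <= wn s c)%E.
Proof. exact: (esum_ge1 (fun k => (jp s k * nrm (c k))%:E)). Qed.

Lemma le_wn s t c : s <= t -> (wn s c <= wn t c)%E.
Proof.
by move=> st; apply: le_esumT => k; rewrite lee_fin ler_wpM2r ?nrm_ge0 // jp_le.
Qed.

Lemma wnD s c d : (wn s (fun k => c k + d k)%R <= wn s c + wn s d)%E.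
Proof.
rewrite /wn -esumTD.
- by apply: le_esumT => k; rewrite -EFinD lee_fin -mulrDr ler_wpM2l ?jp_ge0 ?nrmD.
- by move=> k; rewrite lee_fin mulr_ge0 ?jp_ge0 ?nrm_ge0.
- by move=> k; rewrite lee_fin mulr_ge0 ?jp_ge0 ?nrm_ge0.
Qed.

Lemma wnZ s (z : C) c : wn s (fun k => z * c k) = ((nrm z)%:E * wn s c)%E.
Proof.
rewrite /wn -esumTZ ?nrm_ge0 //.
  by congr (esum _ _); apply/funext => k; rewrite -EFinM nrm_mul mulrCA.
by move=> k; rewrite lee_fin mulr_ge0 ?jp_ge0 ?nrm_ge0.
Qed.

(** Passes from a supremum bound to an l1 bound, at the price of the summable weight [- 2 n]. *)
Lemma wn_dom s c M : (forall k, jp (s + 2 * n%:R) k * nrm (c k) <= M) ->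
  (wn s c <= M%:E * \esum_(k in [set: Zn]) (jp (- (2 * n%:R)) k)%:E)%E.
Proof.
move=> h; have M0 : 0 <= M.
  by apply: le_trans (h 0); rewrite mulr_ge0 ?jp_ge0 ?nrm_ge0.
rewrite -esumTZ //; last by move=> k; rewrite lee_fin jp_ge0.
apply: le_esumT => k; rewrite -EFinM lee_fin jpN ler_pdivlMr ?jp_gt0 //.
by rewrite mulrAC -jpA.
Qed.

Lemma fsummable_nrm u : fsummable u -> ((nrm u)%:E <= wn 0 (coef u))%E.
Proof.
move=> hu; apply: le_trans (psum_nrm_le hu) _.
apply: le_esumT => k; rewrite lee_fin nrmZ (nrm_unitary (monom_unitary T k)) mulr1.
by rewrite jp0 mul1r.
Qed.

Lemma fourier_cvg c : (wn 0 c < +oo)%E ->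
  exists2 u, fourier_sums c @ totally --> u & coef u = c.
Proof.
move=> h; have hc : fourier_sums c @ totally --> summability.sum (fun k => c k *: monom k).
  apply: nsum_cvg; apply: le_lt_trans h; apply: le_esumT => k.
  by rewrite lee_fin nrmZ (nrm_unitary (monom_unitary T k)) mulr1 jp0 mul1r.
by exists (summability.sum (fun k => c k *: monom k)) => //; exact: coef_cvg.
Qed.

(** Let [w] be the sum of the Fourier series of [u]. An approximant [v] is close to [u] by
    hypothesis, and close to [w] because [w - v] is the sum of its Fourier series and has the
    coefficients of [u - v]. Hence [u = w]. *)
Lemma fsummable_lim u :
  (forall e : R, 0 < e -> exists2 v, fsummable v &
     nrm (u - v) <= e /\ (wn 0 (coef (u - v)%R) <= e%:E)%E) ->
  (wn 0 (coef u) < +oo)%E -> fsummable u.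
Proof.
move=> h hu; have [w hw cw] := fourier_cvg hu.
suff -> : u = w by exact: fsummable_cvg hw.
apply/eqP; rewrite -subr_eq0; apply/eqP/nrm_eq0/le_anti; rewrite nrm_ge0 andbT.
apply/ler_addgt0Pr => e e0; rewrite add0r.
have e2 : 0 < e / 2 by rewrite divr_gt0.
have [v hv [uv1 uv2]] := h _ e2.
rewrite -(subrK v u) -addrA (le_trans (nrmD _ _)) // [e]splitr lerD // nrmC.
have hwv : fsummable (w - v).
  by apply: fsummableB => //; exact: fsummable_cvg hw.
rewrite -lee_fin (le_trans (fsummable_nrm hwv)) //.
rewrite (_ : coef (w - v)%R = coef (u - v)%R) //.
by apply/funext => k; rewrite !coefB cw.
Qed.

End Fourier.

Section EuclideanNorm.
Variables (R : realType) (n : nat).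
Implicit Types (x : 'rV[R]_n).

Lemma sup_le_enorm x : `|x| <= enorm x.
Proof.
rewrite [leLHS]/Num.norm /= mx_normrE; apply: bigmax_le => [|[i j] _].
  exact: sqrtr_ge0.
rewrite /= ord1 /enorm -sqrtr_sqr; apply: ler_wsqrtr.
rewrite (bigD1 j) //= lerDl sumr_ge0 // => k _; exact: sqr_ge0.
Qed.

Lemma enorm_le_sup x : enorm x <= n%:R * `|x|.
Proof.
rewrite /enorm -[leRHS]ger0_norm ?mulr_ge0 // -sqrtr_sqr; apply: ler_wsqrtr.
apply: (@le_trans _ _ (\sum_(j < n) `|x| ^+ 2)).
  apply: ler_sum => j _; rewrite -[x 0 j ^+ 2]real_normK ?num_real //.
  by rewrite ler_pXn2r ?nnegrE // coord_le.
rewrite sumr_const card_ord exprMn -[_ *+ n]mulr_natl ler_wpM2r ?sqr_ge0 //.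
case: (n) => [|m]; first by rewrite expr0n.
by rewrite expr2 ler_peMr // ler1n.
Qed.

End EuclideanNorm.

(** * The smooth algebra and its weighted norms *)

Section Smooth.
Variables (R : realType) (n : nat) (theta : 'M[R]_n) (T : ncTorus theta).
Local Notation C := R[i].
Local Notation Zn := 'rV[int]_n.
Local Notation monom := (monomial (@gen _ _ _ T)).
Implicit Types (k l p : Zn) (u v w : T) (c d : Zn -> C) (s t : R).

Definition wfin c := forall s, (wn s c < +oo)%E.

Lemma wfinD c d : wfin c -> wfin d -> wfin (fun k => c k + d k).
Proof. by move=> hc hd s; apply: le_lt_trans (wnD _ _ _) _; rewrite lte_add_pinfty. Qed.

Lemma wfinZ (z : C) c : wfin c -> wfin (fun k => z * c k).
Proof.
move=> hc s; rewrite wnZ lte_mul_pinfty ?lee_fin ?nrm_ge0 //.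
Qed.

Lemma wfin_dom c : (forall N : nat, exists M, forall k, wt R k ^+ N * nrm (c k) <= M) -> wfin c.
Proof.
move=> h s; have [N hN] : exists N : nat, s + 2 * n%:R <= N%:R.
  exists (Num.truncn `|s + 2 * n%:R|).+1; apply: le_trans (ler_norm _) _.
  by rewrite ltW // truncnS_gt.
have [M hM] := h N.
have M0 : 0 <= M.
  by apply: le_trans (hM 0); rewrite mulr_ge0 ?nrm_ge0 // exprn_ge0 // ltW // wt_gt0.
apply: (@le_lt_trans _ _ (M%:E * \esum_(k in [set: Zn]) (jp (- (2 * n%:R)) k)%:E)%E).
  apply: wn_dom => k; apply: le_trans (hM k); rewrite ler_wpM2r ?nrm_ge0 //.
  apply: le_trans (jp_le _ hN) _.
  by rewrite /jp powR_mulrn ?lexx // ltW // wt_gt0.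
by rewrite lte_mul_pinfty ?lee_fin // esum_jp_fin.
Qed.

Lemma rapid_decayP c : rapid_decay c <-> wfin c.
Proof.
split=> [h|h].
  apply: wfin_dom => N; have [M hM] := h N; exists M => k.
  apply: le_trans (hM k); rewrite ler_wpM2r ?nrm_ge0 //.
  apply: lerXn2r; rewrite ?nnegrE ?(ltW (wt_gt0 _ _)) ?addr_ge0 ?sqrtr_ge0 //.
  by rewrite lerD2l sup_le_enorm.
move=> N; exists ((1 + n%:R) ^+ N * fine (wn N%:R c)) => k.
have := wn_coord N%:R c k.
rewrite -[X in (_ <= X)%E]fineK ?ge0_fin_numE ?wn_ge0 // lee_fin => hk.
apply: (@le_trans _ _ ((1 + n%:R) ^+ N * (jp N%:R k * nrm (c k)))); last first.
  by rewrite ler_wpM2l // exprn_ge0 // addr_ge0.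
have w0 := ltW (wt_gt0 R k).
rewrite mulrA ler_wpM2r ?nrm_ge0 // /jp powR_mulrn // -exprMn.
have e0 : 0 <= enorm (lattice R k) by exact: sqrtr_ge0.
apply: lerXn2r; rewrite ?nnegrE ?addr_ge0 ?mulr_ge0 ?addr_ge0 //.
rewrite mulrDl mul1r lerD ?wt_ge1 //.
apply: le_trans (enorm_le_sup _) _; rewrite ler_wpM2l // /wt lerDr //.
Qed.

Lemma CinfP u : Cinf u <-> fsummable u /\ wfin (coef u).
Proof.
split=> [[c [/rapid_decayP hc cu]]|[h1 h2]].
  by rewrite (coef_cvg cu); split => //; exact: fsummable_cvg cu.
by exists (coef u); split => //; apply/rapid_decayP.
Qed.

(* [fine] turns an infinite norm into 0, whence the hypotheses [wfin]. *)
Definition sn s u := fine (wn s (coef u)).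

Lemma snE s u : wfin (coef u) -> wn s (coef u) = (sn s u)%:E.
Proof. by move=> hu; rewrite /sn fineK // ge0_fin_numE ?wn_ge0. Qed.

Lemma sn_ge0 s u : 0 <= sn s u. Proof. by rewrite fine_ge0 ?wn_ge0. Qed.

Lemma sn_le s u (M : R) : (wn s (coef u) <= M%:E)%E -> sn s u <= M.
Proof.
move=> h; rewrite -lee_fin /sn fineK // ge0_fin_numE ?wn_ge0 //.
by rewrite (le_lt_trans h) // ltry.
Qed.

Lemma le_sn s t u : wfin (coef u) -> s <= t -> sn s u <= sn t u.
Proof. by move=> hu st; apply: sn_le; rewrite -snE // le_wn. Qed.

Lemma sn_coord s u k : wfin (coef u) -> jp s k * nrm (coef u k) <= sn s u.
Proof. by move=> hu; rewrite -lee_fin -snE // wn_coord. Qed.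

Lemma wfin_coefD u v : wfin (coef u) -> wfin (coef v) -> wfin (coef (u + v)).
Proof.
move=> hu hv; rewrite (_ : coef _ = fun k => coef u k + coef v k); first exact: wfinD.
by apply/funext => k; rewrite coefD.
Qed.

Lemma wfin_coefZ (z : C) u : wfin (coef u) -> wfin (coef (z *: u)).
Proof.
move=> hu; rewrite (_ : coef _ = fun k => z * coef u k); first exact: wfinZ.
by apply/funext => k; rewrite coefZ.
Qed.

Lemma wfin_coefB u v : wfin (coef u) -> wfin (coef v) -> wfin (coef (u - v)).
Proof. by move=> hu hv; apply: wfin_coefD => //; rewrite -scaleN1r; apply: wfin_coefZ. Qed.

Lemma sn0 s : sn s 0 = 0.
Proof.
rewrite /sn (_ : wn _ _ = 0%E) // /wn esum1 // => k _.
by rewrite coef0 nrm0 mulr0.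
Qed.

Lemma snD s u v : wfin (coef u) -> wfin (coef v) -> sn s (u + v) <= sn s u + sn s v.
Proof.
move=> hu hv; apply: sn_le; rewrite EFinD -!snE //; apply: le_trans (wnD _ _ _).
by apply: le_esumT => k; rewrite coefD.
Qed.

Lemma snZ s (z : C) u : wfin (coef u) -> sn s (z *: u) = nrm z * sn s u.
Proof.
move=> hu; rewrite /sn (_ : coef (z *: u) = fun k => z * coef u k).
  by rewrite wnZ fineM // ge0_fin_numE // wn_ge0.
by apply/funext => k; rewrite coefZ.
Qed.

Lemma snN s u : sn s (- u) = sn s u.
Proof.
rewrite /sn; congr fine; congr (esum _ _); apply/funext => k.
by rewrite coefN nrmN.
Qed.

Lemma snB s u v : wfin (coef u) -> wfin (coef v) -> sn s (u - v) <= sn s u + sn s v.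
Proof.
move=> hu hv; rewrite -(snN s v); apply: snD => //.
by rewrite -scaleN1r; apply: wfin_coefZ.
Qed.

Lemma snBC s u v : sn s (u - v) = sn s (v - u).
Proof. by rewrite -snN opprB. Qed.

Lemma Cinf_wfin u : Cinf u -> wfin (coef u). Proof. by case/CinfP. Qed.
Lemma Cinf_fsum u : Cinf u -> fsummable u. Proof. by case/CinfP. Qed.

Lemma Cinf0 : Cinf (0 : T).
Proof.
apply/CinfP; split; first exact: fsummable0.
move=> s; rewrite /wn esum1 ?ltry // => k _; by rewrite coef0 nrm0 mulr0.
Qed.

Lemma Cinf_lin (z : C) u v : Cinf u -> Cinf v -> Cinf (z *: u + v).
Proof.
move=> /CinfP[u1 u2] /CinfP[v1 v2]; apply/CinfP; split; first exact: fsummable_lin.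
by apply: wfin_coefD => //; apply: wfin_coefZ.
Qed.

Lemma CinfD u v : Cinf u -> Cinf v -> Cinf (u + v).
Proof. by move=> hu hv; rewrite -[u]scale1r; apply: Cinf_lin. Qed.

Lemma CinfZ (z : C) u : Cinf u -> Cinf (z *: u).
Proof. by move=> hu; rewrite -[z *: u]addr0; apply: Cinf_lin => //; exact: Cinf0. Qed.

Lemma CinfN u : Cinf u -> Cinf (- u).
Proof. by move=> hu; rewrite -scaleN1r; apply: CinfZ. Qed.

Lemma CinfB u v : Cinf u -> Cinf v -> Cinf (u - v).
Proof. by move=> hu hv; apply: CinfD => //; apply: CinfN. Qed.

Lemma Cinf_sum (I : Type) (r : seq I) (f : I -> T) :
  (forall i, Cinf (f i)) -> Cinf (\sum_(i <- r) f i).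
Proof.
move=> h; elim: r => [|i r IH]; first by rewrite big_nil; exact: Cinf0.
by rewrite big_cons; apply: CinfD.
Qed.

Lemma wfin_monom l : wfin (coef (monom l)).
Proof.
move=> s; apply: (@le_lt_trans _ _ (jp s l)%:E); last exact: ltry.
apply: esum_leP => F; rewrite sumEFin lee_fin.
apply: (@le_trans _ _ (\sum_(k <- F) if k == l then jp s l else 0)).
  apply: ler_sum => k _; rewrite coef_monom; case: eqP => [->|_].
    by rewrite nrm1 mulr1.
  by rewrite nrm0 mulr0.
rewrite -big_mkcond /= -big_filter; case lF: (l \in F); last first.
  rewrite big_seq big1 ?jp_ge0 // => k; rewrite mem_filter => /andP[/eqP -> ].
  by rewrite lF.
rewrite (perm_big [:: l]) ?big_seq1 //; apply: uniq_perm => //.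
  by rewrite filter_uniq // fset_uniq.
move=> k; rewrite mem_filter !inE; case: eqP => // ->.
by rewrite lF.
Qed.

Lemma Cinf_monom l : Cinf (monom l).
Proof. by apply/CinfP; split; [exact: fsummable_monom|exact: wfin_monom]. Qed.

Lemma esum_shift (f : Zn -> \bar R) l :
  \esum_(k in setT) f k = \esum_(k in setT) f (k + l).
Proof.
rewrite (reindex_esum [set: Zn] [set: Zn] (fun k => k + l)) //.
split=> //; first by move=> x y _ _ /addIr.
by move=> k _; exists (k - l) => //; rewrite subrK.
Qed.

(** Peetre's inequality after a translation. The two lemmas differ in which factor keeps the signed
    weight [t], the monomial here and [u] in [wn_mull]; this matters for negative [t]. *)
Lemma wn_mulr t N u l : `|t| <= N ->
  (wn t (coef (u * monom l)%R) <= (jp t l)%:E * wn N (coef u))%E.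
Proof.
move=> tN; rewrite /wn (esum_shift _ l) -esumTZ ?jp_ge0 //.
  apply: le_esumT => k; rewrite -EFinM lee_fin nrm_coef_mulr addrK mulrA.
  by rewrite ler_wpM2r ?nrm_ge0 // mulrC peetre.
by move=> k; rewrite lee_fin mulr_ge0 ?jp_ge0 ?nrm_ge0.
Qed.

Lemma wn_mull t N u l : `|t| <= N ->
  (wn t (coef (monom l * u)%R) <= (jp N l)%:E * wn t (coef u))%E.
Proof.
move=> tN; rewrite /wn (esum_shift _ l) -esumTZ ?jp_ge0 //.
  apply: le_esumT => k; rewrite -EFinM lee_fin nrm_coef_mull addrK mulrA.
  by rewrite ler_wpM2r ?nrm_ge0 // addrC peetre.
by move=> k; rewrite lee_fin mulr_ge0 ?jp_ge0 ?nrm_ge0.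
Qed.

Lemma wfin_mulr u l : wfin (coef u) -> wfin (coef (u * monom l)).
Proof.
move=> hu s; apply: le_lt_trans (wn_mulr _ _ (lexx `|s|)) _.
by rewrite lte_mul_pinfty ?lee_fin ?jp_ge0 // hu.
Qed.

Lemma fsummable_mulr u l : fsummable u -> fsummable (u * monom l).
Proof.
move=> hu; have /boolp.choice [z hz] : forall k, exists z : C, monom k * monom l = z *: monom (k + l).
  by move=> k; have [z _ hz] := peq_sym (monomD T k l); exists z.
have h : partial_sum (fun k => (coef u k *: monom k) * monom l) @ totally --> u * monom l.
  apply: (@psum_lin _ _ _ _ _ _ (fun x : T => x * monom l) 1) hu => [x y||x].
  - by rewrite mulrDl.
  - by rewrite mul0r.
  - by rewrite mul1r nrm_unitary_mulr //; exact: monom_unitary.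
have hb : bijective (fun k : Zn => k - l).
  by exists (fun k => k + l) => k; rewrite ?addrK ?subrK.
have := psum_reindex hb h.
rewrite (_ : (fun i => _) = fun k => (coef u (k - l) * z (k - l)) *: monom k).
  exact: fsummable_cvg.
by apply/funext => k; rewrite -scalerAl hz scalerA subrK.
Qed.

Lemma Cinf_mulr u l : Cinf u -> Cinf (u * monom l).
Proof.
by move=> /CinfP[h1 h2]; apply/CinfP; split; [exact: fsummable_mulr|exact: wfin_mulr].
Qed.

(** [psum_phi_le] bounds each coefficient, then the sums are exchanged. The weighted norms are not
    continuous for the C*-norm; this is how they pass through limits taken in the C*-norm. *)
Lemma wn_series (I : choiceType) (V : normedModType C) (f : I -> V) (v : V) (phi : V -> T)
    (K s : R) :
  (forall x y, phi (x + y) = phi x + phi y) -> phi 0 = 0 ->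
  (forall x, nrm (phi x) <= K * nrm x) ->
  partial_sum f @ totally --> v ->
  (wn s (coef (phi v)) <= \esum_(i in setT) wn s (coef (phi (f i))))%E.
Proof.
move=> phiD phi0 phiK fv; have [K' K'0 hK'] := coef_bound T.
apply: (@le_trans _ _ (\esum_(l in setT) ((jp s l)%:E *
    \esum_(i in setT) (nrm (coef (phi (f i)) l))%:E))%E).
  apply: le_esumT => l; rewrite EFinM lee_wpmul2l ?lee_fin ?jp_ge0 //.
  apply: (@psum_phi_le _ _ _ _ _ _ (fun x => coef (phi x) l) (K' * K)) fv.
  - by move=> x y; rewrite phiD coefD.
  - by rewrite phi0 coef0.
  - by move=> x; rewrite (le_trans (hK' _ _)) // -mulrA ler_wpM2l.
rewrite (_ : \esum_(i in _) wn _ _ = \esum_(l in setT) \esum_(i in setT)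
   (jp s l * nrm (coef (phi (f i)) l))%:E).
  apply: le_esumT => l; rewrite -esumTZ ?jp_ge0 // => i.
  by rewrite lee_fin nrm_ge0.
by rewrite esumT_exchange // => i l; rewrite lee_fin mulr_ge0 ?jp_ge0 ?nrm_ge0.
Qed.

Lemma wn_series_id (I : choiceType) (f : I -> T) v s :
  partial_sum f @ totally --> v ->
  (wn s (coef v) <= \esum_(i in setT) wn s (coef (f i)))%E.
Proof.
by move=> fv; apply: (@wn_series _ _ _ _ id 1) fv => // x; rewrite mul1r.
Qed.

Lemma wn_mul s u v : fsummable u ->
  (wn s (coef (u * v)%R) <= \esum_(k in setT) (nrm (coef u k))%:E * wn s (coef (monom k * v)%R))%E.
Proof.
move=> hu.
have h := @wn_series _ _ (fun k => coef u k *: monom k) u (fun x => x * v) (nrm v) s.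
apply: le_trans (h _ _ _ hu) _.
- by move=> x y; rewrite mulrDl.
- by rewrite mul0r.
- by move=> x; rewrite mulrC nrmM.
apply: le_esumT => k; rewrite -scalerAl -wnZ le_eqVlt; apply/orP; left; apply/eqP.
by congr (wn _ _); apply/funext => l; rewrite coefZ.
Qed.

Lemma snM_wfin s u v : 0 <= s -> fsummable u -> wfin (coef u) -> wfin (coef v) ->
  (wn s (coef (u * v)%R) <= (sn s u * sn s v)%:E)%E.
Proof.
move=> s0 hu hu' hv; apply: le_trans (wn_mul _ _ hu) _.
rewrite mulrC EFinM -(snE s hu') /wn -esumTZ ?sn_ge0 //.
  apply: le_esumT => k; have := wn_mull v k (lexx `|s|).
  rewrite (ger0_norm s0) (snE s hv) -EFinM => h.
  apply: le_trans (lee_wpmul2l _ h) _; rewrite lee_fin ?nrm_ge0 //.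
  by rewrite [leRHS]mulrC [leRHS]mulrAC [leRHS]mulrC mulrA.
by move=> k; rewrite lee_fin mulr_ge0 ?jp_ge0 ?nrm_ge0.
Qed.

Lemma wfinM u v : Cinf u -> wfin (coef v) -> wfin (coef (u * v)).
Proof.
move=> /CinfP[hu hu'] hv s; have [s0|s0] := leP 0 s.
  exact: le_lt_trans (snM_wfin s0 hu hu' hv) (ltry _).
apply: le_lt_trans (le_wn _ (ltW s0)) _.
exact: le_lt_trans (snM_wfin (lexx 0) hu hu' hv) (ltry _).
Qed.

Lemma snM s u v : 0 <= s -> Cinf u -> wfin (coef v) -> sn s (u * v) <= sn s u * sn s v.
Proof. by move=> s0 /CinfP[hu hu'] hv; apply: sn_le; exact: snM_wfin. Qed.

Lemma sn_mulr t N u l : `|t| <= N -> wfin (coef u) -> sn t (u * monom l) <= jp t l * sn N u.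
Proof.
by move=> tN hu; apply: sn_le; rewrite EFinM -snE // wn_mulr.
Qed.

Lemma sn_monom t l : sn t (monom l) <= jp t l.
Proof.
have := @wn_mulr t `|t| 1 l (lexx _); rewrite mul1r => h.
apply: sn_le; apply: le_trans h _; rewrite -[leRHS]mule1 lee_wpmul2l ?lee_fin ?jp_ge0 //.
rewrite -(monom0 T); apply: esum_leP => F; rewrite sumEFin lee_fin.
apply: (@le_trans _ _ (\sum_(k <- F) if k == 0 then 1 else 0)).
  apply: ler_sum => k _; rewrite coef_monom; case: eqP => [->|_].
    by rewrite nrm1 mulr1 jpz.
  by rewrite nrm0 mulr0.
rewrite -big_mkcond /= -big_filter; case lF: (0 \in F); last first.
  rewrite big_seq big1 // => k; rewrite mem_filter => /andP[/eqP -> ].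
  by rewrite lF.
rewrite (perm_big [:: 0]) ?big_seq1 //; apply: uniq_perm => //.
  by rewrite filter_uniq // fset_uniq.
move=> k; rewrite mem_filter !inE; case: eqP => // ->.
by rewrite lF.
Qed.

Lemma nrm_le_sn s u : 0 <= s -> Cinf u -> nrm u <= sn s u.
Proof.
move=> s0 /CinfP[h1 h2]; rewrite -lee_fin -snE //.
by apply: le_trans (fsummable_nrm h1) (le_wn _ _).
Qed.

Lemma psum_tail (I : choiceType) (f : I -> T) v (F0 : {fset I}) :
  partial_sum f @ totally --> v ->
  partial_sum (fun i => if i \in F0 then 0 else f i) @ totally --> v - \sum_(i <- F0) f i.
Proof.
move=> fv; have FT := @totally_filter I; apply/cvg_nrmP => e e0.
move/cvg_nrmP: fv => /(_ e e0)[A _ hA]; exists (A `|` F0)%fset => //= B AFB.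
have := hA B (fsubset_trans (fsubsetUl _ _) AFB); rewrite !psumE.
rewrite !(sum_fsubset _ (fsubset_trans (fsubsetUr _ _) AFB)).
have -> : \sum_(i <- F0) (if i \in F0 then 0 else f i) = 0.
  by rewrite big_seq big1 // => i ->.
rewrite add0r opprD addrA; congr (nrm (_ - _) < e).
by rewrite -sum_fset_disj // => i; rewrite inE => /andP[].
Qed.

(** Completeness for series that converge absolutely in all weighted norms: the sum exists in the
    C*-algebra, and its small tails make the finite sums the approximants of [fsummable_lim]. *)
Lemma Cinf_series (I : choiceType) (f : I -> T) :
  (forall i, Cinf (f i)) ->
  (forall s, (\esum_(i in setT) wn s (coef (f i)) < +oo)%E) ->
  exists2 v, partial_sum f @ totally --> v & Cinf v.
Proof.
move=> hf hs.
have cv : partial_sum f @ totally --> summability.sum f.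
  apply: nsum_cvg; apply: le_lt_trans (hs 0); apply: le_esumT => i.
  by apply: fsummable_nrm; exact: Cinf_fsum.
exists (summability.sum f) => //; apply/CinfP.
have hw : wfin (coef (summability.sum f)).
  by move=> s; apply: le_lt_trans (wn_series_id s cv) (hs s).
split=> //; apply: fsummable_lim => // e e0.
have [|F0 hF0] := esumT_tail _ (hs 0) e0; first by move=> i; exact: wn_ge0.
exists (\sum_(i <- F0) f i); first by apply/Cinf_fsum/Cinf_sum.
have ct := psum_tail (F0 := F0) cv.
split.
  rewrite -lee_fin; apply: le_trans hF0; apply: le_trans (psum_nrm_le ct) _.
  apply: le_esumT => i; case: ifP => _; first by rewrite nrm0.
  by apply: fsummable_nrm; exact: Cinf_fsum.
apply: le_trans (wn_series_id 0 ct) _; apply: le_trans hF0.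
apply: le_esumT => i; case: ifP => // _.
by rewrite /wn esum1 // => k _; rewrite coef0 nrm0 mulr0.
Qed.

Lemma coord_le_wt k j : `|(k 0 j)%:~R| <= wt R k.
Proof.
have := coord_le (lattice R k) j; rewrite mxE => h.
by rewrite (le_trans h) // /wt lerDr.
Qed.

Lemma delta1P j u : Cinf u ->
  Cinf (delta1 j u) /\ forall k, coef (delta1 j u) k = (k 0 j)%:~R * coef u k.
Proof.
move=> /CinfP[hu hw]; pose c k : C := (k 0 j)%:~R * coef u k.
have hc : wfin c.
  move=> s; apply: le_lt_trans (hw (s + 1)); apply: le_esumT => k.
  rewrite lee_fin jpA -mulrA ler_wpM2l ?jp_ge0 // nrm_mul ler_wpM2r ?nrm_ge0 //.
  rewrite -(rmorph_int (real_complex R)) nrm_real /jp powRr1 ?coord_le_wt //.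
  by rewrite ltW // wt_gt0.
have [v hv cv] := fourier_cvg T (hc 0).
have -> : delta1 j u = v by rewrite /delta1 (psum_sum hv).
split; last by move=> k; rewrite cv.
by apply/CinfP; rewrite cv; split=> //; exact: fsummable_cvg hv.
Qed.

Lemma deltaP (b : multi n) u : Cinf u ->
  Cinf (delta b u) /\
  forall k, coef (delta b u) k = (\prod_j ((k 0 j)%:~R ^+ b j)) * coef u k.
Proof.
move=> hu; rewrite /delta /mcompose.
have it j m v : Cinf v -> Cinf (iter m (delta1 j) v) /\
    forall k, coef (iter m (delta1 j) v) k = (k 0 j)%:~R ^+ m * coef v k.
  move=> hv; elim: m => [|m [IH1 IH2]]; first by split=> // k; rewrite expr0 mul1r.
  have [h1 h2] := delta1P j IH1; split=> // k.
  by rewrite /= h2 IH2 exprS mulrA.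
have gen (s : seq 'I_n) : Cinf (foldr (fun j y => iter (b j) (@delta1 _ _ _ T j) y) u s) /\
    forall k, coef (foldr (fun j y => iter (b j) (@delta1 _ _ _ T j) y) u s) k =
      (\prod_(j <- s) ((k 0 j)%:~R ^+ b j)) * coef u k.
  elim: s => [|j s [IH1 IH2]] /=; first by split=> // k; rewrite big_nil mul1r.
  have [h1 h2] := it j (b j) _ IH1; split=> // k.
  by rewrite h2 IH2 big_cons mulrA.
by have [h1 h2] := gen (enum 'I_n); split=> // k; rewrite h2 big_enum.
Qed.

Lemma nrm_delta_le b u : Cinf u -> nrm (delta b u) <= sn (msize b)%:R u.
Proof.
move=> hu; have [h1 h2] := deltaP b hu.
apply: le_trans (nrm_le_sn (lexx 0) h1) _; apply: sn_le.
rewrite -(snE _ (Cinf_wfin hu)); apply: le_esumT => k.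
rewrite lee_fin jp0 mul1r h2 nrm_mul ler_wpM2r ?nrm_ge0 //.
rewrite /jp powR_mulrn ?(ltW (wt_gt0 _ _)) // /msize.
elim/big_rec2: _ => [|j m x _ IH]; first by rewrite nrm1 expr0.
rewrite nrm_mul exprD ler_pM ?nrm_ge0 //.
elim: (b j) => [|p IHp]; first by rewrite !expr0 nrm1.
rewrite !exprS nrm_mul ler_pM ?nrm_ge0 //.
by rewrite -(rmorph_int (real_complex R)) nrm_real coord_le_wt.
Qed.

(* Large powers of the single derivations control all the weights, as
   [(1 + |k|) ^ N <= 2 ^ N * (1 + \sum_j |k_j| ^ N)]. *)
Lemma sn_le_delta s : exists (gs : seq {ffun 'I_n -> nat}) (K : R), 0 <= K /\
  forall u (d : R), Cinf u -> (forall g, g \in gs -> nrm (delta g u) <= d) -> sn s u <= K * d.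
Proof.
have [N hN] : exists N : nat, s + 2 * n%:R <= N%:R.
  exists (Num.truncn `|s + 2 * n%:R|).+1; apply: le_trans (ler_norm _) _.
  by rewrite ltW // truncnS_gt.
have [K K0 hK] := coef_bound T.
pose Z : \bar R := \esum_(k in [set: Zn]) (jp (- (2 * n%:R)) k)%:E.
have Zf : Z \is a fin_num by rewrite ge0_fin_numE ?esum_jp_fin // esumT_ge0 // => k; rewrite lee_fin jp_ge0.
have Z0 : 0 <= fine Z by rewrite fine_ge0 // esumT_ge0 // => k; rewrite lee_fin jp_ge0.
pose z : {ffun 'I_n -> nat} := [ffun=> 0%N].
pose pw (j : 'I_n) : {ffun 'I_n -> nat} := [ffun i => if i == j then N else 0%N].
exists (z :: [seq pw j | j <- enum 'I_n]), (2 ^+ N * (K + K) * fine Z).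
split; first by rewrite !mulr_ge0 ?exprn_ge0 ?addr_ge0.
move=> u d hu hd; apply: sn_le.
have d0 : 0 <= d.
  by have := hd z (mem_head _ _); apply: le_trans; exact: nrm_ge0.
rewrite mulrAC EFinM fineK // ; apply: wn_dom => k.
apply: (@le_trans _ _ (wt R k ^+ N * nrm (coef u k))).
  rewrite ler_wpM2r ?nrm_ge0 // (le_trans (jp_le _ hN)) //.
  by rewrite /jp powR_mulrn // ltW // wt_gt0.
have cf g : g \in z :: [seq pw j | j <- enum 'I_n] -> nrm ((\prod_j ((k 0 j)%:~R ^+ g j)) * coef u k) <= K * d.
  move=> gN; have [_ h2] := deltaP g hu; rewrite -h2.
  by rewrite (le_trans (hK _ _)) // ler_wpM2l // hd.
have c0 : nrm (coef u k) <= K * d.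
  have := cf z (mem_head _ _); rewrite big1 ?mul1r //.
  by move=> j _; rewrite ffunE expr0.
have cj j : `|(k 0 j)%:~R| ^+ N * nrm (coef u k) <= K * d.
  have := cf (pw j) _; rewrite inE map_f ?mem_enum ?orbT // => /(_ isT).
  rewrite (bigD1 j) //= ffunE eqxx big1 ?mulr1; last first.
    by move=> i /negbTE ij; rewrite ffunE ij expr0.
  rewrite nrm_mul (_ : nrm (_ ^+ N) = `|(k 0 j)%:~R| ^+ N); last first.
    by rewrite -(rmorph_int (real_complex R)) -rmorphXn nrm_real normrX.
  by [].
have [x hx] : exists x : R, [/\ 0 <= x, wt R k = 1 + x & x ^+ N * nrm (coef u k) <= K * d].
  exists `|lattice R k|; split=> //.
  have -> : `|lattice R k| = mx_norm (lattice R k) by [].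
  have [->|] := eqVneq (mx_norm (lattice R k)) 0.
    case: (N) => [|m]; first by rewrite expr0 mul1r.
    by rewrite expr0n mul0r mulr_ge0.
  by move=> /mx_norm_neq0[[i j] ->]; rewrite /= ord1 mxE.
case: hx => x0 -> hx; apply: (@le_trans _ _ (2 ^+ N * (1 + x ^+ N) * nrm (coef u k))).
  rewrite ler_wpM2r ?nrm_ge0 //; have [x1|x1] := leP x 1.
    apply: (@le_trans _ _ (2 ^+ N)); first by apply: lerXn2r; rewrite ?nnegrE ?addr_ge0 ?lerD.
    by rewrite ler_peMr ?exprn_ge0 // lerDl exprn_ge0.
  apply: (@le_trans _ _ (2 ^+ N * x ^+ N)); last by rewrite ler_wpM2l ?exprn_ge0 // lerDr.
  rewrite -exprMn; apply: lerXn2r; rewrite ?nnegrE ?addr_ge0 ?mulr_ge0 //.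
  by rewrite mulrDl mul1r lerD2r ltW.
rewrite -!mulrA ler_wpM2l ?exprn_ge0 // mulrDl mul1r mulrDl.
by rewrite lerD.
Qed.

End Smooth.

(** * Parametrix *)

Section ConeSymbol.
Variables (R : realType) (n : nat) (theta : 'M[R]_n) (T : ncTorus theta).
Local Notation C := R[i].
Implicit Types (xi eta zeta : 'rV[R]_n) (s t e : R) (u v b : T).
Variables (sigma : 'rV[R]_n -> T) (w phi : R).
Hypothesis sigma_Cinf : forall xi, xi != 0 -> Cinf (sigma xi).
Hypothesis sigma_cont : forall xi, xi != 0 -> forall s e, 0 < e ->
  \forall eta \near xi, sn s (sigma eta - sigma xi) <= e.
Hypothesis sigma_hom : forall t xi, 0 < t -> xi != 0 ->
  sigma (t *: xi) = (t `^ w)%:C *: sigma xi.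

Definition inv_at xi t b := [/\ Cinf b,
  (sigma xi - (polar t phi)%:A) * b = 1 & b * (sigma xi - (polar t phi)%:A) = 1].

(** The value [t = 0] is ellipticity; it closes the range of the parameter, so that compactness
    applies to [[0, t0]]. *)
Hypothesis sigma_inv : forall xi, xi != 0 -> forall t, 0 <= t -> exists b, inv_at xi t b.

Lemma unit_neq0 xi : `|xi| = 1 -> xi != 0.
Proof. by move=> h; rewrite -normr_eq0 h oner_neq0. Qed.

Lemma sphere_compact : compact [set xi : 'rV[R]_n | `|xi| = 1].
Proof.
apply: bounded_closed_compact.
  exists 1; split; first exact: num_real.
  by move=> M M1 xi /= ->; exact: ltW.
apply: (@closed_comp _ _ (fun xi : 'rV[R]_n => `|xi|) [set 1]).
  by move=> xi _; exact: norm_continuous.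
exact: closed_eq.
Qed.

Lemma near_neq0 xi : xi != 0 -> \forall eta \near xi, eta != 0.
Proof.
move=> x0; apply/nbhs_ballP; exists `|xi|; first by rewrite /= normr_gt0.
move=> eta; rewrite -ball_normE /=; apply: contraTneq => ->.
by rewrite subr0 ltxx.
Qed.

Lemma polar_scale xi : xi != 0 -> xi = `|xi| *: (`|xi|^-1 *: xi) /\ `| `|xi|^-1 *: xi| = 1.
Proof.
move=> x0; have nx : `|xi| != 0 by rewrite normr_eq0.
by rewrite scalerA mulfV // scale1r normrZ normfV normr_id mulVf.
Qed.

Lemma sn_1 s : sn s (1 : T) <= 1.
Proof. by have := sn_monom T s 0; rewrite monom0 jpz. Qed.

Lemma Cinf1 : Cinf (1 : T).
Proof. by rewrite -(monom0 T); exact: Cinf_monom. Qed.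

(** The bound [M] is the variable of the filter [+oo]: [compact_near_coveringP] then turns local
    bounds on the sphere into a uniform one. *)
Lemma sigma_bound s : exists2 M, 0 <= M &
  forall xi, xi != 0 -> sn s (sigma xi) <= M * `|xi| `^ w.
Proof.
have := (compact_near_coveringP _).1 sphere_compact R +oo
  (fun M xi => sn s (sigma xi) <= M) _.
case.
  move=> xi /= /unit_neq0 x0.
  exists ([set eta | sn s (sigma eta - sigma xi) <= 1 /\ eta != 0],
          [set M | sn s (sigma xi) + 1 <= M]) => /=.
    split; last by exists (sn s (sigma xi) + 1); split => [|M /ltW]; rewrite ?num_real.
    by apply: filterI; [exact: sigma_cont|exact: near_neq0].
  move=> [eta M] /= [[h1 e0] h2]; rewrite -(subrK (sigma xi) (sigma eta)) addrC.
  apply: le_trans (snD _ _ _) _; rewrite ?(le_trans _ h2) ?lerD2l //.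
    exact/Cinf_wfin/sigma_Cinf.
  by apply/Cinf_wfin/CinfB; exact: sigma_Cinf.
move=> M [_ hM]; exists `|M + 1| => // xi x0.
have [xE n1] := polar_scale x0; have nx : 0 < `|xi| by rewrite normr_gt0.
rewrite {1}xE sigma_hom ?unit_neq0 // snZ; last exact/Cinf_wfin/sigma_Cinf/unit_neq0.
rewrite nrm_real ger0_norm ?powR_ge0 // mulrC ler_wpM2r ?powR_ge0 //.
by apply: le_trans (hM (M + 1) _ _ n1) (ler_norm _); rewrite ltrDl.
Qed.

(** Uniform continuity near the sphere, transported by homogeneity; hence displacements are measured
    relative to [|xi|]. *)
Lemma sigma_unif s e : 0 < e -> exists kap, [/\ 0 < kap, kap <= 2^-1 &
  forall xi zeta, xi != 0 -> `|zeta| <= kap * `|xi| ->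
    sn s (sigma (xi + zeta) - sigma xi) <= e * `|xi| `^ w].
Proof.
move=> e0; have e2 : 0 < e / 2 by rewrite divr_gt0.
have := (compact_near_coveringP _).1 sphere_compact R 0^'+
  (fun kap xi => forall zeta, `|zeta| <= kap -> sn s (sigma (xi + zeta) - sigma xi) <= e) _.
case.
  move=> xi /= /unit_neq0 x0.
  have /nbhs_ballP[d /= d0 hd] :
      nbhs xi [set eta | sn s (sigma eta - sigma xi) <= e / 2 /\ eta != 0].
    by apply: filterI; [exact: sigma_cont|exact: near_neq0].
  exists (ball xi (d / 2), [set kap | 0 < kap < d / 2]) => /=.
    split; first by apply: nbhsx_ballx; rewrite divr_gt0.
    exists (d / 2); first by rewrite /= divr_gt0.
    move=> k /=; rewrite sub0r normrN => h1 h2; rewrite h2 /=.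
    by rewrite (le_lt_trans (ler_norm _)).
  move=> [eta kap] /= [h1 /andP[k0 k1]] zeta zk.
  have dd : d = d / 2 + d / 2 by rewrite -splitr.
  have [|a1 a2] := hd (eta + zeta).
    move: h1; rewrite -!ball_normE /= opprD addrA => h1.
    rewrite [ltRHS]dd (le_lt_trans (ler_normB _ _)) // ltrD //.
    exact: le_lt_trans zk k1.
  have [|a3 a4] := hd eta.
    move: h1; rewrite -!ball_normE /= => h1.
    by rewrite (lt_trans h1) // ltr_pdivrMr // ltr_pMr // ltr1n.
  rewrite -(subrK (sigma xi) (sigma (eta + zeta))) -addrA.
  rewrite [e]splitr (le_trans (snD _ _ _)) ?lerD //.
  - by apply/Cinf_wfin/CinfB; exact: sigma_Cinf.
  - by apply/Cinf_wfin/CinfB; exact: sigma_Cinf.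
  - by rewrite snBC.
(* The bound [1/2] keeps [xi + zeta] away from the origin, and [d / 2] provides a value strictly
   inside the neighbourhood where the estimate holds. *)
move=> d /= d0 hd; pose kap := Num.min (d / 2) 2^-1.
have k0 : 0 < kap by rewrite lt_min !invr_gt0 divr_gt0 //=.
exists kap; split=> //; first by rewrite ge_min lexx orbT.
move=> xi zeta x0 hz.
have [xE n1] := polar_scale x0; have nx : 0 < `|xi| by rewrite normr_gt0.
set eta := _ *: xi in xE n1.
have zE : zeta = `|xi| *: (`|xi|^-1 *: zeta) by rewrite scalerA mulfV ?scale1r ?gt_eqF.
have hz' : `| `|xi|^-1 *: zeta| <= kap.
  by rewrite normrZ normfV normr_id ler_pdivrMl // mulrC.
have hk : sn s (sigma (eta + `|xi|^-1 *: zeta) - sigma eta) <= e.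
  apply: (hd kap) => //=; rewrite sub0r normrN gtr0_norm //.
  rewrite (@le_lt_trans _ _ (d / 2)) ?ge_min ?lexx //.
  by rewrite ltr_pdivrMr // ltr_pMr // ltr1n.
have k12 : kap <= 2^-1 by rewrite /kap ge_min lexx orbT.
have ez0 : eta + `|xi|^-1 *: zeta != 0.
  apply/eqP => /eqP; rewrite addr_eq0 => /eqP h.
  have := le_trans hz' k12; rewrite -normrN -h n1.
  by rewrite leNgt invf_lt1 ?ltr1n.
have -> : xi + zeta = `|xi| *: (eta + `|xi|^-1 *: zeta) by rewrite scalerDr -xE -zE.
have -> : sigma xi = (`|xi| `^ w)%:C *: sigma eta by rewrite {1}xE sigma_hom ?unit_neq0.
rewrite sigma_hom // -scalerBr.
rewrite snZ; last by apply/Cinf_wfin/CinfB; apply: sigma_Cinf => //; exact: unit_neq0.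
by rewrite nrm_real ger0_norm ?powR_ge0 // mulrC ler_wpM2r ?powR_ge0.
Qed.

Lemma polar_split (t a : R) : polar t a = t%:C * polar 1 a.
Proof. by rewrite /polar mul1r. Qed.

Lemma polarM (x t a : R) : polar (x * t) a = x%:C * polar t a.
Proof. by rewrite /polar rmorphM mulrA. Qed.

Lemma nrm_polar (t a : R) : nrm (polar t a) = `|t|.
Proof. by rewrite /polar nrm_mul nrm_real nrm_cexp /= expR0 mulr1. Qed.

Lemma alg_Cinf (z : C) : Cinf (z%:A : T).
Proof. by apply: CinfZ; exact: Cinf1. Qed.

Lemma sn_alg s (z : C) : sn s (z%:A : T) <= nrm z.
Proof.
rewrite snZ; last exact: Cinf_wfin Cinf1.
by rewrite -[X in _ <= X]mulr1 ler_wpM2l ?nrm_ge0 // sn_1.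
Qed.

(** From [b = b0 - b0 (a - a0) b], the last term is absorbed: symbol and parameter each move by at
    most [d], and [2 d] times the norm of [b0] is at most [1/2]. The inverse [b] is given, so only
    its size is at stake. *)
Lemma inv_at_local s xi t : 0 <= s -> xi != 0 -> 0 <= t ->
  exists2 M, 0 <= M & exists2 d, 0 < d & forall eta t' b, eta != 0 ->
    sn s (sigma eta - sigma xi) <= d -> `|t' - t| <= d -> inv_at eta t' b -> sn s b <= M.
Proof.
move=> s0 x0 t0; have [b0 [hb0 l0 r0]] := sigma_inv x0 t0.
exists (2 * sn s b0); first by rewrite mulr_ge0 ?sn_ge0.
exists (4 * (sn s b0 + 1))^-1; first by rewrite invr_gt0 mulr_gt0 // ltr_wpDl ?sn_ge0.
move=> eta t' b e0 he ht [hb l r]; set d := (_^-1) in he ht.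
have [wb0 wb] := (Cinf_wfin hb0, Cinf_wfin hb).
set a0 := sigma xi - _ in l0 r0; set a := sigma eta - _ in l r.
have ca0 : Cinf a0 by apply: CinfB; [exact: sigma_Cinf|exact: alg_Cinf].
have ca : Cinf a by apply: CinfB; [exact: sigma_Cinf|exact: alg_Cinf].
have wd : wfin (coef (a - a0)) by apply/Cinf_wfin/CinfB.
have bE : b = b0 - b0 * ((a - a0) * b).
  by rewrite mulrBl l mulrBr mulr1 mulrA r0 mul1r opprB addrC subrK.
have had : sn s (a - a0) <= d + d.
  have -> : a - a0 = (sigma eta - sigma xi) + (polar t phi - polar t' phi)%:A.
    by rewrite /a /a0 scalerBl opprD opprK addrACA [X in _ + X]addrC.
  apply: le_trans (snD _ _ _) _; first by apply/Cinf_wfin/CinfB; exact: sigma_Cinf.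
    by apply/Cinf_wfin/alg_Cinf.
  rewrite lerD // (le_trans (sn_alg _ _)) // polar_split (polar_split t') -mulrBl.
  rewrite nrm_mul nrm_polar normr1 mulr1 -rmorphB nrm_real distrC //.
have h1 : sn s b <= sn s b0 + sn s b0 * ((d + d) * sn s b).
  rewrite {1}bE; apply: le_trans (snB _ _ _) _ => //.
    by apply: wfinM => //; apply: wfinM => //; exact: CinfB.
  rewrite lerD2l (le_trans (snM s0 hb0 _)) //; first by apply: wfinM => //; exact: CinfB.
  rewrite ler_wpM2l ?sn_ge0 // (le_trans (snM s0 _ wb)) ?ler_wpM2r ?sn_ge0 //.
  exact: CinfB.
have h2 : sn s b0 * ((d + d) * sn s b) <= sn s b / 2.
  rewrite mulrA [leRHS]mulrC ler_wpM2r ?sn_ge0 // /d.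
  move: (sn s b0) (sn_ge0 s b0) => B B0.
  have B1 : 0 < B + 1 by rewrite ltr_wpDl.
  rewrite (_ : B * _ = 2^-1 * (B / (B + 1))); last by field; rewrite gt_eqF.
  by rewrite ler_piMr ?invr_ge0 // ler_pdivrMr ?mul1r ?lerDl.
lra.
Qed.

Lemma inv_at_bound s : 0 <= s -> exists2 M, 0 <= M &
  forall xi t b, xi != 0 -> 0 < t -> inv_at xi t b -> sn s b <= M / (`|xi| `^ w + t).
Proof.
move=> s0; have [M1 M10 hM1] := sigma_bound s.
(* Beyond [t0], the relation [polar t phi *: b = b * sigma eta - 1] gives [(t - M1) |b| <= 1], where
   [t - M1 >= (1 + t) / 2]. Below [t0] compactness applies. *)
pose t0 := 2 * M1 + 1; have t00 : 0 < t0 by rewrite ltr_wpDl ?mulr_ge0.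
have large eta t b : `|eta| = 1 -> t0 <= t -> inv_at eta t b -> sn s b <= 4 / (1 + t).
  move=> n1 tt [hb l r]; have e0 := unit_neq0 n1.
  have t_gt0 : 0 < t := lt_le_trans t00 tt.
  have wb := Cinf_wfin hb.
  have E : polar t phi *: b = b * sigma eta - 1.
    by rewrite -r mulrBr opprB addrC subrK -scalerAr mulr1.
  have : t * sn s b <= sn s b * M1 + 1.
    have -> : t * sn s b = sn s (polar t phi *: b) by rewrite snZ // nrm_polar gtr0_norm.
    have ws := Cinf_wfin (sigma_Cinf e0).
    apply: le_trans (_ : sn s (b * sigma eta) + sn s 1 <= _).
      by rewrite E; apply: snB; [exact: wfinM|exact: Cinf_wfin Cinf1].
    apply: lerD; last exact: sn_1.
    apply: le_trans (snM s0 hb ws) _; apply: ler_wpM2l (sn_ge0 _ _) _ _ _.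
    by have := hM1 _ e0; rewrite n1 powR1 mulr1.
  have B0 := sn_ge0 s b; rewrite ler_pdivlMr ?addr_gt0 // => h.
  rewrite /t0 in tt; nra.
have [M2 M20 small] : exists2 M, 0 <= M & forall eta t b, `|eta| = 1 -> 0 <= t <= t0 ->
    inv_at eta t b -> sn s b <= M.
  have cK := compact_setX sphere_compact (@segment_compact R 0 t0).
  have := (compact_near_coveringP _).1 cK R +oo
    (fun M x => forall b, inv_at x.1 x.2 b -> sn s b <= M) _.
  case.
    move=> [xi t] [/= /unit_neq0 x0]; rewrite in_itv /= => /andP[tt _].
    have [M M0 [d d0 hd]] := inv_at_local s0 x0 tt.
    exists ([set y | [/\ y.1 != 0, sn s (sigma y.1 - sigma xi) <= d & `|y.2 - t| <= d]],
            [set M' | M <= M']) => /=.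
      split; last by exists M; split => [|M' /ltW]; rewrite ?num_real.
      exists ([set eta | sn s (sigma eta - sigma xi) <= d /\ eta != 0], ball t d) => /=.
        split; last by apply: nbhsx_ballx.
        by apply: filterI; [exact: sigma_cont|exact: near_neq0].
      move=> [eta t'] /= [[h1 h2] h3]; split=> //.
      by move: h3; rewrite -ball_normE /= distrC => /ltW.
    move=> [[eta t'] M'] /= [[h1 h2 h3] h4] b hb.
    exact: le_trans (hd _ _ _ h1 h2 h3 hb) h4.
  move=> M [_ hM]; exists `|M + 1| => // eta t b n1 tt hb.
  apply: le_trans (hM (M + 1) _ (eta, t) _ b hb) (ler_norm _); first by rewrite ltrDl.
  by split => //=; rewrite in_itv.
pose M := 4 + M2 * (1 + t0).
have M0 : 0 <= M by rewrite addr_ge0 // mulr_ge0 // addr_ge0 // ltW.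
have all_t eta t b : `|eta| = 1 -> 0 <= t -> inv_at eta t b -> sn s b <= M / (1 + t).
  move=> n1 tt hb; have t1 : 0 < 1 + t by rewrite ltr_pwDl.
  have [h|h] := leP t0 t.
    apply: le_trans (large _ _ _ n1 h hb) _.
    by rewrite ler_wpM2r ?invr_ge0 ?(ltW t1) // lerDl mulr_ge0 // addr_ge0 // ltW.
  rewrite ler_pdivlMr // (@le_trans _ _ (M2 * (1 + t))) //.
    by rewrite ler_wpM2r ?(ltW t1) // (small eta t) // tt ltW.
  rewrite (@le_trans _ _ (M2 * (1 + t0))) ?lerDr //.
  by rewrite ler_wpM2l // lerD2l ltW.
exists M => // xi t b x0 t_gt0 [hb l r].
have [xE n1] := polar_scale x0; have nx : 0 < `|xi| by rewrite normr_gt0.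
set eta := _ *: xi in xE n1; have aw : 0 < `|xi| `^ w by rewrite powR_gt0.
(* Homogeneity rescales the parameter together with [xi]: an inverse at [(xi, t)] becomes one on the
   sphere at [t / |xi| ^ w]. *)
have E : sigma xi - (polar t phi)%:A =
    (`|xi| `^ w)%:C *: (sigma eta - (polar (t / `|xi| `^ w) phi)%:A).
  rewrite {1}xE sigma_hom ?unit_neq0 // scalerBr scalerA; congr (_ - _ *: _).
  by rewrite -polarM mulrC mulfVK // gt_eqF.
have inv' : inv_at eta (t / `|xi| `^ w) ((`|xi| `^ w)%:C *: b).
  split; first exact: CinfZ.
    by rewrite -scalerAr scalerAl -E.
  by rewrite -scalerAl scalerAr -E.
have := all_t _ _ _ n1 (ltW (divr_gt0 t_gt0 aw)) inv'.
rewrite snZ; last exact: Cinf_wfin hb.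
rewrite nrm_real gtr0_norm // -ler_pdivlMl //.
congr (_ <= _); move: (`|xi| `^ w) aw => X X0.
by field; rewrite (gt_eqF X0) gt_eqF //= addr_gt0.
Qed.

End ConeSymbol.

(** Constants of [param_diff]: the factor [1 / (J1 + t)] is at most [c / J], and [J / (J + t)] is at
    most 1, so [t] disappears. *)
Lemma diff_arith (R : realType) (M c e J J1 t : R) :
  0 <= M -> 0 <= c -> 0 < e -> 0 < J -> 0 < J1 -> 0 < t -> J <= c * J1 ->
  M / (J1 + t) * (e / (M * M * c + 1) * J * (M / (J + t))) <= e / J.
Proof.
move=> M0 c0 e0 J0 J10 t0 JJ.
have Jt : 0 < J + t by rewrite addr_gt0.
have J1t : 0 < J1 + t by rewrite addr_gt0.
have X0 : 0 <= M * M * c by rewrite !mulr_ge0.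
have X1 : 0 < M * M * c + 1 by rewrite ltr_wpDl.
have i1 : (J1 + t)^-1 <= c / J.
  rewrite -[leLHS]mul1r ler_pdivrMr // mulrAC ler_pdivlMr // mul1r.
  by apply: le_trans JJ _; rewrite ler_wpM2l // lerDl ltW.
have i2 : J * (J + t)^-1 <= 1 by rewrite ler_pdivrMr ?mul1r // lerDl ltW.
pose Y := M * M * (e / (M * M * c + 1)).
have Y0 : 0 <= Y by rewrite !mulr_ge0 ?invr_ge0 ?(ltW e0) ?(ltW X1).
apply: (@le_trans _ _ (Y * (c / J) * 1)).
  rewrite (_ : _ * _ = Y * (J1 + t)^-1 * (J * (J + t)^-1)); last by rewrite /Y; ring.
  apply: ler_pM => //.
  - by rewrite mulr_ge0 // invr_ge0 ltW.
  - by rewrite mulr_ge0 ?invr_ge0 ?(ltW J0) ?(ltW Jt).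
  - by rewrite ler_wpM2l.
rewrite mulr1 mulrA ler_wpM2r ?invr_ge0 ?(ltW J0) //.
rewrite (_ : _ * _ = (M * M * c) / (M * M * c + 1) * e); last by rewrite /Y; ring.
by rewrite ler_piMl ?(ltW e0) // ler_pdivrMr ?mul1r ?lerDl.
Qed.

Lemma ratio_arith (R : realType) (X e : R) : 0 <= X -> 0 < e ->
  X * (e / (2 * (X + 1))) <= e / 2.
Proof.
move=> X0 e0; have X1 : 0 < X + 1 by rewrite ltr_wpDl.
rewrite (_ : X * _ = e / 2 * (X / (X + 1))); last by field; rewrite gt_eqF.
by rewrite ler_piMr ?divr_ge0 ?(ltW e0) // ler_pdivrMr ?mul1r ?lerDl.
Qed.

Lemma far_arith (R : realType) (M d J Jm c t : R) :
  0 <= M -> 0 < d -> 0 < J -> 0 <= Jm -> 0 <= c -> 0 < t -> J <= c * Jm ->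
  2 * M * c / d <= t -> 2 * M / t <= d / J * Jm.
Proof.
move=> M0 d0 J0 Jm0 c0 t0 JJ; rewrite ler_pdivrMr // => ht.
rewrite ler_pdivrMr // mulrAC -!mulrA mulrA mulrAC ler_pdivlMr //.
apply: (@le_trans _ _ (2 * M * (c * Jm))); first by rewrite ler_wpM2l // mulr_ge0.
rewrite mulrA (le_trans (ler_wpM2r Jm0 ht)) //.
by rewrite le_eqVlt; apply/orP; left; apply/eqP; ring.
Qed.

(** When [m] is not small relative to [k], the weight of [k] is at most that of [m] divided by
    [kap]; the decay of coefficients in [m] can then pay for powers of [k]. *)
Lemma jp_far (R : realType) (n : nat) (kap w : R) (k m : 'rV[int]_n) :
  0 < kap -> kap <= 1 -> 0 <= w ->
  ~~ ((k != 0) && (`|lattice R m| <= kap * `|lattice R k|)) ->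
  jp w k <= kap `^ (- w) * jp w m.
Proof.
move=> kap0 kap1 w0 far.
rewrite powRN /jp mulrC ler_pdivlMr ?powR_gt0 //.
rewrite -powRM ?(ltW (wt_gt0 R k)) ?(ltW kap0) //.
apply: ge0_ler_powR; rewrite ?nnegrE ?(ltW (wt_gt0 R m)) //.
  by rewrite mulr_ge0 ?(ltW (wt_gt0 R k)) ?(ltW kap0).
rewrite mulrC /wt mulrDr mulr1 lerD //.
move: far; rewrite negb_and negbK => /orP[/eqP ->|].
  by rewrite lattice0 normr0 mulr0.
by rewrite -ltNge => /ltW.
Qed.

Lemma weight_regroup (R : realType) (c p J X D W : R) : 0 <= c ->
  p <= J * X * (D * W) -> c * p <= D * X * (J * W * c).
Proof.
move=> c0 /(ler_wpM2l c0) h; apply: le_trans h _.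
by rewrite le_eqVlt; apply/orP; left; apply/eqP; ring.
Qed.

Section Parametrix.
Variables (R : realType) (n : nat) (theta : 'M[R]_n) (T : ncTorus theta).
Local Notation C := R[i].
Local Notation Zn := 'rV[int]_n.
Local Notation monom := (monomial (@gen _ _ _ T)).
Local Notation lat := (lattice R).
Implicit Types (k l m : Zn) (s t e : R) (u v b : T) (xi eta : 'rV[R]_n).
Variables (sigma : 'rV[R]_n -> T) (w phi : R).
Hypothesis w_gt0 : 0 < w.
Hypothesis sigma_Cinf : forall xi, xi != 0 -> Cinf (sigma xi).
Hypothesis sigma_cont : forall xi, xi != 0 -> forall s e, 0 < e ->
  \forall eta \near xi, sn s (sigma eta - sigma xi) <= e.
Hypothesis sigma_hom : forall t xi, 0 < t -> xi != 0 ->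
  sigma (t *: xi) = (t `^ w)%:C *: sigma xi.
Hypothesis sigma_inv : forall xi, xi != 0 -> forall t, 0 <= t ->
  exists b, inv_at sigma phi xi t b.
Variable a : Zn -> T.
Hypothesis a_Cinf : forall k, Cinf (a k).
Hypothesis a_sigma : forall s, exists2 K, 0 <= K &
  forall k, k != 0 -> sn s (a k - sigma (lat k)) <= K * jp (w - 1) k.

(** At [k = 0], where the principal symbol carries no information, the value 0 keeps the difference
    with [polar t phi] invertible for [t > 0]. *)
Definition sigz k : T := if k == 0 then 0 else sigma (lat k).

Lemma lat_eq0 k : (lat k == 0) = (k == 0).
Proof.
apply/eqP/eqP => [/rowP h|->]; last exact: lattice0.
by apply/rowP => j; have := h j; rewrite !mxE => /eqP; rewrite intr_eq0 => /eqP.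
Qed.

Lemma lat_ge1 k : k != 0 -> 1 <= `|lat k|.
Proof.
move=> k0; have /rV0Pn[j kj] := k0.
apply: le_trans (coord_le (lat k) j); rewrite mxE.
by rewrite -intr_norm -[1]/(1%:~R) ler_int -gtz0_ge1 normr_gt0.
Qed.

Lemma jp_lat k : k != 0 -> `|lat k| `^ w <= jp w k <= 2 `^ w * `|lat k| `^ w.
Proof.
move=> k0; have k1 := lat_ge1 k0; rewrite /jp /wt -powRM //.
by rewrite !ge0_ler_powR ?nnegrE ?mulr_ge0 ?addr_ge0 ?(ltW w_gt0) ?lerDr // mulrDl mul1r lerD2r.
Qed.

Lemma sigz_Cinf k : Cinf (sigz k).
Proof.
rewrite /sigz; case: (eqVneq k 0) => k0; first exact: Cinf0.
by apply: sigma_Cinf; rewrite lat_eq0.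
Qed.

Lemma a_sigz s : exists2 K, 0 <= K & forall k, sn s (a k - sigz k) <= K * jp (w - 1) k.
Proof.
have [K K0 hK] := a_sigma s; exists (K + sn s (a 0)); first by rewrite addr_ge0 ?sn_ge0.
move=> k; rewrite /sigz; case: eqVneq => [->|k0].
  by rewrite subr0 jpz mulr1 lerDr.
by apply: le_trans (hK _ k0) _; rewrite ler_wpM2r ?jp_ge0 // lerDl sn_ge0.
Qed.

Lemma a_bound s : exists2 K, 0 <= K & forall k, sn s (a k) <= K * jp w k.
Proof.
have [K K0 hK] := a_sigz s.
have [M M0 hM] := sigma_bound sigma_Cinf sigma_cont sigma_hom s.
exists (K + M); first exact: addr_ge0.
move=> k; rewrite -(subrK (sigz k) (a k)) mulrDl.
have cs := sigz_Cinf k.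
apply: le_trans (snD s (Cinf_wfin (CinfB (a_Cinf k) cs)) (Cinf_wfin cs)) _.
apply: lerD.
  by apply: le_trans (hK k) _; rewrite ler_wpM2l // jp_le // gerBl.
rewrite /sigz; case: eqVneq => k0; first by rewrite sn0 mulr_ge0 ?jp_ge0.
apply: le_trans (hM _ _) _; first by rewrite lat_eq0.
by rewrite ler_wpM2l //; case/andP: (jp_lat k0).
Qed.

Definition is_param t (q : Zn -> T) := forall k,
  [/\ Cinf (q k), (sigz k - (polar t phi)%:A) * q k = 1 &
      q k * (sigz k - (polar t phi)%:A) = 1].

Lemma polar_neq0 t f : 0 < t -> polar t f != 0 :> C.
Proof.
move=> t0; apply/eqP => h; have := nrm_polar t f.
by rewrite h nrm0 => /esym/eqP; rewrite normr_eq0 gt_eqF.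
Qed.

Lemma param_exists t : 0 < t -> exists q, is_param t q.
Proof.
move=> t0; suff h k : exists b, [/\ Cinf b, (sigz k - (polar t phi)%:A) * b = 1 &
    b * (sigz k - (polar t phi)%:A) = 1] by have [q hq] := boolp.choice h; exists q.
rewrite /sigz; case: eqVneq => k0.
  have l0 := polar_neq0 phi t0.
  exists ((- polar t phi)^-1%:A); split; first exact: alg_Cinf.
    by rewrite sub0r -scaleNr -scalerAl mul1r scalerA mulfV ?scale1r // oppr_eq0.
  by rewrite sub0r -scaleNr -scalerAl mul1r scalerA mulVf ?scale1r // oppr_eq0.
have lk0 : lat k != 0 by rewrite lat_eq0.
by have [b [b1 b2 b3]] := sigma_inv lk0 (ltW t0); exists b.
Qed.

Lemma param_bound s : 0 <= s -> exists2 M, 0 <= M & forall t q, 1 <= t -> is_param t q ->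
  forall k, sn s (q k) <= M / (jp w k + t).
Proof.
move=> s0; have [M M0 hM] := inv_at_bound sigma_Cinf sigma_cont sigma_hom sigma_inv s0.
exists (2 `^ w * M + 2); first by rewrite addr_ge0 // mulr_ge0 // powR_ge0.
move=> t q t1 hq k; have [q1 q2 q3] := hq k; have t0 : 0 < t := lt_le_trans ltr01 t1.
have j0 := jp_gt0 w k; have jt : 0 < jp w k + t by rewrite addr_gt0.
move: q2 q3; rewrite /sigz; case: eqVneq => [k0|k0] q2 q3.
  have l0 := polar_neq0 phi t0.
  have -> : q k = (- polar t phi)^-1%:A.
    move: q2; rewrite sub0r -scaleNr -scalerAl mul1r => <-.
    by rewrite scalerA mulVf ?scale1r // oppr_eq0.
  rewrite (le_trans (sn_alg _ _ _)) // nrm_inv nrmN nrm_polar gtr0_norm //.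
  rewrite k0 jpz ler_pdivlMr ?addr_gt0 // mulrC ler_pdivrMr //.
  rewrite mulrDl -[1 + t]add0r lerD //; first by rewrite !mulr_ge0 ?powR_ge0 // ltW.
  by rewrite mulrDl mul1r lerD2r.
have lk0 : lat k != 0 by rewrite lat_eq0.
have x0 : 0 < `|lat k| `^ w by rewrite powR_gt0 // normr_gt0.
apply: le_trans (hM _ _ _ lk0 t0 _) _; first by split.
have two1 : (1 : R) <= 2 by rewrite ler1n.
have h2 : 1 <= 2 `^ w by have := ler_powR two1 (ltW w_gt0); rewrite powRr0.
have /andP[_ h3] := jp_lat k0.
rewrite ler_pdivrMr ?addr_gt0 // mulrAC ler_pdivlMr //.
move: (`|lat k| `^ w) (jp w k) (2 `^ w) x0 h2 h3 {jt j0} => X J c X0 c1 Jc.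
have h4 : M * (J + t) <= M * (c * X + c * t).
  by rewrite ler_wpM2l // lerD // ler_peMl // ltW.
by apply: le_trans h4 _; nra.
Qed.

(** If [wt k >= 1 / e], the missing order gives the factor [e]. Otherwise [jp w k] is bounded by
    [e ^ (- w)], which a large [t] dominates. This makes the lower order part of the symbol
    negligible. *)
Lemma small_ratio e : 0 < e -> exists2 L, 1 <= L & forall t k, L <= t ->
  jp (w - 1) k / (jp w k + t) <= e.
Proof.
move=> e0; pose X := e^-1 `^ w / e.
have X0 : 0 <= X by rewrite mulr_ge0 ?powR_ge0 ?invr_ge0 ?ltW.
exists (1 + X); first by rewrite lerDl.
move=> t k ht; have t0 : 0 < t by apply: lt_le_trans ht; rewrite ltr_pwDl.
have j0 := jp_gt0 w k; rewrite ler_pdivrMr ?addr_gt0 //.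
have w0 := wt_gt0 R k; rewrite jpA jpN {2}/jp powRr1 ?(ltW w0) //.
have [h|h] := leP e^-1 (wt R k).
  have h1 : (wt R k)^-1 <= e by rewrite -[e]invrK lef_pV2 ?posrE ?invr_gt0.
  apply: (@le_trans _ _ (jp w k * e)); first by rewrite ler_wpM2l // ltW.
  by rewrite mulrC ler_wpM2l ?(ltW e0) // lerDl ltW.
apply: (@le_trans _ _ (e * X)); last first.
  by rewrite ler_wpM2l ?(ltW e0) // (le_trans _ (lerD (ltW j0) ht)) // add0r lerDr.
rewrite /X mulrCA mulfV ?gt_eqF // mulr1 (@le_trans _ _ (jp w k)) //.
  by rewrite ler_piMr ?jp_ge0 // invf_le1 ?wt_ge1.
by rewrite /jp ge0_ler_powR ?nnegrE ?invr_ge0 ?(ltW w0) ?(ltW e0) ?(ltW w_gt0) // ltW.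
Qed.

(** Uses [q' - q = - q' (sigma' - sigma) q]: the symbols differ by a small multiple of [jp w k], and
    [kap <= 1/2] makes the weights at [k] and [m + k] comparable. The bound does not involve [t]. *)
Lemma param_diff s e : 0 <= s -> 0 < e -> exists kap, [/\ 0 < kap, kap <= 1 &
  forall t q k m, 1 <= t -> is_param t q -> k != 0 -> `|lat m| <= kap * `|lat k| ->
    sn s (q (m + k) - q k) <= e / jp w k].
Proof.
move=> s0 e0; have [M M0 hM] := param_bound s0.
have c0 : 0 <= M * M * 2 `^ w by rewrite !mulr_ge0 ?powR_ge0.
have d0 : 0 < e / (M * M * 2 `^ w + 1) by rewrite divr_gt0 // ltr_wpDl.
have [kap [kap0 kap1 hkap]] := sigma_unif sigma_Cinf sigma_cont sigma_hom s d0.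
set d := e / _ in d0 hkap.
exists kap; split=> //.
  by apply: le_trans kap1 _; rewrite invf_le1 ?ler1n.
move=> t q k m t1 hq k0 hm; have t0 : 0 < t := lt_le_trans ltr01 t1.
have x0 : 0 < `|lat k| := lt_le_trans ltr01 (lat_ge1 k0).
have lmk : lat (m + k) = lat k + lat m by rewrite latticeD addrC.
have hmk : 2^-1 * `|lat k| <= `|lat (m + k)|.
  have : `|lat k| <= `|lat (m + k)| + `|lat m|.
    by rewrite lmk -{1}(addrK (lat m) (lat k)) ler_normB.
  have : `|lat m| <= 2^-1 * `|lat k| by apply: le_trans hm _; rewrite ler_wpM2r.
  lra.
have mk0 : m + k != 0.
  by rewrite -lat_eq0 -normr_eq0 gt_eqF // (lt_le_trans _ hmk) // mulr_gt0 // invr_gt0.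
have hj : jp w k <= 2 `^ w * jp w (m + k).
  have wmk := wt_gt0 R (m + k); have wk := wt_gt0 R k.
  rewrite /jp -powRM ?(ltW wmk) // ge0_ler_powR ?nnegrE ?mulr_ge0 ?(ltW wmk) ?(ltW wk) ?(ltW w_gt0) //.
  by rewrite /wt; lra.
have [c1 l1 r1] := hq (m + k); have [c2 l2 r2] := hq k.
have cs : Cinf (sigz (m + k) - sigz k) by apply: CinfB; exact: sigz_Cinf.
have wp : wfin (coef ((sigz (m + k) - sigz k) * q k)) by apply: wfinM => //; exact: Cinf_wfin.
have E : q (m + k) - q k = - (q (m + k) * ((sigz (m + k) - sigz k) * q k)).
  have -> : sigz (m + k) - sigz k =
     (sigz (m + k) - (polar t phi)%:A) - (sigz k - (polar t phi)%:A).
    by rewrite opprB addrA subrK.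
  by rewrite mulrBl l2 mulrBr mulr1 mulrA r1 mul1r opprB.
rewrite E snN; apply: le_trans (snM s0 c1 wp) _.
apply: le_trans (ler_wpM2l (sn_ge0 _ _) (snM s0 cs (Cinf_wfin c2))) _.
have h1 := hM _ _ t1 hq (m + k); have h2 := hM _ _ t1 hq k.
have h3 : sn s (sigz (m + k) - sigz k) <= d * jp w k.
  rewrite /sigz (negbTE mk0) (negbTE k0) lmk.
  apply: le_trans (hkap _ _ _ hm) _; first by rewrite lat_eq0.
  by rewrite ler_wpM2l ?(ltW d0) //; have /andP[] := jp_lat k0.
have j0 := jp_gt0 w k; have j1 := jp_gt0 w (m + k).
apply: (@le_trans _ _ (M / (jp w (m + k) + t) * (d * jp w k * (M / (jp w k + t))))).
  apply: (ler_pM (sn_ge0 _ _) (mulr_ge0 (sn_ge0 _ _) (sn_ge0 _ _)) h1).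
  exact: (ler_pM (sn_ge0 _ _) (sn_ge0 _ _) h3 h2).
exact: diff_arith.
Qed.

Lemma esum_coef_shift (f : Zn -> R) k u : (forall m, 0 <= f m) ->
  (\esum_(l in setT) (nrm (coef (u * monom k) l) * f l)%:E =
   \esum_(m in setT) (nrm (coef u m) * f (m + k))%:E)%E.
Proof.
move=> f0; rewrite (esum_shift _ k); congr (esum _ _); apply/funext => m.
by rewrite nrm_coef_mulr addrK.
Qed.

(* [q k] inverts the principal symbol minus [polar t phi] at the point [k]. The
   remainder compares [q l] with [q k]: for [l - k] small against [k] this is
   uniform continuity on the sphere, otherwise the decay of [coef (a k)] wins. *)
Lemma parametrix N e : 0 <= N -> 0 < e -> exists L K, [/\ 1 <= L, 0 <= K &
  forall t, L <= t -> exists q r : Zn -> T,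
  [/\ forall k, Cinf (q k),
      forall x k, `|x| <= N ->
        (wn x (coef (q k * monom k)%R) <= (K * (jp x k / (jp w k + t)))%:E)%E,
      forall k, partial_sum (fun l => coef (a k * monom k) l *: (q l * monom l)) @ totally
        --> polar t phi *: (q k * monom k) + monom k + r k &
      forall x k, `|x| <= N -> (wn x (coef (r k)) <= (e * jp x k)%:E)%E]].
Proof.
move=> N0 e0; have [M M0 hM] := param_bound N0.
(* The additional weight [w] on the coefficients of [a k] pays for the differences [q l - q k] at
   distant [l]. *)
have [A A0 hA] := a_bound (N + w).
have [B B0 hB] := a_sigz N.
pose d := e / (2 * (A + 1)).
have A1 : 0 < A + 1 by rewrite ltr_wpDl.
have d0 : 0 < d by rewrite divr_gt0 // mulr_gt0.
have [kap [kap0 kap1 hkap]] := param_diff N0 d0.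
pose K2 := 2 * M * kap `^ (- w); have K20 : 0 <= K2 by rewrite !mulr_ge0 ?powR_ge0.
have e4 : 0 < e / (2 * (M * B + 1)) by rewrite divr_gt0 // mulr_gt0 // ltr_wpDl ?mulr_ge0.
have [L1 L11 hL1] := small_ratio e4.
pose L := L1 + K2 / d.
have K2d : 0 <= K2 / d by rewrite mulr_ge0 // invr_ge0 ltW.
have L1L : L1 <= L by rewrite lerDl.
exists L, M; split=> //; first exact: le_trans L1L.
move=> t Lt; have t1 : 1 <= t by apply: le_trans Lt; exact: le_trans L1L.
have t0 : 0 < t := lt_le_trans ltr01 t1.
have [q hq] := param_exists t0; exists q.
have qC k : Cinf (q k) by have [] := hq k.
have qw k : wfin (coef (q k)) := Cinf_wfin (qC k).
have sum_ex k : exists v, partial_sum (fun l => coef (a k * monom k) l *: (q l * monom l)) @ totally --> v.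
  exists (summability.sum (fun l => coef (a k * monom k) l *: (q l * monom l))).
  have cw := Cinf_wfin (Cinf_mulr k (a_Cinf k)).
  apply: nsum_cvg; apply: (@le_lt_trans _ _ (M%:E * wn 0 (coef (a k * monom k)%R))%E).
    rewrite /wn -esumTZ //; last by move=> l; rewrite lee_fin mulr_ge0 ?jp_ge0 ?nrm_ge0.
    apply: le_esumT => l; rewrite -EFinM lee_fin jp0 mul1r nrmZ mulrC ler_wpM2r ?nrm_ge0 //.
    rewrite (le_trans (nrm_unitary_mulr _ (monom_unitary _ _))) //.
    rewrite (le_trans (nrm_le_sn N0 (qC l))) // (le_trans (hM _ _ t1 hq l)) //.
    have j0 := jp_ge0 w l; rewrite ler_piMr // invf_le1; last by rewrite ltr_wpDl.
    by rewrite (le_trans t1) // lerDr.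
  by rewrite lte_mul_pinfty ?lee_fin // cw.
have [v hv] := boolp.choice sum_ex.
pose lam := polar t phi; exists (fun k => v k - (lam *: (q k * monom k) + monom k)).
split=> //.
- move=> x k xN; apply: le_trans (wn_mulr _ _ xN) _; rewrite snE // -EFinM lee_fin.
  by rewrite mulrCA ler_wpM2l ?jp_ge0 // hM.
- by move=> k; rewrite addrC subrK.
move=> x k xN; set p := a k * monom k in v hv sum_ex *.
pose rest := q k * (a k - sigz k) * monom k.
have restE : q k * p - (lam *: (q k * monom k) + monom k) = rest.
  have [_ _ r1] := hq k.
  have qs : q k * sigz k = lam *: q k + 1.
    by rewrite -r1 mulrBr -scalerAr mulr1 addrC subrK.
  by rewrite /rest /p mulrBr qs mulrBl mulrA mulrDl mul1r -scalerAl.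
(* Freezing [q l] at [q k] would give exactly [q k * p], which differs from the expected value by
   the lower order term [rest]; [main] expresses the error of the freezing. *)
have main : partial_sum (fun l => coef p l *: ((q l - q k) * monom l)) @ totally -->
    v k - q k * p.
  have hp : fsummable p by apply/Cinf_fsum/Cinf_mulr.
  have h2 : partial_sum (fun l => q k * (coef p l *: monom l)) @ totally --> q k * p.
    apply: (@psum_lin _ _ _ _ _ _ (fun y : T => q k * y) (nrm (q k))) hp => [y z||y].
    - by rewrite mulrDr.
    - by rewrite mulr0.
    - exact: nrmM.
  have := psum_lincomb (c := -1) h2 (hv k); rewrite scaleN1r addrC.
  rewrite (_ : (fun i => _) = (fun l => coef p l *: ((q l - q k) * monom l))) //.
  apply/funext => l; rewrite scaleN1r -scalerAr mulrBl scalerBr addrC //.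
have -> : v k - (lam *: (q k * monom k) + monom k) = (v k - q k * p) + rest.
  by rewrite -restE addrA subrK.
have cas : Cinf (a k - sigz k) by apply: CinfB => //; exact: sigz_Cinf.
have jw := jp_gt0 w k; have jx := jp_gt0 x k.
have S1 : (wn x (coef rest) <= (e / 2 * jp x k)%:E)%E.
  apply: le_trans (wn_mulr _ _ xN) _.
  have wqa : wfin (coef (q k * (a k - sigz k))) by apply: wfinM => //; exact: Cinf_wfin.
  rewrite snE // -EFinM lee_fin mulrC ler_wpM2r ?jp_ge0 //.
  apply: le_trans (snM N0 (qC k) (Cinf_wfin cas)) _.
  apply: (@le_trans _ _ (M / (jp w k + t) * (B * jp (w - 1) k))).
    by rewrite ler_pM ?sn_ge0 // hM.
  rewrite (_ : _ * _ = M * B * (jp (w - 1) k / (jp w k + t))); last by ring.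
  apply: (@le_trans _ _ (M * B * (e / (2 * (M * B + 1))))).
    by rewrite ler_wpM2l ?mulr_ge0 // hL1 // (le_trans L1L).
  exact: (ratio_arith (mulr_ge0 M0 B0)).
have diff m : sn N (q (m + k) - q k) <= d / jp w k * jp w m.
  have jm := jp_gt0 w m.
  case: (boolP ((k != 0) && (`|lat m| <= kap * `|lat k|))) => [/andP[k0 hm]|far].
    apply: le_trans (hkap _ _ _ _ t1 hq k0 hm) _.
    have := ler_wpM2l (divr_ge0 (ltW d0) (ltW jw)) (jp_ge1 m (ltW w_gt0)).
    by rewrite mulr1.
  have hJ := jp_far kap0 kap1 (ltW w_gt0) far.
  apply: le_trans (snB _ (qw _) (qw _)) _.
  apply: (@le_trans _ _ (2 * M / t)).
    have bd l : sn N (q l) <= M / t.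
      apply: le_trans (hM _ _ t1 hq l) _; rewrite ler_wpM2l // lef_pV2 ?posrE //.
        by rewrite lerDr jp_ge0.
      by rewrite ltr_wpDl ?jp_ge0.
    by rewrite mulrAC -mulrA mulrDl mul1r mulrC lerD.
  apply: (far_arith M0 d0 jw (ltW jm) (powR_ge0 _ _) t0 hJ); apply: le_trans Lt.
  by rewrite lerDr (le_trans ler01).
have S2 : (wn x (coef (v k - q k * p)%R) <= (e / 2 * jp x k)%:E)%E.
  apply: le_trans (wn_series_id x main) _.
  apply: (@le_trans _ _ (\esum_(l in setT) (nrm (coef p l) * (jp x l * sn N (q l - q k)))%:E)%E).
    apply: le_esumT => l.
    rewrite (_ : coef _ = fun m => coef p l * coef ((q l - q k) * monom l) m); last first.
      by apply/funext => m; rewrite coefZ.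
    rewrite wnZ EFinM lee_wpmul2l ?lee_fin ?nrm_ge0 // EFinM -snE; last exact: wfin_coefB.
    exact: wn_mulr.
  rewrite /p esum_coef_shift; last by move=> m; rewrite mulr_ge0 ?jp_ge0 ?sn_ge0.
  apply: (@le_trans _ _ ((d / jp w k * jp x k)%:E * wn (N + w) (coef (a k)))%E).
    have dj0 : 0 <= d / jp w k * jp x k.
      by rewrite mulr_ge0 ?(ltW jx) // divr_ge0 ?(ltW d0) ?(ltW jw).
    rewrite /wn -esumTZ //; last by move=> m; rewrite lee_fin mulr_ge0 ?jp_ge0 ?nrm_ge0.
    apply: le_esumT => m; rewrite -EFinM lee_fin jpA.
    have h := ler_pM (jp_ge0 _ _) (sn_ge0 _ _) (peetre m k xN) (diff m).
    exact: weight_regroup (nrm_ge0 _) h.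
  rewrite snE; last exact: Cinf_wfin.
  rewrite -EFinM lee_fin mulrAC ler_wpM2r ?jp_ge0 //.
  apply: le_trans (ratio_arith A0 e0); rewrite -/d mulrC.
  rewrite mulrA ler_pdivrMr // mulrAC ler_wpM2r ?(ltW d0) //.
apply: (@le_trans _ _ (wn x (coef (v k - q k * p)%R) + wn x (coef rest))%E).
  apply: le_trans (wnD _ _ _); apply: le_esumT => l; by rewrite coefD.
by rewrite [e]splitr mulrDl EFinD leeD.
Qed.

End Parametrix.

(** * A priori estimates and the resolvent *)

Section Regularity.
Variables (R : realType) (n : nat) (theta : 'M[R]_n) (T : ncTorus theta).
Local Notation C := R[i].
Local Notation Zn := 'rV[int]_n.
Local Notation monom := (monomial (@gen _ _ _ T)).
Implicit Types (k l m j : Zn) (s t e x : R) (u g f : Zn -> C).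

(* The column equations [\sum_k u_k D_lk = g_l], the sums being limits along
   finite sets of indices. *)
Definition column_eq (d : Zn -> T) u g := forall l e, 0 < e ->
  \forall F \near @totally Zn,
    nrm (g l - \sum_(k <- (F : {fset Zn})) u k * coef (d k) l) < e.

Section Key.
Variables (d q r : Zn -> T) (s0 w D K : R).
Hypotheses (D0 : 0 <= D) (K0 : 0 <= K).
Hypothesis qd : forall k,
  partial_sum (fun l => coef (d k) l *: (q l * monom l)) @ totally --> monom k + r k.
Hypothesis d_bound : forall k, (wn (- s0 - w) (coef (d k)) <= (D * jp (- s0) k)%:E)%E.
Hypothesis q_bound : forall l,
  (wn (- s0) (coef (q l * monom l)%R) <= (K * jp (- s0 - w) l)%:E)%E.
Variables (u g : Zn -> C).
Hypothesis u_fin : (wn (- s0) u < +oo)%E.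
Hypothesis ug : column_eq d u g.

Let Q j l := nrm (coef (q l * monom l) j).

(** For a finite set of columns the parametrix may be applied termwise; it produces
    [\sum_k u_k (monom k + r k)], whose coefficient at [j] is read off. *)
Lemma key_partial (F : {fset Zn}) j : j \in F ->
  ((nrm (u j))%:E <= \esum_(l in setT) (nrm (\sum_(k <- F) u k * coef (d k) l) * Q j l)%:E
     + \esum_(k in setT) (nrm (u k) * nrm (coef (r k) j))%:E)%E.
Proof.
move=> jF; have [B B0 hB] := coef_bound T.
have h : partial_sum (fun l => (\sum_(k <- F) u k * coef (d k) l) *: (q l * monom l)) @ totally
   --> \sum_(k <- F) u k *: (monom k + r k).
  have hk k : partial_sum (fun l => u k *: (coef (d k) l *: (q l * monom l))) @ totally
      --> u k *: (monom k + r k).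
    have := psum_lincomb (c := u k) (@qd k) (@psum_zero R T Zn); rewrite addr0.
    rewrite (_ : (fun i => _ + 0) = (fun l => u k *: (coef (d k) l *: (q l * monom l)))) //.
    by apply/funext => l; rewrite addr0.
  have := psum_bigsum (s := enum_fset F) hk.
  rewrite (_ : (fun i => \sum_(k <- F) _) =
    (fun l => (\sum_(k <- F) u k * coef (d k) l) *: (q l * monom l))) //.
  by apply/funext => l; rewrite scaler_suml; apply: eq_bigr => k _; rewrite scalerA.
have := @psum_phi_le _ _ _ _ _ _ (fun y => coef y j) B _ _ _ h.
move=> /(_ (fun y z => coefD y z j) (coef0 T j) (fun y => hB y j)) h1.
have E : coef (\sum_(k <- F) u k *: (monom k + r k)) j =
    u j + \sum_(k <- F) u k * coef (r k) j.
  rewrite coef_sum; under eq_bigr do rewrite coefZ coefD coef_monom mulrDr.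
  rewrite big_split /= (big_fsetD1 j) //= eqxx mulr1 big_seq [X in _ + X + _]big1 ?addr0 //.
  by move=> k; rewrite !inE => /andP[kj _]; rewrite eq_sym (negbTE kj) mulr0.
rewrite E in h1.
have h2 : nrm (u j) <= nrm (u j + \sum_(k <- F) u k * coef (r k) j) +
   \sum_(k <- F) nrm (u k) * nrm (coef (r k) j).
  rewrite -{1}(addrK (\sum_(k <- F) u k * coef (r k) j) (u j)).
  rewrite (le_trans (nrmB _ _)) // lerD2l (le_trans (nrm_sum _ _)) //.
  by apply: ler_sum => k _; rewrite nrm_mul.
apply: (@le_trans _ _ ((nrm (u j + \sum_(k <- F) u k * coef (r k) j))%:E +
   (\sum_(k <- F) nrm (u k) * nrm (coef (r k) j))%:E)%E); first by rewrite -EFinD lee_fin.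
apply: leeD.
  apply: le_trans h1 _; apply: le_esumT => l; rewrite coefZ nrm_mul //.
rewrite -sumEFin.
exact: (esum_fset_le (fun k => (nrm (u k) * nrm (coef (r k) j))%:E)).
Qed.

(** The column equation holds only in the limit; enlarging [F] to a set where it is nearly satisfied
    leaves an error bounded by the absolute sum outside [F]. *)
Lemma key_tail (F : {fset Zn}) l :
  ((nrm (g l - \sum_(k <- F) u k * coef (d k) l))%:E <=
   \esum_(k in setT) (if k \in F then 0 else nrm (u k) * nrm (coef (d k) l))%:E)%E.
Proof.
set S := (X in (_ <= X)%E).
have S0 : (0 <= S)%E.
  by apply: esumT_ge0 => k; case: ifP; rewrite lee_fin ?mulr_ge0 ?nrm_ge0.
have [|] := leP (+oo%E) S; first by rewrite leye_eq => /eqP ->; rewrite leey.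
move=> hS; have hSn : S \is a fin_num by rewrite ge0_fin_numE.
rewrite -(fineK hSn) lee_fin; apply/ler_addgt0Pr => e e0.
have [A _ hA] := ug l e0.
have := hA (A `|` F)%fset; rewrite /= fsubsetUl => /(_ isT) h.
have FA : (F `<=` A `|` F)%fset by rewrite fsubsetUr.
have E : g l - \sum_(k <- F) u k * coef (d k) l =
   (g l - \sum_(k <- (A `|` F)%fset) u k * coef (d k) l) +
   \sum_(k <- ((A `|` F) `\` F)%fset) u k * coef (d k) l.
  by rewrite (sum_fsubset (fun k => u k * coef (d k) l) FA) opprD addrA subrK.
rewrite E (le_trans (nrmD _ _)) // addrC lerD //; last exact: ltW.
rewrite -lee_fin fineK //; apply: le_trans (esum_fset_le _ ((A `|` F) `\` F)%fset).
rewrite sumEFin lee_fin (le_trans (nrm_sum _ _)) // big_seq [leRHS]big_seq.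
apply: ler_sum => k; rewrite inE => /andP[/negbTE -> _].
by rewrite nrm_mul.
Qed.

(* Exchanging the two summations in [\sum_l Q_jl (\sum_k D_lk u_k)], which only
   converge for the weak weight [- s0]. *)
Lemma key_estimate j :
  ((nrm (u j))%:E <= \esum_(l in setT) (nrm (g l) * Q j l)%:E
     + \esum_(k in setT) (nrm (u k) * nrm (coef (r k) j))%:E)%E.
Proof.
set G := \esum_(l in _) _; set S := \esum_(k in _) _.
have Q0 l : 0 <= Q j l by exact: nrm_ge0.
have Qb l : Q j l <= jp s0 j * K * jp (- s0 - w) l.
  have := le_trans (wn_coord (- s0) (coef (q l * monom l)) j) (q_bound l).
  rewrite lee_fin [jp (- s0) j]jpN mulrC ler_pdivrMr; last exact: jp_gt0.
  by rewrite mulrAC [K * _]mulrC.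
pose D' := jp s0 j * K * D; have D'0 : 0 <= D' by rewrite !mulr_ge0 ?jp_ge0.
have colb k : (\esum_(l in setT) (nrm (coef (d k) l) * Q j l)%:E <= (D' * jp (- s0) k)%:E)%E.
  apply: (@le_trans _ _ ((jp s0 j * K)%:E * wn (- s0 - w) (coef (d k)))%E).
    rewrite /wn -esumTZ ?mulr_ge0 ?jp_ge0 //; last first.
      by move=> l; rewrite lee_fin mulr_ge0 ?jp_ge0 ?nrm_ge0.
    apply: le_esumT => l; rewrite -EFinM lee_fin mulrC mulrA ler_wpM2r ?nrm_ge0 //.
  apply: le_trans (lee_wpmul2l _ (d_bound k)) _; first by rewrite lee_fin mulr_ge0 ?jp_ge0.
  by rewrite -EFinM lee_fin mulrA.
have tot : (\esum_(k in setT) (D' * (jp (- s0) k * nrm (u k)))%:E < +oo)%E.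
  rewrite [X in (X < _)%E](_ : _ = (D'%:E * wn (- s0) u)%E); last first.
    rewrite /wn -esumTZ // => k; by rewrite lee_fin mulr_ge0 ?jp_ge0 ?nrm_ge0.
  by rewrite lte_mul_pinfty ?lee_fin.
suff h e : 0 < e -> ((nrm (u j))%:E <= (G + S) + e%:E)%E.
  by apply/lee_addgt0Pr => e e0; exact: h.
move=> e0.
have [|F0 hF0] := esumT_tail _ tot e0.
  by move=> k; rewrite lee_fin !mulr_ge0 ?jp_ge0 ?nrm_ge0.
pose F := (j |` F0)%fset.
apply: le_trans (key_partial (fset1U1 j F0)) _; rewrite -/F -/S.
rewrite addeAC leeD2r //.
apply: (@le_trans _ _ (\esum_(l in setT) ((nrm (g l) * Q j l)%:E +
    (nrm (g l - \sum_(k <- F) u k * coef (d k) l) * Q j l)%:E))%E).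
  apply: le_esumT => l; rewrite -EFinD lee_fin -mulrDl ler_wpM2r //.
  rewrite -{1}(subrK (g l) (\sum_(k <- F) _)) (le_trans (nrmD _ _)) // addrC lerD2l.
  by rewrite nrmC.
rewrite esumTD; last 2 first.
- by move=> l; rewrite lee_fin mulr_ge0 ?nrm_ge0.
- by move=> l; rewrite lee_fin mulr_ge0 ?nrm_ge0.
rewrite leeD2l //.
pose c k l : R := if k \in F then 0 else nrm (u k) * nrm (coef (d k) l).
have c0 k l : 0 <= c k l by rewrite /c; case: ifP => // _; rewrite mulr_ge0 ?nrm_ge0.
apply: (@le_trans _ _ (\esum_(l in setT) \esum_(k in setT) (Q j l * c k l)%:E)%E).
  apply: le_esumT => l; rewrite mulrC EFinM.
  rewrite [leRHS](_ : _ = ((Q j l)%:E * \esum_(k in setT) (c k l)%:E)%E); last first.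
    by rewrite -esumTZ // => k; rewrite lee_fin.
  by rewrite lee_wpmul2l ?lee_fin // key_tail.
rewrite esumT_exchange; last by move=> l k; rewrite lee_fin mulr_ge0.
apply: le_trans hF0; apply: le_esumT => k; rewrite /c.
case: (boolP (k \in F)) => kF.
  rewrite esum1; last by move=> l _; rewrite mulr0.
  by case: ifP => _ //; rewrite lee_fin !mulr_ge0 ?jp_ge0 ?nrm_ge0.
have -> : (k \in F0) = false by apply: contraNF kF => kF0; rewrite !inE kF0 orbT.
rewrite [leLHS](_ : _ = ((nrm (u k))%:E * \esum_(l in setT) (nrm (coef (d k) l) * Q j l)%:E)%E).
  apply: le_trans (lee_wpmul2l _ (colb k)) _; first by rewrite lee_fin nrm_ge0.
  by rewrite -EFinM lee_fin [leRHS]mulrA [leRHS]mulrC.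
rewrite -esumTZ ?nrm_ge0 //; last by move=> l; rewrite lee_fin mulr_ge0 ?nrm_ge0.
by congr (esum _ _); apply/funext => l; rewrite -EFinM mulrC -mulrA.
Qed.

(** Summing [key_estimate] against [om] gives [X <= Y + X / 2]. Subtracting is licit because [X] is
    finite; the weight [om] is left free so that [gain] can choose one for which this is known. *)
Lemma key_absorb (om : Zn -> R) : (forall k, 0 <= om k) ->
  (\esum_(k in setT) (om k * nrm (u k))%:E < +oo)%E ->
  (forall k, (\esum_(j in setT) (om j * nrm (coef (r k) j))%:E <= (2^-1 * om k)%:E)%E) ->
  (\esum_(k in setT) (om k * nrm (u k))%:E <=
   2%:E * \esum_(l in setT) ((nrm (g l))%:E * \esum_(j in setT) (om j * Q j l)%:E))%E.
Proof.
move=> om0; set X := \esum_(k in _) _; move=> Xfin hr.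
have X0 : (0 <= X)%E by apply: esumT_ge0 => k; rewrite lee_fin mulr_ge0 ?nrm_ge0.
set Y := \esum_(l in _) (_ * _)%E.
have h : (X <= Y + (2^-1)%:E * X)%E.
  apply: (@le_trans _ _ (\esum_(j in setT) (((om j)%:E * (\esum_(l in setT) (nrm (g l) * Q j l)%:E))
     + ((om j)%:E * (\esum_(k in setT) (nrm (u k) * nrm (coef (r k) j))%:E))))%E).
    apply: le_esumT => j; rewrite EFinM. rewrite -ge0_muleDr.
    - by apply: lee_wpmul2l; [rewrite lee_fin|exact: key_estimate].
    - by apply: esumT_ge0 => l; rewrite lee_fin mulr_ge0 ?nrm_ge0.
    - by apply: esumT_ge0 => l; rewrite lee_fin mulr_ge0 ?nrm_ge0.
  rewrite esumTD; last 2 first.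
  - by move=> j; rewrite mule_ge0 ?lee_fin // esumT_ge0 // => l; rewrite lee_fin mulr_ge0 ?nrm_ge0.
  - by move=> j; rewrite mule_ge0 ?lee_fin // esumT_ge0 // => l; rewrite lee_fin mulr_ge0 ?nrm_ge0.
  apply: leeD.
    rewrite /Y [leLHS](_ : _ = \esum_(j in setT) \esum_(l in setT) (nrm (g l) * (om j * Q j l))%:E)%E.
      rewrite esumT_exchange; last by move=> j l; rewrite lee_fin !mulr_ge0 ?nrm_ge0.
      apply: le_esumT => l; rewrite -esumTZ ?nrm_ge0 // => j.
      by rewrite lee_fin mulr_ge0 ?nrm_ge0.
    congr (esum _ _); apply/funext => j; rewrite -esumTZ //; last first.
      by move=> l; rewrite lee_fin mulr_ge0 ?nrm_ge0.
    by congr (esum _ _); apply/funext => l; rewrite -EFinM mulrCA.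
  rewrite [leLHS](_ : _ = \esum_(j in setT) \esum_(k in setT)
      (nrm (u k) * (om j * nrm (coef (r k) j)))%:E)%E.
    rewrite esumT_exchange; last by move=> j k; rewrite lee_fin !mulr_ge0 ?nrm_ge0.
    rewrite /X -esumTZ ?invr_ge0 //; last by move=> k; rewrite lee_fin mulr_ge0 ?nrm_ge0.
    apply: le_esumT => k.
    rewrite [leLHS](_ : _ = ((nrm (u k))%:E *
        \esum_(j in setT) (om j * nrm (coef (r k) j))%:E)%E); last first.
      by rewrite -esumTZ ?nrm_ge0 // => j; rewrite lee_fin mulr_ge0 ?nrm_ge0.
    apply: le_trans (lee_wpmul2l _ (hr k)) _; first by rewrite lee_fin nrm_ge0.
    by rewrite -!EFinM lee_fin mulrCA [nrm _ * _]mulrC.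
  congr (esum _ _); apply/funext => j; rewrite -esumTZ //; last first.
    by move=> k; rewrite lee_fin mulr_ge0 ?nrm_ge0.
  by congr (esum _ _); apply/funext => k; rewrite -EFinM mulrCA.
have Y0 : (0 <= Y)%E.
  apply: esumT_ge0 => l; rewrite mule_ge0 ?lee_fin ?nrm_ge0 // esumT_ge0 // => j.
  by rewrite lee_fin mulr_ge0 ?nrm_ge0.
have Xn : X \is a fin_num by rewrite ge0_fin_numE.
move: h; rewrite -(fineK Xn); case: (Y) Y0 => [y| |] //= y0.
  by rewrite -!EFinM -EFinD !lee_fin; lra.
by move=> _; rewrite mulry gtr0_sg // mul1e leey.
Qed.

End Key.

Section Gain.
Variables (d q r : Zn -> T) (s0 w D K N : R).
Hypotheses (D0 : 0 <= D) (K0 : 0 <= K) (s00 : 0 <= s0) (w0 : 0 < w) (s0N : s0 <= N).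
Hypothesis qd : forall k,
  partial_sum (fun l => coef (d k) l *: (q l * monom l)) @ totally --> monom k + r k.
Hypothesis d_bound : forall k, (wn (- s0 - w) (coef (d k)) <= (D * jp (- s0) k)%:E)%E.
Hypothesis q_bound : forall x l, `|x| <= N ->
  (wn x (coef (q l * monom l)%R) <= (K * jp (x - w) l)%:E)%E.
Hypothesis r_bound : forall x k, `|x| <= N -> (wn x (coef (r k)) <= (2^-1 * jp x k)%:E)%E.

(** The norm of weight [x + w] is not known to be finite beforehand. Absorption is carried out with
    the smaller of this weight and [B * jp (- s0)], for which it is finite, and yields a bound
    independent of [B]. The remainder is halved by both weights, hence by their minimum. *)
Lemma gain u g x : (wn (- s0) u < +oo)%E -> column_eq d u g ->
  - s0 <= x -> x + w <= N -> (wn (x + w) u <= (2 * K)%:E * wn x g)%E.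
Proof.
move=> uf ug sx xN; have xN' : `|x + w| <= N.
  by rewrite ler_norml xN andbT (le_trans _ (ler_wpDr (ltW w0) sx)) // lerN2.
have sN' : `|- s0| <= N by rewrite normrN ger0_norm.
have cap B : 0 <= B ->
    (\esum_(k in setT) (Num.min (jp (x + w) k) (B * jp (- s0) k) * nrm (u k))%:E <=
    (2 * K)%:E * wn x g)%E.
  move=> B0; pose om k := Num.min (jp (x + w) k) (B * jp (- s0) k).
  have om0 k : 0 <= om k by rewrite le_min jp_ge0 mulr_ge0 ?jp_ge0.
  have qb l : (wn (- s0) (coef (q l * monom l)%R) <= (K * jp (- s0 - w) l)%:E)%E.
    exact: q_bound.
  apply: le_trans (@key_absorb d q r s0 w D K D0 K0 qd d_bound qb u g uf ug om om0 _ _) _.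
  - apply: (@le_lt_trans _ _ (B%:E * wn (- s0) u)%E); last by rewrite lte_mul_pinfty ?lee_fin.
    rewrite /wn -esumTZ //; last by move=> k; rewrite lee_fin mulr_ge0 ?jp_ge0 ?nrm_ge0.
    apply: le_esumT => k; rewrite -EFinM lee_fin mulrA ler_wpM2r ?nrm_ge0 //.
    by rewrite ge_min lexx orbT.
  - move=> k; rewrite /om minr_pMr ?invr_ge0 // EFin_min le_min; apply/andP; split.
      apply: le_trans (r_bound k xN'); apply: le_esumT => j.
      by rewrite lee_fin ler_wpM2r ?nrm_ge0 // ge_min lexx.
    apply: (@le_trans _ _ (B%:E * wn (- s0) (coef (r k)))%E).
      rewrite /wn -esumTZ //; last by move=> j; rewrite lee_fin mulr_ge0 ?jp_ge0 ?nrm_ge0.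
      apply: le_esumT => j; rewrite -EFinM lee_fin mulrA ler_wpM2r ?nrm_ge0 //.
      by rewrite ge_min lexx orbT.
    apply: le_trans (lee_wpmul2l _ (r_bound k sN')) _; first by rewrite lee_fin.
    by rewrite -EFinM lee_fin mulrCA.
  rewrite EFinM -muleA lee_wpmul2l ?lee_fin //.
  rewrite /wn -esumTZ //; last by move=> k; rewrite lee_fin mulr_ge0 ?jp_ge0 ?nrm_ge0.
  apply: le_esumT => l.
  apply: (@le_trans _ _ ((nrm (g l))%:E * (K * jp x l)%:E)%E); last first.
    by rewrite -!EFinM lee_fin mulrC mulrA.
  rewrite lee_wpmul2l ?lee_fin ?nrm_ge0 //.
  have := q_bound l xN'; rewrite addrK; apply: le_trans.
  apply: le_esumT => j; rewrite lee_fin ler_wpM2r ?nrm_ge0 //.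
  by rewrite ge_min lexx.
apply: esum_leP => F.
(* This [B] dominates each [jp (x + w + s0) k] with [k] in [F], so on [F] the truncated weight is
   the full one. *)
pose B : R := \sum_(k <- F) jp (x + w + s0) k.
have B0 : 0 <= B by apply: sumr_ge0 => k _; exact: jp_ge0.
apply: le_trans (cap B B0); apply: le_trans (esum_fset_le _ F).
rewrite big_seq [leRHS]big_seq; apply: lee_sum => k kF; rewrite lee_fin ler_wpM2r ?nrm_ge0 //.
rewrite le_min lexx /= jpN ler_pdivlMr ?jp_gt0 // -jpA.
rewrite /B (big_fsetD1 k) //= lerDl; apply: sumr_ge0 => j _; exact: jp_ge0.
Qed.

End Gain.

(** Changing the parameter costs the single diagonal term [(lam - mu) u_l], present once [l] belongs
    to the finite set; hence the enlargement by [l]. *)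
Lemma column_eq_shift (p : Zn -> T) (lam mu : C) u f :
  column_eq (fun k => p k - lam *: monom k) u f ->
  column_eq (fun k => p k - mu *: monom k) u (fun l => f l + (lam - mu) * u l).
Proof.
move=> h l e e0; have [A _ hA] := h l e e0.
exists (l |` A)%fset => //= F lAF; have := hA F (fsubset_trans (fsubsetU1 _ _) lAF).
have lF : l \in F by apply: (fsubsetP lAF); rewrite fset1U1.
rewrite (_ : f l + _ - _ = f l - \sum_(k <- F) u k * coef (p k - lam *: monom k) l) //.
rewrite -addrA; congr (_ + _).
have -> : \sum_(k <- F) u k * coef (p k - mu *: monom k) l =
   \sum_(k <- F) u k * coef (p k - lam *: monom k) l +
   \sum_(k <- F) (if k == l then (lam - mu) * u l else 0).
  rewrite -big_split /=; apply: eq_bigr => k _; rewrite !coefB !coefZ coef_monom eq_sym.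
  case: eqP => [->|_]; last by rewrite !mulr0 !subr0 addr0.
  by rewrite !mulr1; ring.
rewrite [X in _ - (_ + X)](big_fsetD1 l) //= eqxx [X in _ + (_ + X)]big_seq.
rewrite [X in _ + (_ + X)]big1; last by move=> k; rewrite !inE => /andP[/negbTE ->].
by rewrite addr0 opprD addrCA subrr addr0.
Qed.

End Regularity.

Lemma nrm_sqr_le (R : realType) (x c : R[i]) (A J : R) : nrm c <= A * J ->
  nrm (x * c) ^+ 2 <= A ^+ 2 * (J ^+ 2 * nrm x ^+ 2).
Proof.
move=> h; rewrite nrm_mul exprMn [leLHS]mulrC [leRHS]mulrA ler_wpM2r ?sqr_ge0 //.
by rewrite -exprMn ler_pXn2r ?nnegrE ?(le_trans (nrm_ge0 c) h) ?nrm_ge0.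
Qed.

(** * Fourier coefficients in the Hilbert space *)

Section HilbertSpace.
Variables (R : realType) (n : nat) (theta : 'M[R]_n) (T : ncTorus theta).
Local Notation C := R[i].
Local Notation Zn := 'rV[int]_n.
Local Notation monom := (monomial (@gen _ _ _ T)).
Implicit Types (k l m : Zn) (u v : T) (x y z : L2 T).

Lemma ipD x y z : ip (x + y) z = ip x z + ip y z.
Proof. by rewrite -[x]scale1r ip_linear mul1r scale1r. Qed.

Lemma ip0 z : ip 0 z = 0 :> C.
Proof. by apply: (@addrI _ (ip 0 z)); rewrite -ipD !addr0. Qed.

Lemma ipZ (c : C) x z : ip (c *: x) z = c * ip x z.
Proof. by rewrite -[c *: x]addr0 ip_linear ip0 addr0. Qed.

Lemma ipN x z : ip (- x) z = - ip x z.
Proof. by rewrite -scaleN1r ipZ mulN1r. Qed.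

Lemma nrm_ip x : ip x x = (nrm x ^+ 2)%:C.
Proof. by rewrite ip_norm nrmE rmorphXn. Qed.

Lemma coefL2_emb u k : coefL2 (emb T u) k = coef u k.
Proof. exact: emb_ip. Qed.

Lemma coefL2D x y k : coefL2 (x + y) k = coefL2 x k + coefL2 y k.
Proof. exact: ipD. Qed.

Lemma coefL2Z (c : C) x k : coefL2 (c *: x) k = c * coefL2 x k.
Proof. exact: ipZ. Qed.

Lemma coefL2B x y k : coefL2 (x - y) k = coefL2 x k - coefL2 y k.
Proof. by rewrite coefL2D; congr (_ + _); exact: ipN. Qed.

Lemma coefL2_sum (I : Type) (s : seq I) (f : I -> L2 T) k :
  coefL2 (\sum_(i <- s) f i) k = \sum_(i <- s) coefL2 (f i) k.
Proof.
apply: (big_morph (fun x => coefL2 x k)) => [x y|]; [exact: coefL2D|exact: ip0].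
Qed.

(** Cauchy-Schwarz against the unit vector [e]: the residue [y] is orthogonal to [e], so [(y|x)]
    equals [(y|y)] and is nonnegative. *)
Lemma coefL2_bound x k : nrm (coefL2 x k) <= nrm x.
Proof.
pose e := emb T (monom k); pose c := coefL2 x k.
have ee : ip e e = 1 by rewrite /e emb_ip (monom_unitary T k).2 tau1.
pose y := x - c *: e.
have ye : ip y e = 0 by rewrite ipD ipN ipZ ee mulr1 subrr.
have yx : ip y x = ip x x - c * c^*.
  by rewrite ipD ipN ipZ; congr (_ - _ * _); rewrite ip_conj.
have yy : ip y y = (ip y x)^*.
  rewrite {1}/y ipD ipN ipZ [ip e y]ip_conj ye conjc0 mulr0 subr0.
  by rewrite ip_conj.
have cc : c * c^* = (nrm c ^+ 2)%:C by rewrite rmorphXn /= -nrmE sqr_normc.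
move: yy; rewrite yx cc !nrm_ip -rmorphB conjc_real => /(@complexI R) h.
rewrite -(ler_pXn2r (ltn0Sn 1)) ?nnegrE ?nrm_ge0 // -subr_ge0 -h sqr_ge0 //.
Qed.

Lemma nrm_star u : nrm (star u) = nrm u.
Proof.
have le (v : T) : nrm v <= nrm (star v).
  have [v0|v0] := eqVneq (nrm v) 0; first by rewrite v0 nrm_ge0.
  have vp : 0 < nrm v by rewrite lt_def v0 nrm_ge0.
  rewrite -(ler_pM2r vp) -expr2 -nrm_star_mul; exact: nrmM.
by apply/le_anti; rewrite le -{2}(starK u) le.
Qed.

Lemma nrm_emb u : nrm (emb T u) ^+ 2 = nrm (tau T (u * star u)).
Proof. by rewrite -emb_ip nrm_ip nrm_real ger0_norm // sqr_ge0. Qed.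

Lemma emb_bound : exists2 K, 0 <= K & forall u, nrm (emb T u) <= K * nrm u.
Proof.
have [K K0 hK] := tau_bound T; exists (K + 1); first by rewrite addr_ge0.
move=> u; rewrite -(ler_pXn2r (ltn0Sn 1)) ?nnegrE ?mulr_ge0 ?addr_ge0 ?nrm_ge0 //.
rewrite nrm_emb (le_trans (hK _)) // exprMn.
apply: (@le_trans _ _ (K * (nrm u * nrm u))).
  by rewrite ler_wpM2l // (le_trans (nrmM _ _)) // nrm_star.
by rewrite -expr2 ler_wpM2r ?sqr_ge0 //; nra.
Qed.

Lemma nrm_emb_mull u m : nrm (emb T (monom m * u)) = nrm (emb T u).
Proof.
apply/eqP; rewrite -(@eqrXn2 _ 2) ?nrm_ge0 // !nrm_emb starM.
rewrite -mulrA tau_tracial -!mulrA (monom_unitary T m).1 mulr1 //.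
Qed.

Lemma pythagoras (c : Zn -> C) (F : {fset Zn}) :
  nrm (emb T (\sum_(k <- F) c k *: monom k)) ^+ 2 = \sum_(k <- F) nrm (c k) ^+ 2.
Proof.
rewrite nrm_emb; set v := \sum_(k <- F) _.
have -> : star v = \sum_(k <- F) (c k)^* *: star (monom k).
  rewrite (big_morph (@star R T) (@starD R T) (star0 T)).
  by apply: eq_bigr => k _; rewrite starZ.
rewrite mulr_sumr raddf_sum /=.
have -> : \sum_(k <- F) tau T (v * ((c k)^* *: star (monom k))) =
  (\sum_(k <- F) nrm (c k) ^+ 2)%:C.
  rewrite rmorph_sum /= big_seq [RHS]big_seq; apply: eq_bigr => k kF.
  rewrite -scalerAr tauZ -[tau T _]/(coef v k).
  have -> : coef v k = c k.
    have := coef_fourier T c F k; rewrite /fourier_sums psumE kF; apply.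
  by rewrite mulrC rmorphXn /= -nrmE sqr_normc.
by rewrite nrm_real ger0_norm // sumr_ge0 // => k _; exact: sqr_ge0.
Qed.

End HilbertSpace.

(** * The operator on smooth elements and on Sobolev vectors *)

Section Operator.
Variables (R : realType) (n : nat) (theta : 'M[R]_n) (T : ncTorus theta).
Local Notation C := R[i].
Local Notation Zn := 'rV[int]_n.
Local Notation monom := (monomial (@gen _ _ _ T)).
Implicit Types (k l m : Zn) (u v : T) (x y z : L2 T) (s t e : R).
Variables (w : R) (a : Zn -> T) (P : T -> T).
Hypothesis w_gt0 : 0 < w.
Hypothesis a_Cinf : forall k, Cinf (a k).
Hypothesis a_bound : forall s, exists2 A, 0 <= A & forall k, sn s (a k) <= A * jp w k.
Hypothesis PE : forall u, Cinf u ->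
  P u = summability.sum (fun k => coef u k *: (a k * monom k)).

Let p k := a k * monom k.

Lemma p_Cinf k : Cinf (p k). Proof. exact: Cinf_mulr. Qed.

Lemma p_bound s : exists2 A, 0 <= A & forall k, sn s (p k) <= A * jp (s + w) k.
Proof.
have [A A0 hA] := a_bound `|s|; exists A => // k.
apply: le_trans (sn_mulr k (lexx _) (Cinf_wfin (a_Cinf k))) _.
by rewrite jpA mulrCA ler_wpM2l ?jp_ge0.
Qed.

Lemma P_series u : Cinf u ->
  [/\ partial_sum (fun k => coef u k *: p k) @ totally --> P u, Cinf (P u) &
      forall s A, 0 <= A -> (forall k, sn s (p k) <= A * jp (s + w) k) ->
        sn s (P u) <= A * sn (s + w) u].
Proof.
move=> hu; have wu := Cinf_wfin hu.
have hs s A : 0 <= A -> (forall k, sn s (p k) <= A * jp (s + w) k) ->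
    (\esum_(k in setT) wn s (coef (coef u k *: p k)%R) <= (A * sn (s + w) u)%:E)%E.
  move=> A0 hA; rewrite EFinM -snE // /wn -esumTZ //; last first.
    by move=> k; rewrite lee_fin mulr_ge0 ?jp_ge0 ?nrm_ge0.
  apply: le_esumT => k; rewrite -/(wn s _).
  rewrite (_ : coef _ = fun l => coef u k * coef (p k) l); last first.
    by apply/funext => l; rewrite coefZ.
  rewrite wnZ snE; last exact/Cinf_wfin/p_Cinf.
  by rewrite -!EFinM lee_fin mulrC mulrA ler_wpM2r ?nrm_ge0.
have [v hv cv] : exists2 v, partial_sum (fun k => coef u k *: p k) @ totally --> v & Cinf v.
  apply: Cinf_series => [k|s]; first by apply/CinfZ/p_Cinf.
  have [A A0 hA] := p_bound s.
  exact: le_lt_trans (hs s A A0 hA) (ltry _).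
have Pv : P u = v by rewrite PE // (psum_sum hv).
rewrite Pv; split=> // s A A0 hA; apply: sn_le.
exact: le_trans (wn_series_id s hv) (hs s A A0 hA).
Qed.

Lemma P_Cinf u : Cinf u -> Cinf (P u). Proof. by case/P_series. Qed.

Lemma P_bound s : exists2 A, 0 <= A & forall u, Cinf u -> sn s (P u) <= A * sn (s + w) u.
Proof.
have [A A0 hA] := p_bound s; exists A => // u hu.
by have [_ _] := P_series hu; apply.
Qed.

Lemma P_lin (c : C) u v : Cinf u -> Cinf v -> P (c *: u + v) = c *: P u + P v.
Proof.
move=> hu hv; have [h1 _ _] := P_series hu; have [h2 _ _] := P_series hv.
have [h3 _ _] := P_series (Cinf_lin c hu hv).
apply: psum_uniq h3 _; have := psum_lincomb (c := c) h1 h2.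
rewrite (_ : (fun i => _) = (fun k => coef (c *: u + v) k *: p k)) //.
by apply/funext => k; rewrite coefD coefZ scalerDl scalerA.
Qed.

Lemma P_monom k : P (monom k) = p k.
Proof.
have [h _ _] := P_series (Cinf_monom T k); apply: psum_uniq h _.
have FT := @totally_filter Zn.
apply/cvg_nrmP => e e0; exists [fset k]%fset => //= A /=; rewrite fsub1set => kA.
rewrite psumE (big_fsetD1 k) //= coef_monom eqxx scale1r.
rewrite big_seq big1 ?addr0 ?subrr ?nrm0 // => l; rewrite !inE => /andP[kl _].
by rewrite coef_monom (negbTE kl) scale0r.
Qed.

Lemma column_eq_Cinf (lam : C) u : Cinf u ->
  column_eq (fun k => p k - lam *: monom k) (coef u) (coef (P u - lam *: u)).
Proof.
move=> hu; have [h _ _] := P_series hu; have FT := @totally_filter Zn.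
have hf : partial_sum (fun k => coef u k *: (p k - lam *: monom k)) @ totally --> P u - lam *: u.
  have := psum_lincomb (c := - lam) (Cinf_fsum hu) h; rewrite scaleNr addrC.
  rewrite (_ : (fun i => _) = (fun k => coef u k *: (p k - lam *: monom k))) //.
  by apply/funext => k; rewrite scalerBr !scalerA mulNr scaleNr addrC mulrC.
have [B B0 hB] := coef_bound T.
move=> l e e0; have B1 : 0 < B + 1 by rewrite ltr_wpDl.
move/cvg_nrmP: hf => /(_ (e / (B + 1)) (divr_gt0 e0 B1)).
apply: filterS => F; rewrite psumE ltr_pdivlMr // => h1.
rewrite (_ : _ - _ = coef (P u - lam *: u - \sum_(k <- F) coef u k *: (p k - lam *: monom k)) l).
  apply: le_lt_trans (hB _ _) _; apply: le_lt_trans h1.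
  by rewrite mulrC ler_wpM2l ?nrm_ge0 // lerDl.
by rewrite [RHS]coefB coef_sum; congr (_ - _); apply: eq_bigr => k _; rewrite coefZ.
Qed.

Lemma emb_P u : Cinf u -> opL2 P (emb T u) = emb T (P u).
Proof.
move=> hu; have [h _ _] := P_series hu; have [K K0 hK] := emb_bound T.
apply: psum_sum; have := psum_lin (phi := emb T) (K := K) (raddfD _) (raddf0 _) hK h.
rewrite (_ : (fun i => _) = (fun k => coefL2 (emb T u) k *: emb T (P (monom k)))) //.
by apply/funext => k; rewrite linearZ /= P_monom coefL2_emb.
Qed.

Lemma sobolev_jp x : sobolev w x ->
  (\esum_(k in setT) (jp (2 * w) k * nrm (coefL2 x k) ^+ 2)%:E < +oo)%E.
Proof.
move=> hx; apply: (@le_lt_trans _ _ ((2 `^ w)%:E * \esum_(k in setT)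
   ((1 + enorm (lattice R k) ^+ 2) `^ w * nrm (coefL2 x k) ^+ 2)%:E)%E); last first.
  by rewrite lte_mul_pinfty ?lee_fin ?powR_ge0.
rewrite -esumTZ ?powR_ge0 //; last by move=> k; rewrite lee_fin mulr_ge0 ?powR_ge0 ?sqr_ge0.
apply: le_esumT => k; rewrite -EFinM lee_fin [leRHS]mulrA ler_wpM2r ?sqr_ge0 //.
have w0 := wt_gt0 R k.
have e0 : 0 <= 1 + enorm (lattice R k) ^+ 2 by rewrite addr_ge0 ?sqr_ge0.
rewrite -powRM // /jp powRrM powR_mulrn ?(ltW w0) //.
apply: ge0_ler_powR; rewrite ?nnegrE ?(ltW w_gt0) ?sqr_ge0 ?mulr_ge0 //.
rewrite /wt; have := sup_le_enorm (lattice R k).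
move: (`|lattice R k|) (normr_ge0 (lattice R k)) (enorm _) => X X0 E h.
have hXE : X ^+ 2 <= E ^+ 2 by apply: lerXn2r; rewrite ?nnegrE // (le_trans X0).
by have := sqr_ge0 (1 - X); nra.
Qed.

(** For a Sobolev vector this series need not converge absolutely. Each [a k] is expanded in
    monomials; for fixed [m] the terms [monom m * monom k] are orthogonal in [k], so Pythagoras and
    the Sobolev sum bound their contribution by [d] times a weight summable in [m]. *)
Lemma opL2_cvg x : sobolev w x ->
  partial_sum (fun k => coefL2 x k *: emb T (p k)) @ totally --> opL2 P x.
Proof.
move=> /sobolev_jp hx.
have -> : opL2 P x = summability.sum (fun k => coefL2 x k *: emb T (p k)).
  by rewrite /opL2; congr summability.sum; apply/funext => k; rewrite P_monom.
have [A A0 hA] := a_bound (2 * n%:R).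
have [K K0 hK] := emb_bound T.
pose Z : \bar R := \esum_(k in [set: Zn]) (jp (- (2 * n%:R)) k)%:E.
have Zp : (0 <= Z)%E by apply: esumT_ge0 => k; rewrite lee_fin jp_ge0.
have Zf : Z \is a fin_num by rewrite ge0_fin_numE ?esum_jp_fin.
have Z0 : 0 <= fine Z by rewrite fine_ge0.
apply: psum_cauchy => e e0.
pose d := e / (A * fine Z + 1).
have AZ : 0 < A * fine Z + 1 by rewrite ltr_wpDl // mulr_ge0.
have d0 : 0 < d by rewrite divr_gt0.
have [|F0 hF0] := esumT_tail _ hx (exprn_gt0 2 d0).
  by move=> k; rewrite lee_fin mulr_ge0 ?jp_ge0 ?sqr_ge0.
exists F0 => F FF0.
have SF : \sum_(k <- F) jp (2 * w) k * nrm (coefL2 x k) ^+ 2 <= d ^+ 2.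
  rewrite -lee_fin; apply: le_trans hF0; apply: le_trans (esum_fset_le _ F).
  rewrite -sumEFin big_seq [leRHS]big_seq; apply: lee_sum => k kF.
  by rewrite (negbTE (FF0 _ kF)).
pose v m := \sum_(k <- F) (coefL2 x k * coef (a k) m) *: monom k.
have hv : partial_sum (fun m => monom m * v m) @ totally --> \sum_(k <- F) coefL2 x k *: p k.
  have hk k : partial_sum (fun m => coefL2 x k *: ((coef (a k) m *: monom m) * monom k)) @ totally
     --> coefL2 x k *: p k.
    have h1 : partial_sum (fun m => (coef (a k) m *: monom m) * monom k) @ totally --> p k.
      apply: (@psum_lin _ _ _ _ _ _ (fun y : T => y * monom k) 1) (Cinf_fsum (a_Cinf k)) => [y z||y].
      - by rewrite mulrDl.
      - by rewrite mul0r.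
      - by rewrite mul1r nrm_unitary_mulr //; exact: monom_unitary.
    have := psum_lincomb (c := coefL2 x k) h1 (@psum_zero R T Zn); rewrite addr0.
    rewrite (_ : (fun i => _ + 0) =
      (fun m => coefL2 x k *: ((coef (a k) m *: monom m) * monom k))) //.
    by apply/funext => m; rewrite addr0.
  have := psum_bigsum (s := enum_fset F) hk.
  rewrite (_ : (fun i => \sum_(k <- F) _) = (fun m => monom m * v m)) //.
  apply/funext => m; rewrite /v mulr_sumr; apply: eq_bigr => k _.
  by rewrite -scalerAl -scalerAr scalerA.
have := psum_phi_le (phi := emb T) (K := K) (raddfD _) (raddf0 _) hK hv.
rewrite raddf_sum /=; under [X in nrm X]eq_bigr do rewrite linearZ /=.
move=> h; rewrite -lee_fin; apply: le_trans h _.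
apply: (@le_trans _ _ ((A * d)%:E * Z)%E); last first.
  rewrite -(fineK Zf) -EFinM lee_fin /d mulrAC mulrA ler_pdivrMr // mulrC ler_wpM2l ?(ltW e0) //.
  by rewrite lerDl.
have AD0 : 0 <= A * d := mulr_ge0 A0 (ltW d0).
rewrite /Z -(esumTZ AD0); last by move=> m; rewrite lee_fin jp_ge0.
apply: le_esumT => m; rewrite -EFinM lee_fin nrm_emb_mull.
have ADj := mulr_ge0 AD0 (jp_ge0 (- (2 * n%:R)) m).
rewrite -(ler_pXn2r (ltn0Sn 1)) ?nnegrE ?nrm_ge0 //.
rewrite /v pythagoras.
apply: (@le_trans _ _ (\sum_(k <- F) (A * jp (- (2 * n%:R)) m) ^+ 2 *
   (jp (2 * w) k * nrm (coefL2 x k) ^+ 2))); last first.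
  rewrite -mulr_sumr [leRHS](_ : _ = (A * jp (- (2 * n%:R)) m) ^+ 2 * d ^+ 2).
    by rewrite ler_wpM2l ?sqr_ge0.
  by rewrite -exprMn mulrAC.
apply: ler_sum => k _.
have -> : jp (2 * w) k = jp w k ^+ 2 by rewrite mulr_natl mulr2n jpA expr2.
apply: nrm_sqr_le; have := le_trans (sn_coord (2 * n%:R) m (Cinf_wfin (a_Cinf k))) (hA k).
rewrite [jp (- _) m]jpN mulrAC ler_pdivlMr; last exact: jp_gt0.
by rewrite mulrC.
Qed.

Lemma column_eq_L2 (lam : C) x f : sobolev w x -> opL2 P x - lam *: x = f ->
  column_eq (fun k => p k - lam *: monom k) (coefL2 x) (coefL2 f).
Proof.
move=> hx E l e e0; have := opL2_cvg hx; have FT := @totally_filter Zn.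
move=> /cvg_nrmP/(_ e e0)[A _ hA]; exists (l |` A)%fset => //= F lAF.
have := hA F (fsubset_trans (fsubsetU1 _ _) lAF); apply: le_lt_trans.
have lF : l \in F by apply: (fsubsetP lAF); rewrite fset1U1.
apply: le_trans (coefL2_bound _ l); rewrite psumE -E !coefL2B coefL2Z coefL2_sum.
rewrite le_eqVlt; apply/orP; left; apply/eqP; congr nrm.
have -> : \sum_(k <- F) coefL2 x k * coef (p k - lam *: monom k) l =
   \sum_(k <- F) coefL2 (coefL2 x k *: emb T (p k)) l -
   \sum_(k <- F) (if k == l then lam * coefL2 x l else 0).
  rewrite -sumrB; apply: eq_bigr => k _; rewrite coefL2Z coefL2_emb coefB coefZ coef_monom.
  rewrite mulrBr eq_sym; case: eqP => [->|_]; last by rewrite !mulr0.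
  by rewrite mulr1 (mulrC lam).
rewrite [X in _ - (_ - X)](big_fsetD1 l) //= eqxx [X in _ - (_ - (_ + X))]big_seq.
rewrite [X in _ - (_ - (_ + X))]big1; last by move=> k; rewrite !inE => /andP[/negbTE ->].
by rewrite addr0 opprB addrA subrK.
Qed.

End Operator.

Lemma max_lip (R : realType) (r x y : R) : `|Num.max r x - Num.max r y| <= `|x - y|.
Proof.
have h1 := ler_norm (x - y); have h2 := ler_norm (y - x); rewrite distrC in h2.
have h3 := normr_ge0 (x - y); move: (`|x - y|) h1 h2 h3 => Z h1 h2 h3.
by rewrite ler_norml; case: (leP r x) => h4; case: (leP r y) => h5; apply/andP; split; lra.
Qed.

(** * Uniform estimates for the resolvent *)

Section Resolvent.
Variables (R : realType) (n : nat) (theta : 'M[R]_n) (T : ncTorus theta).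
Local Notation C := R[i].
Local Notation Zn := 'rV[int]_n.
Local Notation monom := (monomial (@gen _ _ _ T)).
Local Notation lat := (lattice R).
Implicit Types (k l m : Zn) (s t e x : R) (xi eta : 'rV[R]_n) (lam mu : C).
Variables (sigma : 'rV[R]_n -> T) (w phi : R).
Hypothesis w_gt0 : 0 < w.
Hypothesis sigma_Cinf : forall xi, xi != 0 -> Cinf (sigma xi).
Hypothesis sigma_cont : forall xi, xi != 0 -> forall s e, 0 < e ->
  \forall eta \near xi, sn s (sigma eta - sigma xi) <= e.
Hypothesis sigma_hom : forall t xi, 0 < t -> xi != 0 ->
  sigma (t *: xi) = (t `^ w)%:C *: sigma xi.
Hypothesis sigma_inv : forall xi, xi != 0 -> forall t, 0 <= t ->
  exists b, inv_at sigma phi xi t b.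
Variable a : Zn -> T.
Hypothesis a_Cinf : forall k, Cinf (a k).
Hypothesis a_sigma : forall s, exists2 K, 0 <= K &
  forall k, k != 0 -> sn s (a k - sigma (lat k)) <= K * jp (w - 1) k.
Variable P : T -> T.
Hypothesis PE : forall u, Cinf u ->
  P u = summability.sum (fun k => coef u k *: (a k * monom k)).

(** The starting regularity: coefficients of a vector of [L2] are bounded by its norm, so they have
    finite norm for the weight [- 2 n]. *)
Let s0 : R := 2 * n%:R.
Let d lam k : T := a k * monom k - lam *: monom k.
Let a_bd := a_bound w_gt0 sigma_Cinf sigma_cont sigma_hom a_Cinf a_sigma.

Lemma psum_single (V : normedModType C) k (y : V) :
  partial_sum (fun l : Zn => if l == k then y else 0) @ totally --> y.
Proof.
have FT := @totally_filter Zn; apply/cvg_nrmP => e e0.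
exists [fset k]%fset => //= A /=; rewrite fsub1set => kA.
rewrite psumE (big_fsetD1 k) //= eqxx big_seq big1 ?addr0 ?subrr ?nrm0 //.
by move=> l; rewrite !inE => /andP[/negbTE ->].
Qed.

(** [parametrix] with remainder [1/2]. Its term [polar t phi *: (q k * monom k)] is cancelled by the
    diagonal part of the column [d lam k], and dropping [t] from [1 / (jp w k + t)] leaves a gain of
    [w] orders uniform in [t]. *)
Lemma uniform_gain N : s0 <= N -> exists L K, [/\ 1 <= L, 0 <= K & forall t, L <= t ->
  forall (u g : Zn -> C), (wn (- s0) u < +oo)%E -> column_eq (d (polar t phi)) u g ->
  forall x, - s0 <= x -> x + w <= N -> (wn (x + w) u <= (2 * K)%:E * wn x g)%E].
Proof.
move=> s0N; have s00 : 0 <= s0 by rewrite mulr_ge0.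
have N0 : 0 <= N by exact: le_trans s0N.
have h2 : 0 < 2^-1 :> R by rewrite invr_gt0.
have [L [K [L1 K0 h]]] := parametrix w_gt0 sigma_Cinf sigma_cont sigma_hom sigma_inv
  a_Cinf a_sigma N0 h2.
exists L, K; split=> // t Lt u g uf ug x sx xN.
have [q [r [_ hq hd hr]]] := h t Lt; set lam := polar t phi in ug hd.
have t0 : 0 < t by apply: lt_le_trans Lt; exact: lt_le_trans L1.
have [A A0 hA] := p_bound a_Cinf a_bd (- s0 - w).
apply: (@gain _ _ _ _ (d lam) q r s0 w (A + nrm lam) K N) => //.
- by rewrite addr_ge0 ?nrm_ge0.
- move=> k; have h1 : partial_sum (fun l => if l == k then lam *: (q k * monom k) else 0)
      @ totally --> lam *: (q k * monom k) by exact: psum_single.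
  have := psum_lincomb (c := -1) h1 (hd k); rewrite scaleN1r -addrA addKr.
  rewrite (_ : (fun i => _) = (fun l => coef (d lam k) l *: (q l * monom l))) //.
  apply/funext => l; rewrite /d coefB coefZ coef_monom scalerBl addrC scaleN1r.
  by case: eqP => [->|_]; rewrite ?mulr1 ?mulr0 ?scale0r.
- move=> k; have cm := CinfZ lam (Cinf_monom T k).
  have cp := Cinf_mulr k (a_Cinf k).
  rewrite snE; last exact: Cinf_wfin (CinfB cp cm).
  rewrite lee_fin mulrDl; apply: le_trans (snB _ (Cinf_wfin cp) (Cinf_wfin cm)) _.
  apply: lerD; first by apply: le_trans (hA k) _; rewrite subrK.
  rewrite snZ; last exact: Cinf_wfin (Cinf_monom T k).
  rewrite ler_wpM2l ?nrm_ge0 // (le_trans (sn_monom _ _ _)) // jp_le //.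
  by rewrite gerDl oppr_le0 ltW.
- move=> y l yN; apply: le_trans (hq y l yN) _; rewrite lee_fin ler_wpM2l //.
  rewrite jpA jpN ler_wpM2l ?jp_ge0 // lef_pV2 ?posrE ?jp_gt0 //.
    by rewrite lerDl ltW.
  by rewrite addr_gt0 ?jp_gt0.
Qed.

Lemma apriori_large s : 0 <= s -> exists L K, [/\ 1 <= L, 0 <= K & forall t, L <= t ->
  forall (u f : Zn -> C), (wn (- s0) u < +oo)%E -> column_eq (d (polar t phi)) u f ->
  (wn s u <= K%:E * wn s f)%E].
Proof.
move=> s_ge0; have s00 : 0 <= s0 by rewrite mulr_ge0.
have [|L [K [L1 K0 h]]] := @uniform_gain (s0 + (s + w)).
  by rewrite lerDl addr_ge0 // ltW.
exists L, (2 * K); split=> //; first exact: mulr_ge0.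
move=> t Lt u f uf ug; apply: le_trans (le_wn u (_ : s <= s + w)) _.
  by rewrite lerDl ltW.
apply: (h t Lt u f uf ug s); last by rewrite lerDr.
by rewrite (le_trans _ s_ge0) // oppr_le0.
Qed.

(** Far on the ray the remainder is small, but not at a bounded [lam]. The equation is therefore
    shifted to the fixed point [lam1], which puts a multiple of [u] on the right; each turn gains
    [w] orders on [u], and [m] turns lead from [- s0] to [s]. *)
Lemma apriori_bounded s B : 0 <= B -> exists M K, 0 <= K /\
  forall lam (u f : Zn -> C), nrm lam <= B -> (wn (- s0) u < +oo)%E ->
  column_eq (d lam) u f -> (wn s u <= K%:E * (wn M f + wn (- s0) u))%E.
Proof.
move=> B0; have s00 : 0 <= s0 by rewrite mulr_ge0.
have [m hm] : exists m : nat, s <= - s0 + m%:R * w.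
  exists (Num.truncn `|(s + s0) / w|).+1; rewrite addrC -lerBlDr opprK -ler_pdivrMr //.
  by rewrite (le_trans (ler_norm _)) // ltW // truncnS_gt.
pose M := - s0 + m%:R * w.
have [|L [K [L1 K0 h]]] := @uniform_gain (s0 + m%:R * w).
  by rewrite lerDl mulr_ge0 // ltW.
have hL := h L (lexx L); set lam1 := polar L phi in hL.
have B1 : 0 <= B + L by rewrite addr_ge0 // (le_trans _ L1).
have step i : (i <= m)%N -> exists2 Ki, 0 <= Ki & forall lam (u f : Zn -> C),
    nrm lam <= B -> (wn (- s0) u < +oo)%E ->
    column_eq (d lam) u f -> (wn (- s0 + i%:R * w) u <= Ki%:E * (wn M f + wn (- s0) u))%E.
  elim: i => [|i IH] im.
    exists 1 => // lam u f _ _ _; rewrite mul0r addr0 mul1e leeDr ?wn_ge0 //.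
  have [Ki Ki0 hi] := IH (ltnW im).
  exists (2 * K * (1 + (B + L) * Ki)).
    by rewrite !mulr_ge0 // addr_ge0 // mulr_ge0.
  move=> lam u f lamB uf uf_eq.
  have ug := column_eq_shift lam1 uf_eq.
  have := hL u _ uf ug (- s0 + i%:R * w) _ _.
  rewrite -addrA -[i%:R * w + w](_ : i.+1%:R * w = _); last first.
    by rewrite -natr1 mulrDl mul1r.
  move=> h1; apply: le_trans (h1 _ _) _.
  - by rewrite lerDl mulr_ge0 // ltW.
  - by rewrite lerD ?ler_wpM2r ?ler_nat ?(ltW w_gt0) // ge0_cp.
  rewrite [(2 * K * _)%:E]EFinM -muleA lee_wpmul2l ?lee_fin ?mulr_ge0 //.
  apply: le_trans (wnD _ _ _) _; rewrite EFinD ge0_muleDl ?mule_ge0 ?lee_fin ?mulr_ge0 //.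
  rewrite mul1e; apply: leeD.
    apply: (@le_trans _ _ (wn M f)); last by rewrite leeDl ?wn_ge0.
    by apply: le_wn; rewrite lerD2l ler_wpM2r ?ler_nat ?(ltW w_gt0) // ltnW.
  rewrite wnZ EFinM -muleA; apply: lee_pmul; rewrite ?lee_fin ?nrm_ge0 ?wn_ge0 //.
    rewrite (le_trans (nrmB _ _)) // lerD // nrm_polar ger0_norm //.
    exact: le_trans L1.
  exact: hi lamB uf uf_eq.
have [Km Km0 hmm] := step m (leqnn m).
exists M, Km; split=> // lam u f lamB uf uf_eq.
by apply: le_trans (le_wn _ hm) (hmm _ _ _ lamB uf uf_eq).
Qed.

Lemma resolventL2P lam : ~ Sp w P lam -> is_resolvent w P lam (resolventL2 w P lam).
Proof.
rewrite /Sp /= => /contrapT; rewrite /resolventL2; set S := [set B | _] => -[B hB].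
exact: (@xgetPex _ (fun=> 0) S (ex_intro _ B hB)).
Qed.

Lemma wn_L2 (x : L2 T) : (wn (- s0) (coefL2 x) <=
  (nrm x)%:E * \esum_(k in [set: Zn]) (jp (- s0) k)%:E)%E.
Proof.
rewrite -esumTZ ?nrm_ge0 //; last by move=> k; rewrite lee_fin jp_ge0.
by apply: le_esumT => k; rewrite -EFinM lee_fin mulrC ler_wpM2r ?jp_ge0 // coefL2_bound.
Qed.

Lemma wn_L2_fin (x : L2 T) : (wn (- s0) (coefL2 x) < +oo)%E.
Proof.
apply: le_lt_trans (wn_L2 x) _; rewrite lte_mul_pinfty ?lee_fin ?nrm_ge0 //.
exact: esum_jp_fin.
Qed.

Lemma emb_inj u v : Cinf u -> Cinf v -> emb T u = emb T v -> u = v.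
Proof.
move=> hu hv h; apply: fsummable_inj; [exact: Cinf_fsum|exact: Cinf_fsum|].
by apply/funext => k; rewrite -!coefL2_emb h.
Qed.

Lemma sobolev_emb u : Cinf u -> sobolev w (emb T u).
Proof.
move=> /CinfP[_ hu]; rewrite /sobolev /=.
pose c : R := n%:R + 1; have c0 : 0 <= c by rewrite addr_ge0.
pose A := (c ^+ 2) `^ w * sn 0 u.
have A0 : 0 <= A by rewrite mulr_ge0 ?powR_ge0 ?sn_ge0.
apply: (@le_lt_trans _ _ (A%:E * wn (2 * w) (coef u))%E); last first.
  by rewrite lte_mul_pinfty ?lee_fin // hu.
rewrite /wn -(esumTZ A0); last by move=> k; rewrite lee_fin mulr_ge0 ?jp_ge0 ?nrm_ge0.
apply: le_esumT => k; rewrite -EFinM lee_fin coefL2_emb.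
have h1 : nrm (coef u k) <= sn 0 u by have := sn_coord 0 k hu; rewrite jp0 mul1r.
have h2 : (1 + enorm (lat k) ^+ 2) `^ w <= (c ^+ 2) `^ w * jp (2 * w) k.
  have wk := ltW (wt_gt0 R k); have e0 : 0 <= enorm (lat k) by exact: sqrtr_ge0.
  rewrite {1}/jp powRrM powR_mulrn // -powRM ?sqr_ge0 //.
  apply: ge0_ler_powR; rewrite ?nnegrE ?(ltW w_gt0) ?addr_ge0 ?sqr_ge0 ?mulr_ge0 ?sqr_ge0 //.
  have h3 : enorm (lat k) <= n%:R * wt R k.
    by apply: le_trans (enorm_le_sup _) _; rewrite ler_wpM2l // /wt lerDr.
  rewrite -exprMn; apply: (@le_trans _ _ ((1 + enorm (lat k)) ^+ 2)).
    by rewrite sqrrD expr1n mul1r lerD2r lerDl mulrn_wge0.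
  apply: lerXn2r; rewrite ?nnegrE ?addr_ge0 ?mulr_ge0 //.
  by rewrite /c mulrDl mul1r addrC lerD ?wt_ge1.
rewrite expr2 mulrA; apply: (@le_trans _ _ ((c ^+ 2) `^ w * jp (2 * w) k * nrm (coef u k) * sn 0 u)).
  apply: ler_pM h1; rewrite ?nrm_ge0 ?mulr_ge0 ?powR_ge0 ?nrm_ge0 //.
  by rewrite ler_wpM2r ?nrm_ge0.
by rewrite /A le_eqVlt; apply/orP; left; apply/eqP; ring.
Qed.

(** The estimates show that the coefficients of [y] decay rapidly, and [v] is the smooth element
    with these coefficients; but [y = emb v] is not immediate, as coefficients are not shown to
    determine a vector of [L2]. Since [opL2 P y] depends only on them, it equals [emb (P v)], and
    the equation, divided by [lam], displays [y] as [emb v']. *)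
Lemma resolvent_spec lam f : lam != 0 -> ~ Sp w P lam -> Cinf f ->
  [/\ Cinf (resolvent w P lam f),
      emb T (resolvent w P lam f) = resolventL2 w P lam (emb T f) &
      P (resolvent w P lam f) - lam *: resolvent w P lam f = f].
Proof.
move=> lam0 hlam hf; have [_ _ h3 _] := resolventL2P hlam.
set y := resolventL2 w P lam (emb T f).
have [hy hyE] := h3 (emb T f); rewrite -/y in hy hyE.
have ceq := column_eq_L2 w_gt0 a_Cinf a_bd PE hy hyE.
have wy : wfin (coefL2 y).
  move=> s; have [M [K [K0 hK]]] := apriori_bounded s (nrm_ge0 lam).
  apply: le_lt_trans (hK lam _ _ (lexx _) (wn_L2_fin y) ceq) _.
  have -> : coefL2 (emb T f) = coef f by apply/funext => k; rewrite coefL2_emb.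
  apply: lte_mul_pinfty; [by rewrite lee_fin|by []|].
  by apply: lte_add_pinfty; [exact: Cinf_wfin|exact: wn_L2_fin].
have [v hv cv] := fourier_cvg T (wy 0).
have Cv : Cinf v by apply/CinfP; rewrite cv; split=> //; exact: fsummable_cvg hv.
have Pv : opL2 P y = emb T (P v).
  rewrite -(emb_P a_Cinf a_bd PE Cv) /opL2; congr summability.sum.
  by apply/funext => k; rewrite coefL2_emb cv.
pose v' := lam^-1 *: (P v - f).
have Cv' : Cinf v' by apply/CinfZ/CinfB => //; exact: P_Cinf Cv.
have ev' : emb T v' = y.
  rewrite linearZ /= raddfB /= -Pv -hyE opprB addrC subrK scalerA mulVf // scale1r //.
have vv' : v' = v.
  apply: fsummable_inj; [exact: Cinf_fsum|exact: Cinf_fsum|].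
  by apply/funext => k; rewrite -coefL2_emb ev' cv.
have hx : Cinf (resolvent w P lam f) /\ emb T (resolvent w P lam f) = y.
  rewrite /resolvent; set S := [set z | _].
  by apply: (@xgetPex _ 0 S); exists v'.
have [c1 c2] := hx; split=> //.
have -> : resolvent w P lam f = v'.
  by apply: emb_inj => //; rewrite c2 ev'.
rewrite {1}vv' /v' scalerA mulfV // scale1r opprB addrC subrK //.
Qed.

Lemma resolvent_left lam g : lam != 0 -> ~ Sp w P lam -> Cinf g ->
  resolvent w P lam (P g - lam *: g) = g.
Proof.
move=> lam0 hlam hg; have [_ _ _ h4] := resolventL2P hlam.
have Cf : Cinf (P g - lam *: g).
  by apply: CinfB; [exact: P_Cinf hg|exact: CinfZ].
have [c1 c2 _] := resolvent_spec lam0 hlam Cf.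
apply: emb_inj => //; rewrite c2 raddfB /= linearZ /= -(emb_P a_Cinf a_bd PE hg).
exact/h4/sobolev_emb.
Qed.

(** Resolvent identity and absorption: for [mu] this close to [lam], the correction is at most half
    of the norm of [B y]. The resolvent at [mu] is assumed to exist, so only its norm is
    estimated. *)
Lemma resolventL2_local lam : ~ Sp w P lam -> exists2 M, 0 < M & forall mu,
  ~ Sp w P mu -> nrm (mu - lam) <= M^-1 -> forall y, nrm (resolventL2 w P mu y) <= M * nrm y.
Proof.
move=> hlam; have [lin [M hM] h3 h4] := resolventL2P hlam.
pose M1 := 2 * (`|M| + 1); have M10 : 0 < M1 by rewrite mulr_gt0 // ltr_wpDl.
exists M1 => // mu hmu hd y; have [lin' _ h3' h4'] := resolventL2P hmu.
set A := resolventL2 w P lam in lin hM h3 h4; set B := resolventL2 w P mu in lin' h3' h4' *.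
have [sB eB] := h3' y.
have A0 : A 0 = 0.
  have := lin 1 0 0; rewrite !scale1r addr0 => h; apply: (@addrI _ (A 0)).
  by rewrite -h addr0.
have E : B y = A y + (mu - lam) *: A (B y).
  rewrite -[LHS](h4 _ sB) -[opL2 P (B y)](subrK (mu *: B y)) eB -addrA -scalerBl.
  by rewrite addrC lin addrC.
have hM' z : nrm (A z) <= (`|M| + 1) * nrm z.
  by rewrite (le_trans (hM z)) // ler_wpM2r ?nrm_ge0 // (le_trans (ler_norm _)) // lerDl.
have : nrm (B y) <= (`|M| + 1) * nrm y + M1^-1 * ((`|M| + 1) * nrm (B y)).
  rewrite {1}E (le_trans (nrmD _ _)) // lerD // nrmZ.
  by rewrite ler_pM ?nrm_ge0.
have -> : M1^-1 * ((`|M| + 1) * nrm (B y)) = nrm (B y) / 2.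
  have Mn : `|M| + 1 != 0 by rewrite gt_eqF // ltr_wpDl.
  by rewrite /M1; field.
rewrite /M1; lra.
Qed.

Lemma resolventL2_compact (gam : R -> C) (L al be : R) :
  (forall x y, nrm (gam x - gam y) <= L * `|x - y|) ->
  (forall x, al <= x <= be -> ~ Sp w P (gam x)) ->
  exists2 M, 0 <= M & forall x, al <= x <= be -> forall y,
    nrm (resolventL2 w P (gam x) y) <= M * nrm y.
Proof.
move=> lip hsp.
have := (compact_near_coveringP _).1 (@segment_compact R al be) R +oo
  (fun M x => ~ Sp w P (gam x) -> forall y, nrm (resolventL2 w P (gam x) y) <= M * nrm y) _.
case.
  move=> x /=; rewrite in_itv /= => hx.
  have [M M0 hM] := resolventL2_local (hsp x hx).
  pose e := (M * (`|L| + 1))^-1.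
  have L1 : 0 < `|L| + 1 by rewrite ltr_wpDl.
  have e0 : 0 < e by rewrite invr_gt0 mulr_gt0.
  exists (ball x e, [set M' | M <= M']) => /=.
    split; first exact: nbhsx_ballx.
    by exists M; split => [|M' /ltW]; rewrite ?num_real.
  move=> [x' M'] /= [h1 h2] hs y.
  apply: le_trans (hM _ hs _ y) _; last by rewrite ler_wpM2r ?nrm_ge0.
  apply: le_trans (lip _ _) _; move: h1; rewrite -ball_normE /= distrC => /ltW h1.
  apply: (@le_trans _ _ ((`|L| + 1) * e)).
    apply: le_trans (_ : (`|L| + 1) * `|x' - x| <= _); last by rewrite ler_wpM2l ?(ltW L1).
    by rewrite ler_wpM2r // (le_trans (ler_norm _)) // lerDl.
  by rewrite /e invfM mulrCA mulfV ?mulr1 // gt_eqF.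
move=> M [_ hM]; exists `|M + 1| => // x hx y.
have hi : `[al, be]%classic x by rewrite /= in_itv.
apply: le_trans (hM (M + 1) _ x hi (hsp x hx) y) _; first by rewrite ltrDl.
by rewrite ler_wpM2r ?nrm_ge0 // ler_norm.
Qed.

(** Compactness bounds the resolvent on [L2], hence its coefficients in the weight [- s0];
    [apriori_bounded] upgrades this to any weight [s]. The maximum with 0 lets [sn] control the
    C*-norm of [f]. *)
Lemma resolvent_compact (gam : R -> C) (L al be s : R) :
  (forall x y, nrm (gam x - gam y) <= L * `|x - y|) ->
  (forall x, al <= x <= be -> ~ Sp w P (gam x)) ->
  (forall x, gam x != 0) ->
  exists s' K, 0 <= K /\ forall x, al <= x <= be -> forall f, Cinf f ->
    sn s (resolvent w P (gam x) f) <= K * sn s' f.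
Proof.
move=> lip hsp gam0; have [M M0 hM] := resolventL2_compact lip hsp.
have [|s' [K [K0 hK]]] := @apriori_bounded s (nrm (gam al) + `|L| * `|be - al|).
  by rewrite addr_ge0 ?nrm_ge0 ?mulr_ge0.
have [E E0 hE] := emb_bound T.
pose Z : \bar R := \esum_(k in [set: Zn]) (jp (- s0) k)%:E.
have Zp : (0 <= Z)%E by apply: esumT_ge0 => k; rewrite lee_fin jp_ge0.
have Zf : Z \is a fin_num by rewrite ge0_fin_numE //; exact: esum_jp_fin.
have Z0 : 0 <= fine Z by rewrite fine_ge0.
exists (Num.max s' 0), (K * (1 + M * E * fine Z)); split.
  by rewrite mulr_ge0 // addr_ge0 // !mulr_ge0.
move=> x hx f hf; have [c1 c2 c3] := resolvent_spec (gam0 x) (hsp x hx) hf.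
set v := resolvent w P (gam x) f in c1 c2 c3 *.
have wf := Cinf_wfin hf.
have ceq := column_eq_Cinf a_Cinf a_bd PE (gam x) c1; rewrite c3 in ceq.
have gB : nrm (gam x) <= nrm (gam al) + `|L| * `|be - al|.
  rewrite -(subrK (gam al) (gam x)) addrC (le_trans (nrmD _ _)) // lerD2l.
  apply: le_trans (lip _ _) _; apply: le_trans (ler_wpM2r (normr_ge0 _) (ler_norm L)) _.
  case/andP: hx => h1 h2; rewrite ler_wpM2l // !ger0_norm ?subr_ge0 ?lerD2r //.
  exact: le_trans h2.
have w1 : (wn (- s0) (coef v) <= (M * E * fine Z * sn 0 f)%:E)%E.
  rewrite (_ : coef v = coefL2 (emb T v)); last by apply/funext => k; rewrite coefL2_emb.
  apply: le_trans (wn_L2 _) _; rewrite -/Z -(fineK Zf) -EFinM lee_fin c2.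
  rewrite [leRHS]mulrAC ler_wpM2r // (le_trans (hM x hx _)) // -mulrA ler_wpM2l //.
  by rewrite (le_trans (hE _)) // ler_wpM2l // nrm_le_sn.
apply: sn_le; apply: le_trans (hK _ _ _ gB _ ceq) _; first exact: Cinf_wfin.
rewrite -mulrA EFinM lee_wpmul2l ?lee_fin // mulrDl mul1r EFinD; apply: leeD.
  by rewrite snE // lee_fin le_sn // le_max lexx.
apply: le_trans w1 _; rewrite lee_fin ler_wpM2l ?mulr_ge0 // le_sn // le_max lexx orbT //.
Qed.

Lemma resolvent_ray (r s : R) : 0 < r -> 0 <= s ->
  (forall t, 0 < t -> ~ Sp w P (polar t phi)) ->
  exists s' K, 0 <= K /\ forall t, r <= t -> forall f, Cinf f ->
    sn s (resolvent w P (polar t phi) f) <= K * sn s' f.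
Proof.
move=> r0 s_ge0 hsp; have [L [K [L1 K0 h]]] := apriori_large s_ge0.
(* Below [r] the curve is extended by a constant, to satisfy the global conditions of
   [resolvent_compact] (Lipschitz, avoiding 0); it covers [[r, L]], and [apriori_large] the rest of
   the ray. *)
have lip (x y : R) : nrm (polar (Num.max r x) phi - polar (Num.max r y) phi) <= 1 * `|x - y|.
  have -> : polar (Num.max r x) phi - polar (Num.max r y) phi =
     (Num.max r x - Num.max r y)%:C * polar 1 phi.
    by rewrite polar_split (polar_split (Num.max r y)) -mulrBl rmorphB.
  rewrite nrm_mul nrm_polar normr1 mulr1 nrm_real mul1r.
  exact: max_lip.
have mx0 x : 0 < Num.max r x by rewrite lt_max r0.
have [x _|x|s' [K' [K'0 h']]] := @resolvent_compact _ 1 r L s lip.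
- exact: hsp.
- exact: polar_neq0.
exists (Num.max s' s), (K + K'); split; first exact: addr_ge0.
move=> t rt f hf; have wf := Cinf_wfin hf; have t0 : 0 < t := lt_le_trans r0 rt.
have [Lt|tL] := leP L t.
  have [c1 c2 c3] := resolvent_spec (polar_neq0 phi t0) (hsp t t0) hf.
  set v := resolvent _ _ _ _ in c1 c2 c3 *.
  have ceq := column_eq_Cinf a_Cinf a_bd PE (polar t phi) c1; rewrite c3 in ceq.
  apply: (@le_trans _ _ (K * sn s f)).
    apply: sn_le; rewrite EFinM -snE //; apply: h Lt _ _ _ ceq.
    exact: Cinf_wfin.
  by rewrite ler_pM ?sn_ge0 ?lerDl // le_sn // le_max lexx orbT.
have := h' t _ f hf; rewrite (max_idPr rt) rt (ltW tL) => /(_ isT) h1.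
by apply: le_trans h1 _; rewrite ler_pM ?sn_ge0 ?lerDr // le_sn // le_max lexx.
Qed.

End Resolvent.

(** * Integrals of operator families *)

Section RealPrimitive.
Variable R : realType.
Local Notation C := R[i].
Implicit Types (x y t a b c e : R).

Lemma real_primitive (g : R -> R) a : continuous g ->
  exists F : R -> R, forall x, a <= x -> is_derive x 1 F (g x).
Proof.
(* Starting the integral at [a - 1] makes [a] an interior point, so the derivative there is
   two-sided. *)
move=> cg; exists (fun x => \int[lebesgue_measure]_(t in `[a - 1, x]) (g t))%R => x ax.
have ax1 : a - 1 < x by rewrite (lt_le_trans _ ax) // gtrBl.
have ig : lebesgue_measure.-integrable `[a - 1, x + 1] (EFin \o g).
  apply: continuous_compact_integrable; first exact: segment_compact.
  by apply: continuous_subspaceT => z; exact: cg.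
have x1 : x < x + 1 by rewrite ltrDl.
have [d1 d2] := continuous_FTC1_closed x1 ig ax1 (cg x).
apply: DeriveDef; first exact: d1.
by rewrite -derive1E; exact: d2.
Qed.

Lemma derive_mean (F g : R -> R) a x y c e :
  (forall z, a <= z -> is_derive z 1 F (g z)) -> a <= x -> x <= y ->
  (forall t, x <= t <= y -> `|g t - c| <= e) ->
  `|F y - F x - (y - x) * c| <= (y - x) * e.
Proof.
move=> dF ax xy h.
have [z||z zxy ->] := @MVT_segment R F g x y xy.
- by rewrite in_itv /= => /andP[/ltW xz _]; apply: dF; exact: le_trans xz.
- apply: derivable_within_continuous => z; rewrite in_itv /= => /andP[xz _].
  by apply: (@ex_derive _ _ _ _ _ _ _ (dF z (le_trans ax xz))).
rewrite mulrC -mulrBr normrM ger0_norm ?subr_ge0 // ler_wpM2l ?subr_ge0 //.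
by apply: h; move: zxy; rewrite in_itv.
Qed.

(* The integral mean inequality characterizes the primitives of a continuous
   function. The factor two comes from real and imaginary parts. *)
Definition mean_primitive (f F : R -> C) a := forall x y (c : C) e, a <= x -> x <= y ->
  (forall t, x <= t <= y -> nrm (f t - c) <= e) ->
  nrm (F y - F x - (y - x)%:C * c) <= 2 * (y - x) * e.

Lemma mean_primitive_derive (f : R -> C) (F1 F2 : R -> R) a :
  (forall z, a <= z -> is_derive z 1 F1 (complex.Re (f z))) ->
  (forall z, a <= z -> is_derive z 1 F2 (complex.Im (f z))) ->
  mean_primitive f (fun x => F1 x +i* F2 x) a.
Proof.
move=> d1 d2 x y c e ax xy h.
have h1 : `|F1 y - F1 x - (y - x) * complex.Re c| <= (y - x) * e.
  apply: derive_mean d1 ax xy _ => t txy; apply: le_trans (h t txy).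
  by rewrite -raddfB nrm_Re.
have h2 : `|F2 y - F2 x - (y - x) * complex.Im c| <= (y - x) * e.
  apply: derive_mean d2 ax xy _ => t txy; apply: le_trans (h t txy).
  by rewrite -raddfB nrm_Im.
apply: le_trans (nrm_le_ReIm _) _; rewrite -mulrA mulr2n mulrDl mul1r.
case: c h h1 h2 => c1 c2 h /= h1 h2; apply: lerD.
  by rewrite !mul0r subr0.
by rewrite !mul0r addr0.
Qed.

Definition loc_lip (f : R -> C) a := forall b, exists2 K, 0 <= K &
  (forall x, a <= x <= b -> nrm (f x) <= K) /\
  (forall x y, a <= x <= b -> a <= y <= b -> nrm (f x - f y) <= K * `|x - y|).

(** Precomposing with [Num.max a] extends a function controlled on [[a, +oo[] to a continuous
    function on the line, as [real_primitive] requires. *)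
Lemma lip_continuous (g : R -> R) a :
  (forall b, exists2 K, 0 <= K &
     forall x y, a <= x <= b -> a <= y <= b -> `|g x - g y| <= K * `|x - y|) ->
  continuous (fun x => g (Num.max a x)).
Proof.
move=> h x; have [K K0 hK] := h (Num.max a x + 1).
apply/cvgrPdist_le => e e0.
have d0 : 0 < Num.min 1 (e / (K + 1)) by rewrite lt_min ltr01 divr_gt0 // ltr_wpDl.
near=> y.
have xy : `|x - y| < Num.min 1 (e / (K + 1)).
  by near: y; exact: cvgr_dist_lt.
have := max_lip a x y => ml.
apply: le_trans (hK _ _ _ _) _.
- by rewrite le_max lexx lerDl ler01.
- rewrite le_max lexx /=.
  move: xy; rewrite lt_min => /andP[xy _].
  have := ler_norm (Num.max a y - Num.max a x); rewrite distrC => h1.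
  by rewrite -lerBlDl (le_trans h1) // (le_trans ml) // ltW.
move: xy; rewrite lt_min => /andP[_ xy].
apply: (@le_trans _ _ (K * (e / (K + 1)))).
  by rewrite ler_wpM2l // (le_trans ml) // ltW.
by rewrite mulrCA ler_piMr ?(ltW e0) // ler_pdivrMr ?mul1r ?lerDl // ltr_wpDl.
Unshelve. all: by end_near.
Qed.

Lemma primitive_exists (f : R -> C) a : loc_lip f a -> exists F, mean_primitive f F a.
Proof.
move=> h.
have c1 : continuous (fun x => complex.Re (f (Num.max a x))).
  apply: (@lip_continuous (fun x => complex.Re (f x))) => b.
  have [K K0 [_ hK]] := h b; exists K => // x y xb yb.
  by rewrite -raddfB (le_trans (nrm_Re _)) // hK.
have c2 : continuous (fun x => complex.Im (f (Num.max a x))).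
  apply: (@lip_continuous (fun x => complex.Im (f x))) => b.
  have [K K0 [_ hK]] := h b; exists K => // x y xb yb.
  by rewrite -raddfB (le_trans (nrm_Im _)) // hK.
have [F1 hF1] := real_primitive a c1; have [F2 hF2] := real_primitive a c2.
exists (fun x => F1 x +i* F2 x); apply: mean_primitive_derive => z az.
  by have := hF1 z az; rewrite (max_idPr az).
by have := hF2 z az; rewrite (max_idPr az).
Qed.

Lemma primitive_bound (f F : R -> C) a x y M : mean_primitive f F a -> a <= x -> x <= y ->
  (forall t, x <= t <= y -> nrm (f t) <= M) -> nrm (F y - F x) <= 2 * (y - x) * M.
Proof.
move=> hF ax xy hM; have := hF x y 0 M ax xy; rewrite mulr0 subr0; apply.
by move=> t txy; rewrite subr0 hM.
Qed.

(* Summing over dyadic intervals. *)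
Lemma primitive_decay (f F : R -> C) a M : mean_primitive f F a -> 0 < a -> 0 <= M ->
  (forall t, a <= t -> nrm (f t) <= M * t `^ (- (3 / 2))) ->
  forall x y, a <= x -> x <= y -> nrm (F y - F x) <= 8 * M * x `^ (- 2^-1).
Proof.
move=> hF a0 M0 hf.
have key m x y : a <= x -> x <= y -> y <= x * 2 ^+ m ->
    nrm (F y - F x) <= 8 * M * x `^ (- 2^-1).
  elim: m x y => [|m IH] x y ax xy.
    rewrite expr0 mulr1 => yx; have -> : y = x by apply/le_anti; rewrite yx xy.
    by rewrite subrr nrm0 !mulr_ge0 ?powR_ge0.
  move=> yx; have x0 : 0 < x := lt_le_trans a0 ax.
  have step z : x <= z -> z <= 2 * x -> nrm (F z - F x) <= 2 * M * x `^ (- 2^-1).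
    move=> xz zx.
    apply: le_trans (primitive_bound (M := M * x `^ (- (3 / 2))) hF ax xz _) _.
      move=> t /andP[xt _]; apply: le_trans (hf t (le_trans ax xt)) _.
      have t0 : 0 < t := lt_le_trans x0 xt.
      rewrite ler_wpM2l // !powRN lef_pV2 ?posrE ?powR_gt0 //.
      by apply: ge0_ler_powR; rewrite ?nnegrE ?divr_ge0 // ltW.
    rewrite -!mulrA ler_wpM2l // mulrCA ler_wpM2l //.
    rewrite (_ : - (3 / 2) = - 2^-1 - 1); last by lra.
    rewrite powRD ?(gt_eqF x0) ?implybT // (_ : x `^ (-1) = x^-1); last first.
      by rewrite powRN powRr1 // ltW.
    rewrite mulrCA ler_piMr ?powR_ge0 // ler_pdivrMr // mul1r; lra.
  have [h|h] := leP y (2 * x).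
    by apply: le_trans (step y xy h) _; rewrite !ler_wpM2r ?powR_ge0 //; lra.
  rewrite -(subrK (F (2 * x)) (F y)) -addrA (le_trans (nrmD _ _)) //.
  have x2x : x <= 2 * x by rewrite ler_peMl ?(ltW x0) // ler1n.
  have h1 := IH (2 * x) y (le_trans ax x2x) (ltW h) _.
  have {h1} := h1 _; rewrite [2 * x * _]mulrAC -exprS mulrC => /(_ yx) h1.
  have h2 := step (2 * x) x2x (lexx _).
  apply: le_trans (lerD h1 h2) _.
  rewrite powRM ?(ltW x0) // mulrA -mulrDl ler_wpM2r ?powR_ge0 //.
  (* The constant [8] closes the induction because [8 * 2 ^ (- 1/2) + 2 <= 8]. *)
  have -> : 8 * M * 2 `^ (- 2^-1) + 2 * M = M * (8 * 2 `^ (- 2^-1) + 2) by ring.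
  rewrite mulrC ler_wpM2r //.
  have p0 : 0 < 2 `^ (- 2^-1) :> R by rewrite powR_gt0.
  have : (2 `^ (- 2^-1)) ^+ 2 = 2^-1 :> R.
    rewrite -powR_mulrn ?powR_ge0 // -powRrM mulNr mulVf // powRN powRr1 //.
  by move: (2 `^ _) p0 => q q0; rewrite expr2 => qq; nra.
move=> x y ax xy; have x0 : 0 < x := lt_le_trans a0 ax.
pose m := (Num.truncn (y / x)).+1.
apply: (key m) => //.
rewrite mulrC -ler_pdivrMr // (le_trans (ltW (truncnS_gt _))) //.
by rewrite -natrX ler_nat ltnW // ltn_expl.
Qed.

End RealPrimitive.

Lemma frac_lt (R : realType) (X e : R) : 0 <= X -> 0 < e -> X * (e / (X + 1)) < e.
Proof.
move=> X0 e0; have X1 : 0 < X + 1 by rewrite ltr_wpDl.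
by rewrite mulrCA gtr_pMr // ltr_pdivrMr // mul1r ltrDl.
Qed.

(** * Convergence of operators through weighted norms *)

Section OperatorTopology.
Variables (R : realType) (n : nat) (theta : 'M[R]_n) (T : ncTorus theta).
Local Notation C := R[i].
Local Notation Zn := 'rV[int]_n.
Implicit Types (k l : Zn) (s e : R) (u v : T) (S L : T -> T).

Lemma delta_lin b (c : C) u v : Cinf u -> Cinf v ->
  delta b (c *: u + v) = c *: delta b u + delta b v.
Proof.
move=> hu hv; have [u1 u2] := deltaP b hu; have [v1 v2] := deltaP b hv.
have [w1 w2] := deltaP b (Cinf_lin c hu hv).
apply: fsummable_inj; [exact: Cinf_fsum|exact/Cinf_fsum/Cinf_lin|].
apply/funext => k; rewrite w2 !coefD !coefZ u2 v2; ring.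
Qed.

Definition sn_dominated S := forall s, exists s' K, 0 <= K /\
  forall u, Cinf u -> sn s (S u) <= K * sn s' u.

Lemma LCinf_dominated S : (forall u, Cinf u -> Cinf (S u)) ->
  (forall (c : C) u v, Cinf u -> Cinf v -> S (c *: u + v) = c *: S u + S v) ->
  sn_dominated S -> LCinf S.
Proof.
move=> h1 h2 h3; split=> // b e e0.
have [s' [K [K0 hK]]] := h3 (msize b)%:R.
have [gs [K' [K'0 hK']]] := sn_le_delta T s'.
have KK : 0 < K * K' + 1 by rewrite ltr_wpDl // mulr_ge0.
exists (\max_(g <- gs) msize g)%N, (e / (K * K' + 1)); split; first exact: divr_gt0.
move=> u hu hg; apply: le_lt_trans (nrm_delta_le b (h1 u hu)) _.
apply: le_lt_trans (hK u hu) _.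
have h4 : sn s' u <= K' * (e / (K * K' + 1)).
  by apply: hK' => // g ggs; apply/ltW/hg; exact: (@leq_bigmax_seq _ _ xpredT (@msize n) g ggs).
apply: le_lt_trans (ler_wpM2l K0 h4) _; by rewrite (mulrA K K') frac_lt // mulr_ge0.
Qed.

Lemma bounded_sn B s : bounded_Cinf B -> exists2 M, 0 <= M &
  forall u : T, B u -> sn s u <= M.
Proof.
move=> [BC hB]; have [gs [K [K0 hK]]] := sn_le_delta T s.
have /boolp.choice [M hM] := hB.
exists (K * \sum_(g <- gs) `|M g|); first by rewrite mulr_ge0 // sumr_ge0.
move=> u Bu; apply: hK; first exact: BC.
move=> g ggs; apply: le_trans (hM g u Bu) _; apply: le_trans (ler_norm _) _.
by rewrite (big_rem g) //= lerDl sumr_ge0.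
Qed.

Lemma sn_dom : exists2 Z, 0 <= Z & forall s u M, 
  (forall k, jp (s + 2 * n%:R) k * nrm (coef u k) <= M) -> sn s u <= M * Z.
Proof.
pose Z : \bar R := \esum_(k in [set: Zn]) (jp (- (2 * n%:R)) k)%:E.
have Zp : (0 <= Z)%E by apply: esumT_ge0 => k; rewrite lee_fin jp_ge0.
have Zf : Z \is a fin_num by rewrite ge0_fin_numE //; exact: esum_jp_fin.
exists (fine Z); first by rewrite fine_ge0.
by move=> s u M h; apply: sn_le; rewrite EFinM fineK //; exact: wn_dom.
Qed.

(** The index [s'] is chosen before [e], which gives uniformity because [sn s'] is bounded on
    bounded sets; summing over [k] costs the weight [2 * n]. *)
Lemma cvg_LCinf_coef (I : Type) (F : set_system I) {FF : Filter F} (S : I -> T -> T) L :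
  (\forall i \near F, LCinf (S i)) -> LCinf L ->
  (forall s, exists s', forall e, 0 < e -> \forall i \near F, forall u, Cinf u ->
     forall k, jp s k * nrm (coef (S i u - L u) k) <= e * sn s' u) ->
  cvg_LCinf F S L.
Proof.
move=> hS hL h; split=> // B hB b e e0.
have [s' hs'] := h ((msize b)%:R + 2 * n%:R).
have [M M0 hM] := bounded_sn s' hB; have [Z Z0 hZ] := sn_dom.
have MZ : 0 < M * Z + 1 by rewrite ltr_wpDl // mulr_ge0.
have := hs' (e / (M * Z + 1)) (divr_gt0 e0 MZ); apply: filterS2 hS => i [Si _ _] hi u Bu.
have Cu : Cinf u by exact: (hB.1).
have [Lu _ _] := hL.
apply: le_lt_trans (nrm_delta_le b (CinfB (Si u Cu) (Lu u Cu))) _.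
apply: le_lt_trans (hZ _ _ _ (hi u Cu)) _.
apply: (@le_lt_trans _ _ (e / (M * Z + 1) * (M * Z))).
  rewrite -(mulrA (e / (M * Z + 1)) (sn s' u) Z).
  exact: (ler_wpM2l (ltW (divr_gt0 e0 MZ)) (ler_wpM2r Z0 (hM u Bu))).
by rewrite mulrC frac_lt // mulr_ge0.
Qed.

Lemma cvg_Cinf_sn (I : Type) (F : set_system I) {FF : Filter F} (f : I -> T) v s e :
  cvg_Cinf F f v -> 0 < e -> \forall i \near F, sn s (f i - v) <= e.
Proof.
move=> [h1 h2 h3] e0; have [gs [K [K0 hK]]] := sn_le_delta T s.
have K1 : 0 < K + 1 by rewrite ltr_wpDl.
have hg : \forall i \near F, forall g, g \in gs -> nrm (delta g (f i - v)) < e / (K + 1).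
  elim: gs {hK} => [|g gs IH]; first by near=> i.
  have hg := h3 g _ (divr_gt0 e0 K1).
  apply: filterS2 IH hg => i i1 i2 g'; rewrite inE => /orP[/eqP ->|]; first exact: i2.
  exact: i1.
apply: filterS2 h1 hg => i ci hi; apply: (@le_trans _ _ (K * (e / (K + 1)))).
  by apply: hK => [|g ggs]; [exact: CinfB|exact/ltW/hi].
exact/ltW/frac_lt.
Unshelve. all: by end_near.
Qed.

Lemma cvg_LCinf_sn (I : Type) (F : set_system I) {FF : Filter F} (S : I -> T -> T) L u s e :
  cvg_LCinf F S L -> Cinf u -> 0 < e ->
  \forall i \near F, Cinf (S i u) /\ sn s (S i u - L u) <= e.
Proof.
move=> [h1 [h2 _ _] h3] hu e0.
have c1 : \forall i \near F, Cinf (S i u) by apply: filterS h1 => i [Si _ _]; exact: Si.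
have hB : bounded_Cinf [set u].
  by split=> [v -> //|b]; exists (nrm (delta b u)) => v ->.
have hc : cvg_Cinf F (fun i => S i u) (L u).
  split=> // [|b d d0]; first exact: h2.
  by apply: filterS (h3 _ hB b d d0) => i; exact.
exact: filterI c1 (cvg_Cinf_sn s hc e0).
Qed.

Lemma sn_small_eq0 s u : 0 <= s -> Cinf u -> (forall e, 0 < e -> sn s u <= e) -> u = 0.
Proof.
move=> s0 hu h; apply/nrm_eq0/le_anti; rewrite nrm_ge0 andbT.
apply/ler_addgt0Pr => e e0; rewrite add0r.
exact: le_trans (nrm_le_sn s0 hu) (h e e0).
Qed.

(** Continuity of [Q] combined with uniqueness of limits. With the identity it is uniqueness alone;
    with [P] it moves [P] inside an integral. *)
Lemma cvg_LCinf_comp (I : Type) (F : set_system I) {FF : ProperFilter F}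
    (S S' : I -> T -> T) L L' (Q : T -> T) :
  cvg_LCinf F S L -> cvg_LCinf F S' L' -> LCinf Q -> sn_dominated Q ->
  forall u, Cinf u -> (\forall i \near F, Q (S i u) = S' i u) -> Q (L u) = L' u.
Proof.
move=> hS hS' [Q1 Q2 _] Q3 u hu hi; have [s' [K [K0 hK]]] := Q3 0.
have [_ [L1 _ _] _] := hS; have [_ [L1' _ _] _] := hS'.
have cL := L1 u hu; have cL' := L1' u hu.
apply/eqP; rewrite -subr_eq0; apply/eqP; apply: (@sn_small_eq0 0) => //.
  by apply: CinfB => //; exact: Q1.
move=> e e0; have e2 : 0 < e / 2 by rewrite divr_gt0.
have K1 : 0 < K + 1 by rewrite ltr_wpDl.
have PF : Filter F := @filter_filter _ _ FF.
have h1 := @cvg_LCinf_sn _ _ PF _ _ _ s' _ hS hu (divr_gt0 e2 K1).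
have h2 := @cvg_LCinf_sn _ _ PF _ _ _ 0 _ hS' hu e2.
have [i [[c1 b1] [[c2 b2] E]]] := filter_ex (filterI h1 (filterI h2 hi)).
have cSL : Cinf (S i u - L u) by exact: CinfB.
have QB : Q (S i u - L u) = Q (S i u) - Q (L u).
  by rewrite -scaleN1r addrC Q2 // scaleN1r addrC.
rewrite -(subrK (Q (S i u)) (Q (L u))) -addrA.
apply: le_trans (snD _ _ _) _.
- by apply/Cinf_wfin/CinfB; apply: Q1.
- by rewrite E; apply/Cinf_wfin/CinfB.
rewrite [e]splitr lerD //; last by rewrite E.
rewrite snBC -QB (le_trans (hK _ cSL)) // (le_trans (ler_wpM2l K0 b1)) //.
exact/ltW/frac_lt.
Qed.

Lemma LCinf_id : LCinf (@id T) /\ sn_dominated (@id T).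
Proof.
have d : sn_dominated (@id T) by move=> s; exists s, 1; split=> // u _; rewrite mul1r.
by split=> //; apply: LCinf_dominated.
Qed.

Lemma cvg_LCinf_uniq (I : Type) (F : set_system I) {FF : ProperFilter F}
    (S S' : I -> T -> T) L L' :
  cvg_LCinf F S L -> cvg_LCinf F S' L' ->
  forall u, Cinf u -> (\forall i \near F, S i u = S' i u) -> L u = L' u.
Proof.
move=> h1 h2 u hu h; have [i1 i2] := LCinf_id.
exact: (cvg_LCinf_comp h1 h2 i1 i2 hu h).
Qed.

Lemma LCinf_lin (c : C) S S' : LCinf S -> LCinf S' -> LCinf (fun u => c *: S u + S' u).
Proof.
move=> [a1 a2 a3] [b1 b2 b3]; split.
- by move=> u hu; apply: Cinf_lin; [exact: a1|exact: b1].
- move=> z u v hu hv; rewrite a2 // b2 // !scalerDr !scalerA [c * z]mulrC addrACA //.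
move=> b e e0; have e2 : 0 < e / 2 by rewrite divr_gt0.
have c1 : 0 < nrm c + 1 by rewrite ltr_wpDl ?nrm_ge0.
have [N1 [d1 [d10 h1]]] := a3 b _ (divr_gt0 e2 c1).
have [N2 [d2 [d20 h2]]] := b3 b _ e2.
exists (maxn N1 N2), (Num.min d1 d2); split; first by rewrite lt_min d10.
move=> u hu hg; rewrite delta_lin; [|exact: a1|exact: b1].
rewrite (le_lt_trans (nrmD _ _)) // [e]splitr ltr_leD //; last first.
  apply/ltW/h2 => // g gN; have := hg g; rewrite leq_max gN orbT => /(_ isT).
  by rewrite lt_min => /andP[].
rewrite nrmZ; have h3 : nrm (delta b (S u)) < e / 2 / (nrm c + 1).
  apply: h1 => // g gN; have := hg g; rewrite leq_max gN => /(_ isT).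
  by rewrite lt_min => /andP[].
apply: (@le_lt_trans _ _ (nrm c * (e / 2 / (nrm c + 1)))).
  by rewrite ler_wpM2l ?nrm_ge0 // ltW.
by rewrite frac_lt ?nrm_ge0.
Qed.

Lemma cvg_LCinf_lin (I : Type) (F : set_system I) {FF : Filter F} (c : C)
    (S S' : I -> T -> T) L L' :
  cvg_LCinf F S L -> cvg_LCinf F S' L' ->
  cvg_LCinf F (fun i u => c *: S i u + S' i u) (fun u => c *: L u + L' u).
Proof.
move=> [a1 a2 a3] [b1 b2 b3]; split.
- by apply: filterS2 a1 b1 => i; exact: LCinf_lin.
- exact: LCinf_lin.
move=> B hB b e e0; have e2 : 0 < e / 2 by rewrite divr_gt0.
have c1 : 0 < nrm c + 1 by rewrite ltr_wpDl ?nrm_ge0.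
have h1 := a3 B hB b _ (divr_gt0 e2 c1); have h2 := b3 B hB b _ e2.
have [La _ _] := a2; have [Lb _ _] := b2.
apply: filterS2 (filterI a1 b1) (filterI h1 h2) => i [[Sa _ _] [Sb _ _]] [i1 i2] u Bu.
have hu : Cinf u by exact: hB.1.
have -> : c *: S i u + S' i u - (c *: L u + L' u) = c *: (S i u - L u) + (S' i u - L' u).
  by rewrite scalerBr opprD addrACA.
rewrite delta_lin; first last.
- by apply: CinfB; [exact: Sb|exact: Lb].
- by apply: CinfB; [exact: Sa|exact: La].
rewrite (le_lt_trans (nrmD _ _)) // [e]splitr ltr_leD //; last exact/ltW/i2.
rewrite nrmZ; have h3 := i1 u Bu.
apply: (@le_lt_trans _ _ (nrm c * (e / 2 / (nrm c + 1)))).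
  by rewrite ler_wpM2l ?nrm_ge0 // ltW.
by rewrite frac_lt ?nrm_ge0.
Qed.

Lemma LCinf_eq S S' : (forall u, Cinf u -> S u = S' u) -> LCinf S -> LCinf S'.
Proof.
move=> h [a1 a2 a3]; split.
- by move=> u hu; rewrite -h //; exact: a1.
- by move=> c u v hu hv; rewrite -!h ?a2 //; exact: Cinf_lin.
move=> b e e0; have [N [d [d0 hd]]] := a3 b e e0; exists N, d; split=> // u hu.
by rewrite -h //; exact: hd.
Qed.

Lemma LCinfZ (c : C) S : LCinf S -> LCinf (fun u => c *: S u).
Proof.
move=> hS; apply: LCinf_eq (LCinf_lin (c - 1) hS hS) => u _.
by rewrite scalerBl scale1r subrK.
Qed.

Lemma LCinf_scale (c : C) S u : LCinf S -> Cinf u -> S (c *: u) = c *: S u.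
Proof.
move=> [_ SL _] hu; have S0 : S 0 = 0.
  by have := SL (-1) 0 0 (Cinf0 T) (Cinf0 T); rewrite scaleN1r oppr0 addr0 scaleN1r addNr.
by rewrite -[c *: u]addr0 SL ?S0 ?addr0 //; exact: Cinf0.
Qed.

Lemma cvg_LCinf_eq (I : Type) (F : set_system I) {FF : Filter F} (S S' : I -> T -> T) L L' :
  (\forall i \near F, forall u, Cinf u -> S i u = S' i u) ->
  (forall u, Cinf u -> L u = L' u) -> cvg_LCinf F S L -> cvg_LCinf F S' L'.
Proof.
move=> hS hL [a1 a2 a3]; split.
- by apply: filterS2 hS a1 => i; exact: LCinf_eq.
- exact: LCinf_eq a2.
move=> B hB b e e0; apply: filterS2 hS (a3 B hB b e e0) => i i1 i2 u Bu.
by have hu := hB.1 u Bu; rewrite -i1 // -hL // i2.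
Qed.

End OperatorTopology.

(** * Riemann sums of scalar functions *)

Section RiemannSums.
Variable R : realType.
Local Notation C := R[i].
Implicit Types (a b x y t e eta : R) (p : tagged_partition R).

Lemma mesh_points a b eta p : mesh_below a b eta p -> forall i, (i < tp_size p)%N ->
  [/\ a <= tp_point p i, tp_point p i <= tp_tag p i <= tp_point p i.+1 & tp_point p i.+1 <= b].
Proof.
move=> [p0 pN h].
have mono i : (i < tp_size p)%N -> tp_point p i <= tp_point p i.+1.
  by move=> /h [/andP[h1 h2] _]; exact: le_trans h2.
have lo i : (i <= tp_size p)%N -> a <= tp_point p i.
  elim: i => [|i IH] iN; first by rewrite p0.
  by apply: le_trans (mono i iN); apply: IH; exact: ltnW.
have hi j : (j <= tp_size p)%N -> tp_point p (tp_size p - j) <= b.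
  elim: j => [|j IH] jN; first by rewrite subn0 pN.
  apply: le_trans (IH (ltnW jN)); rewrite -(subnSK jN); apply: mono.
  by rewrite ltn_subrL /= (leq_ltn_trans _ jN).
move=> i iN; have [h1 _] := h i iN; split=> //; first exact/lo/ltnW.
by have := hi (tp_size p - i.+1)%N (leq_subr _ _); rewrite subKn.
Qed.

Lemma mesh_sum a b eta p : mesh_below a b eta p ->
  \sum_(i < tp_size p) (tp_point p i.+1 - tp_point p i) = b - a.
Proof.
move=> [p0 pN _]; rewrite -(big_mkord xpredT (fun i => tp_point p i.+1 - tp_point p i)).
by rewrite telescope_sumr // pN p0.
Qed.

Lemma mesh_filter_proper a b : a <= b -> ProperFilter (mesh_filter a b).
Proof.
move=> ab; apply: filter_from_proper.
  apply: filter_from_filter; first by exists 1 => /=.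
  move=> x y /= x0 y0; exists (Num.min x y); first by rewrite /= lt_min x0.
  by move=> p [h1 h2 h3]; split; split=> // i iN; have [h4] := h3 i iN;
    rewrite lt_min => /andP[h5 h6].
move=> eta /= eta0; have [->|anb] := eqVneq a b.
  by exists (TaggedPartition 0 (fun=> b) (fun=> b)); split.
pose N := (Num.truncn ((b - a) / eta)).+1.
have N0 : 0 < N%:R :> R by rewrite ltr0n.
pose h := (b - a) / N%:R.
have h0 : 0 <= h by rewrite divr_ge0 // subr_ge0.
exists (TaggedPartition N (fun i => a + i%:R * h) (fun i => a + i%:R * h)).
split=> /=; first by rewrite mul0r addr0.
  by rewrite /h mulrCA mulfV ?gt_eqF // mulr1 addrC subrK.
move=> i _; have E : a + i.+1%:R * h - (a + i%:R * h) = h.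
  by rewrite -natr1; ring.
split; first by rewrite lexx -subr_ge0 E.
rewrite E /h ltr_pdivrMr // mulrC -ltr_pdivrMr //.
exact: truncnS_gt.
Qed.

Lemma mesh_near a b : \forall p \near mesh_filter a b, mesh_below a b 1 p.
Proof. by exists 1 => /=. Qed.

(** On each interval the mean inequality is applied with [c] the value at the tag, from which [f]
    departs by at most [K * eta]. *)
Lemma riemann_scalar (f F : R -> C) a b K eta p : mean_primitive f F a -> 0 <= K ->
  (forall x y, a <= x <= b -> a <= y <= b -> nrm (f x - f y) <= K * `|x - y|) ->
  mesh_below a b eta p ->
  nrm (\sum_(i < tp_size p) (tp_point p i.+1 - tp_point p i)%:C * f (tp_tag p i) -
       (F b - F a)) <= 2 * (b - a) * (K * eta).
Proof.
move=> hF K0 lip hp; have pts := mesh_points hp.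
have [p0 pN hm] := hp.
have -> : F b - F a = \sum_(i < tp_size p) (F (tp_point p i.+1) - F (tp_point p i)).
  rewrite -(big_mkord xpredT (fun i => F (tp_point p i.+1) - F (tp_point p i))).
  by rewrite telescope_sumr // pN p0.
rewrite -sumrB; apply: le_trans (nrm_sum _ _) _.
rewrite -(mesh_sum hp) -mulrA mulr_suml mulr_sumr; apply: ler_sum => i _.
have [ai /andP[t1 t2] ib] := pts i (ltn_ord i); have [_ me] := hm i (ltn_ord i).
rewrite nrmC mulrA; apply: hF => //; first exact: le_trans t2.
move=> t /andP[t3 t4]; apply: le_trans (lip _ _ _ _) _.
- by rewrite (le_trans ai) //= (le_trans t4).
- by rewrite (le_trans ai) //= (le_trans t2).
rewrite ler_wpM2l // (le_trans _ (ltW me)) // ler_norml; apply/andP; split; lra.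
Qed.

End RiemannSums.

(** * Integrals over a segment *)

Section Families.
Variables (R : realType) (n : nat) (theta : 'M[R]_n) (T : ncTorus theta).
Local Notation C := R[i].
Local Notation Zn := 'rV[int]_n.
Implicit Types (k l : Zn) (s e a b x y t : R) (u v : T) (G : R -> T -> T).

(* Locally bounded and Lipschitz families of operators, for which the Riemann
   sums converge coefficient by coefficient at a uniform rate. *)
Definition fam a G :=
  [/\ forall x u, a <= x -> Cinf u -> Cinf (G x u),
      forall x (c : C) u v, a <= x -> Cinf u -> Cinf v -> G x (c *: u + v) = c *: G x u + G x v &
      forall s b, exists s' K, [/\ 0 <= K,
        forall x u, a <= x <= b -> Cinf u -> sn s (G x u) <= K * sn s' u &
        forall x y u, a <= x <= b -> a <= y <= b -> Cinf u ->
          sn s (G x u - G y u) <= K * sn s' u * `|x - y|]].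

Lemma nrm_coef_sn u k : wfin (coef u) -> nrm (coef u k) <= sn 0 u.
Proof. by move=> hu; have := sn_coord 0 k hu; rewrite jp0 mul1r. Qed.

Lemma fam_primitive a G u : fam a G -> Cinf u ->
  exists Fs : Zn -> R -> C, forall k, mean_primitive (fun t => coef (G t u) k) (Fs k) a.
Proof.
move=> [G1 G2 G3] hu; suff h k : exists F, mean_primitive (fun t => coef (G t u) k) F a.
  by have /boolp.choice [Fs hFs] := h; exists Fs.
apply: primitive_exists => b; have [s' [K [K0 h1 h2]]] := G3 0 b.
exists (K * sn s' u); first by rewrite mulr_ge0 ?sn_ge0.
split=> [x xb|x y xb yb].
  apply: le_trans (h1 x u xb hu); apply: nrm_coef_sn.
  by apply/Cinf_wfin/G1 => //; case/andP: xb.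
rewrite -coefB (le_trans (nrm_coef_sn _ _)) // ?h2 //.
by apply/Cinf_wfin/CinfB; apply: G1 => //; [case/andP: xb|case/andP: yb].
Qed.

Lemma LCinf_riemann a b G p eta : fam a G -> mesh_below a b eta p -> LCinf (riemann_sum G p).
Proof.
move=> [G1 G2 G3] hp; have pts := mesh_points hp.
have tag i : (i < tp_size p)%N -> a <= tp_tag p i <= b.
  move=> iN; have [h1 /andP[h2 h3] h4] := pts i iN.
  by rewrite (le_trans h1 h2) (le_trans h3 h4).
have S1 u : Cinf u -> Cinf (riemann_sum G p u).
  move=> hu; apply: (big_ind (@Cinf _ _ _ T)); [exact: Cinf0|exact: CinfD|].
  by move=> i _; apply/CinfZ/G1 => //; case/andP: (tag i (ltn_ord i)).
apply: LCinf_dominated => //.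
  move=> c u v hu hv; rewrite /riemann_sum scaler_sumr -big_split /=; apply: eq_bigr => i _.
  have /andP[h _] := tag i (ltn_ord i).
  by rewrite G2 // scalerDr !scalerA mulrC.
move=> s; have [s' [K [K0 h1 _]]] := G3 s b.
exists s', (\sum_(i < tp_size p) (tp_point p i.+1 - tp_point p i) * K).
have d0 (i : 'I_(tp_size p)) : 0 <= tp_point p i.+1 - tp_point p i.
  by have [_ /andP[h2 h3] _] := pts i (ltn_ord i); rewrite subr_ge0 (le_trans h2 h3).
split; first by apply: sumr_ge0 => i _; rewrite mulr_ge0.
move=> u hu; rewrite mulr_suml.
have Gi (i : 'I_(tp_size p)) : Cinf (G (tp_tag p i) u).
  by apply: G1 => //; case/andP: (tag i (ltn_ord i)).
suff : Cinf (riemann_sum G p u) /\ sn s (riemann_sum G p u) <=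
    \sum_(i < tp_size p) (tp_point p i.+1 - tp_point p i) * K * sn s' u by case.
rewrite /riemann_sum; elim/big_rec2: _ => [|i M v _ [cv hv]].
  by split; [exact: Cinf0|rewrite sn0].
have ci := CinfZ (tp_point p i.+1 - tp_point p i)%:C (Gi i).
split; first exact: CinfD.
apply: le_trans (snD s (Cinf_wfin ci) (Cinf_wfin cv)) _.
rewrite lerD // snZ; last exact: Cinf_wfin.
by rewrite nrm_real ger0_norm ?d0 // -mulrA ler_wpM2l ?d0 // h1 // tag.
Qed.

Lemma coef_riemann G p u k : coef (riemann_sum G p u) k =
  \sum_(i < tp_size p) (tp_point p i.+1 - tp_point p i)%:C * coef (G (tp_tag p i) u) k.
Proof. by rewrite coef_sum; apply: eq_bigr => i _; rewrite coefZ. Qed.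

Lemma jp_scale s k (z : C) M : jp s k * nrm z <= M -> nrm z <= M / jp s k.
Proof. by move=> h; rewrite ler_pdivlMr ?jp_gt0 // mulrC. Qed.

(** Each coefficient has a complex primitive; its increments satisfy the weighted bounds of the
    family, so they are the coefficients of a smooth element, the candidate integral. The primitives
    are returned as well, to estimate integrals coefficientwise later. *)
Lemma integral_exists a G : fam a G -> exists J : R -> T -> T,
  (forall b, a <= b -> is_integral G a b (J b)) /\
  forall u, Cinf u -> exists Fs : Zn -> R -> C, forall k,
    mean_primitive (fun t => coef (G t u) k) (Fs k) a /\
    forall b, a <= b -> coef (J b u) k = Fs k b - Fs k a.
Proof.
move=> hG; have [G1 G2 G3] := hG.
have [J hJ] : exists J : T -> R -> T, forall u, Cinf u ->
    (exists Fs : Zn -> R -> C, forall k,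
       mean_primitive (fun t => coef (G t u) k) (Fs k) a /\
       forall b, a <= b -> coef (J u b) k = Fs k b - Fs k a) /\
    forall b, a <= b -> Cinf (J u b).
  suff h u : exists Ju : R -> T, Cinf u ->
      (exists Fs : Zn -> R -> C, forall k,
       mean_primitive (fun t => coef (G t u) k) (Fs k) a /\
       forall b, a <= b -> coef (Ju b) k = Fs k b - Fs k a) /\
      forall b, a <= b -> Cinf (Ju b).
    by have [J hJ] := boolp.choice h; exists J.
  have [hu|nu] := pselect (Cinf u); last by exists (fun=> 0).
  have [Fs hF] := fam_primitive hG hu.
  pose c b k := Fs k b - Fs k a.
  have cw b : a <= b -> wfin (c b).
    move=> ab; apply: wfin_dom => N; have [s' [K [K0 h1 _]]] := G3 N%:R b.
    exists (2 * (b - a) * (K * sn s' u)) => k.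
    have -> : wt R k ^+ N = jp N%:R k by rewrite /jp powR_mulrn // ltW // wt_gt0.
    rewrite mulrC -ler_pdivlMr ?jp_gt0 // -(mulrA (2 * (b - a))).
    apply: (primitive_bound (hF k) (lexx a) ab) => t tab.
    apply: jp_scale; apply: le_trans (h1 t u tab hu).
    by apply: sn_coord; apply/Cinf_wfin/G1 => //; case/andP: tab.
  exists (fun b => summability.sum (fun k => c b k *: monomial (@gen _ _ _ T) k)) => _.
  have hJ b : a <= b -> Cinf (summability.sum (fun k => c b k *: monomial (@gen _ _ _ T) k)) /\
     coef (summability.sum (fun k => c b k *: monomial (@gen _ _ _ T) k)) = c b.
    move=> ab; have [v hv cv] := fourier_cvg T (cw b ab 0).
    rewrite (psum_sum hv); split=> //; apply/CinfP; rewrite cv; split; last exact: cw.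
    exact: fsummable_cvg hv.
  split; last by move=> b /hJ[].
  by exists Fs => k; split=> // b /hJ[_ ->].
exists (fun b u => J u b); split; last by move=> u /hJ[].
move=> b ab; rewrite /is_integral.
have FM := mesh_filter_proper ab.
have approx s : exists s' K, 0 <= K /\ forall eta p u, mesh_below a b eta p -> Cinf u ->
    forall k, jp s k * nrm (coef (riemann_sum G p u - J u b) k) <= 2 * (b - a) * K * sn s' u * eta.
  have [s' [K [K0 h1 h2]]] := G3 s b; exists s', K; split=> // eta p u hp hu k.
  have [[Fs hF] _] := hJ u hu; have [hFk hFb] := hF k.
  rewrite mulrC -ler_pdivlMr ?jp_gt0 // coefB coef_riemann hFb //.
  rewrite (_ : 2 * (b - a) * K * sn s' u * eta / jp s k =
     2 * (b - a) * ((K * sn s' u / jp s k) * eta)); last by ring.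
  apply: (riemann_scalar hFk _ _ hp); first by rewrite divr_ge0 ?jp_ge0 // mulr_ge0 ?sn_ge0.
  move=> x y xab yab; rewrite -coefB.
  have cd : Cinf (G x u - G y u).
    by apply: CinfB; apply: G1 => //; [case/andP: xab|case/andP: yab].
  rewrite mulrAC; apply: jp_scale; apply: le_trans (h2 x y u xab yab hu).
  by apply: sn_coord; exact: Cinf_wfin.
have [Z Z0 hZ] := sn_dom T.
have small s u e : Cinf u -> 0 < e -> \forall p \near mesh_filter a b,
   sn s (riemann_sum G p u - J u b) <= e.
  move=> hu e0; have [s' [K [K0 h]]] := approx (s + 2 * n%:R).
  pose X := 2 * (b - a) * K * sn s' u * Z.
  have X0 : 0 <= X by rewrite !mulr_ge0 ?subr_ge0 ?sn_ge0.
  have X1 : 0 < X + 1 by rewrite ltr_wpDl.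
  exists (e / (X + 1)); first exact: divr_gt0.
  move=> p hp /=; apply: le_trans (hZ _ _ _ (h _ _ _ hp hu)) _.
  by rewrite mulrAC; exact/ltW/frac_lt.
apply: cvg_LCinf_coef.
- by apply: filterS (mesh_near a b) => p; exact: LCinf_riemann.
- apply: LCinf_dominated.
  + by move=> u hu; have [_] := hJ u hu; apply.
  (* Primitives are chosen separately for each element, so linearity is inherited from the Riemann
     sums in the limit. *)
  + move=> c u v hu hv; have huv := Cinf_lin c hu hv.
    have cJ z : Cinf z -> Cinf (J z b) by move=> hz; have [_] := hJ z hz; apply.
    apply/eqP; rewrite -subr_eq0; apply/eqP; apply: (@sn_small_eq0 _ _ _ _ 0) => //.
      by apply: CinfB; [exact: cJ|apply: Cinf_lin; exact: cJ].
    move=> e e0; have c3 : 0 < e / (nrm c + 2) by rewrite divr_gt0 // ltr_wpDl ?nrm_ge0.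
    have h1 := small 0 _ _ huv c3; have h2 := small 0 _ _ hu c3; have h3 := small 0 _ _ hv c3.
    have [p [hp [b1 [b2 b3]]]] := filter_ex (filterI (mesh_near a b) (filterI h1 (filterI h2 h3))).
    have [S1 S2 _] := LCinf_riemann hG hp.
    have cR z : Cinf z -> Cinf (riemann_sum G p z - J z b).
      by move=> hz; apply: CinfB; [exact: S1|exact: cJ].
    have E : J (c *: u + v) b - (c *: J u b + J v b) =
      - (riemann_sum G p (c *: u + v) - J (c *: u + v) b) +
      (c *: (riemann_sum G p u - J u b) + (riemann_sum G p v - J v b)).
      by rewrite S2 // scalerBr opprB (addrACA (c *: riemann_sum G p u)) -opprD addrA subrK.
    rewrite E; apply: le_trans (snD _ _ _) _.
    + by apply/Cinf_wfin/CinfN/cR.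
    + by apply/Cinf_wfin/Cinf_lin; exact: cR.
    have h4 := snD 0 (Cinf_wfin (CinfZ c (cR u hu))) (Cinf_wfin (cR v hv)).
    rewrite snN; apply: le_trans (lerD b1 h4) _; rewrite snZ; last exact/Cinf_wfin/cR.
    apply: (@le_trans _ _ (e / (nrm c + 2) + (nrm c * (e / (nrm c + 2)) + e / (nrm c + 2)))).
      by rewrite lerD2l lerD // ler_wpM2l ?nrm_ge0.
    rewrite le_eqVlt; apply/orP; left; apply/eqP; field.
    by apply: lt0r_neq0; have := nrm_ge0 c; lra.
  + move=> s; have [s' [K [K0 h1 _]]] := G3 (s + 2 * n%:R) b.
    exists s', (2 * (b - a) * K * Z); split; first by rewrite !mulr_ge0 ?subr_ge0.
    move=> u hu; have [[Fs hF] _] := hJ u hu.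
    rewrite mulrAC; apply: hZ => k; have [hFk hFb] := hF k.
    rewrite hFb // mulrC -ler_pdivlMr ?jp_gt0 // -2!(mulrA (2 * (b - a))).
    apply: (primitive_bound hFk (lexx a) ab) => t tab.
    apply: jp_scale; apply: le_trans (h1 t u tab hu).
    by apply: sn_coord; apply/Cinf_wfin/G1 => //; case/andP: tab.
- move=> s; have [s' [K [K0 h]]] := approx s; exists s' => e e0.
  pose X := 2 * (b - a) * K; have X0 : 0 <= X by rewrite !mulr_ge0 ?subr_ge0.
  have X1 : 0 < X + 1 by rewrite ltr_wpDl.
  exists (e / (X + 1)); first exact: divr_gt0.
  move=> p hp u hu k; apply: le_trans (h _ _ _ hp hu k) _.
  by rewrite -/X mulrAC ler_wpM2r ?sn_ge0 //; exact/ltW/frac_lt.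
Qed.

End Families.

(** * Locally Lipschitz functions along the contour *)

Section Curves.
Variable R : realType.
Local Notation C := R[i].
Implicit Types (x y t a b e : R) (g : R -> R).

Lemma loc_lip_eq (f f' : R -> C) a : (forall x, a <= x -> f x = f' x) ->
  loc_lip f a -> loc_lip f' a.
Proof.
move=> E h b; have [K K0 [h1 h2]] := h b; exists K => //; split.
  by move=> x xb; rewrite -E ?h1 //; case/andP: xb.
move=> x y xb yb; have /andP[ax _] := xb; have /andP[ay _] := yb.
by rewrite -!E ?h2.
Qed.

Lemma loc_lip_cst (c : C) a : loc_lip (fun=> c) a.
Proof.
move=> b; exists (nrm c); first exact: nrm_ge0.
by split=> // x y _ _; rewrite subrr nrm0 mulr_ge0 ?nrm_ge0.
Qed.

Lemma loc_lipM (f f' : R -> C) a : loc_lip f a -> loc_lip f' a ->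
  loc_lip (fun x => f x * f' x) a.
Proof.
move=> h h' b; have [K K0 [h1 h2]] := h b; have [K' K'0 [h1' h2']] := h' b.
exists (K * K' + 2 * (K * K')); first by rewrite addr_ge0 ?mulr_ge0.
split=> [x xb|x y xb yb].
  have xx := h1 x xb; have xx' := h1' x xb.
  rewrite nrm_mul; apply: (@le_trans _ _ (K * K')); first by apply: ler_pM; rewrite ?nrm_ge0.
  by rewrite lerDl !mulr_ge0.
have -> : f x * f' x - f y * f' y = f x * (f' x - f' y) + (f x - f y) * f' y by ring.
apply: le_trans (nrmD _ _) _; rewrite !nrm_mul mulrDl.
apply: (@le_trans _ _ (K * (K' * `|x - y|) + K * `|x - y| * K')).
  by apply: lerD; apply: ler_pM; rewrite ?nrm_ge0 ?h1 ?h2 ?h1' ?h2'.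
by rewrite -subr_ge0 (_ : _ - _ = K * K' * `|x - y|); [rewrite !mulr_ge0|ring].
Qed.

Lemma loc_lipD (f f' : R -> C) a : loc_lip f a -> loc_lip f' a ->
  loc_lip (fun x => f x + f' x) a.
Proof.
move=> h h' b; have [K K0 [h1 h2]] := h b; have [K' K'0 [h1' h2']] := h' b.
exists (K + K'); first exact: addr_ge0.
split=> [x xb|x y xb yb]; first by rewrite (le_trans (nrmD _ _)) // lerD ?h1 ?h1'.
by rewrite opprD addrACA (le_trans (nrmD _ _)) // mulrDl lerD ?h2 ?h2'.
Qed.

Lemma derive_lip (f df : R -> R) a b K : (forall z, a <= z -> is_derive z 1 f (df z)) ->
  (forall z, a <= z <= b -> `|df z| <= K) ->
  forall x y, a <= x <= b -> a <= y <= b -> `|f x - f y| <= K * `|x - y|.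
Proof.
move=> hd hK x y; wlog xy : x y / x <= y => [H|] xb yb.
  have [/H|/ltW/H] := leP x y; first exact.
  by rewrite (distrC x y) (distrC (f x)); exact.
have ax : a <= x by case/andP: xb.
have := @derive_mean _ f df a x y 0 K hd ax xy; rewrite mulr0 subr0.
rewrite distrC mulrC (distrC x) (ger0_norm (_ : 0 <= y - x)) ?subr_ge0 //; apply.
move=> t /andP[xt ty]; rewrite subr0 hK // (le_trans ax xt) /=.
by case/andP: yb => _; exact: le_trans.
Qed.

Lemma loc_lip_derive (f df : R -> C) a :
  (forall z, a <= z -> is_derive z 1 (fun x => complex.Re (f x)) (complex.Re (df z)) /\
     is_derive z 1 (fun x => complex.Im (f x)) (complex.Im (df z))) ->
  (forall b, exists2 K, 0 <= K & forall x, a <= x <= b -> nrm (f x) <= K /\ nrm (df x) <= K) ->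
  loc_lip f a.
Proof.
move=> hd h b; have [K K0 hK] := h b; exists (2 * K); first exact: mulr_ge0.
split=> [x xb|x y xb yb].
  by have [h1 _] := hK x xb; rewrite (le_trans h1) // ler_peMl // ler1n.
apply: le_trans (nrm_le_ReIm _) _; rewrite !raddfB /= -mulrA mulr2n mulrDl mul1r.
apply: lerD.
- apply: (@derive_lip (fun x => complex.Re (f x)) (fun z => complex.Re (df z)) a b K _ _ x y xb yb).
    by move=> z /hd[].
  by move=> z /hK[_ h1]; exact: le_trans (nrm_Re _) h1.
- apply: (@derive_lip (fun x => complex.Im (f x)) (fun z => complex.Im (df z)) a b K _ _ x y xb yb).
    by move=> z /hd[].
  by move=> z /hK[_ h1]; exact: le_trans (nrm_Im _) h1.
Qed.

Lemma loc_lip_real g dg a : (forall z, a <= z -> is_derive z 1 g (dg z)) ->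
  (forall b, exists2 K, 0 <= K & forall x, a <= x <= b -> `|g x| <= K /\ `|dg x| <= K) ->
  loc_lip (fun x => (g x)%:C) a.
Proof.
move=> hd h; apply: (@loc_lip_derive _ (fun x => (dg x)%:C)).
  by move=> z az /=; split; [exact: hd|exact: is_derive_cst].
by move=> b; have [K K0 hK] := h b; exists K => // x xb; rewrite !nrm_real; exact: hK.
Qed.

(** The affine exponent covers both parametrizations of a complex power: [g] is [ln] on the rays and
    the identity on the circle. *)
Lemma derive_cexp g (dg : R) x (c0 c1 : C) : is_derive x 1 g dg ->
  is_derive x 1 (fun x => complex.Re (cexp (c0 + c1 * (g x)%:C)))
    (complex.Re (c1 * dg%:C * cexp (c0 + c1 * (g x)%:C))) /\
  is_derive x 1 (fun x => complex.Im (cexp (c0 + c1 * (g x)%:C)))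
    (complex.Im (c1 * dg%:C * cexp (c0 + c1 * (g x)%:C))).
Proof.
case: c0 c1 => p0 q0 [p1 q1] hg /=; rewrite /cexp /= !mul0r !subr0 !addr0 !mulr0 !subr0 !add0r.
split.
- under eq_fun do rewrite mul0r subr0.
  apply: is_derive_eq; rewrite /GRing.scale /= ?subr0 ?add0r; ring.
- under eq_fun do rewrite mul0r addr0.
  apply: is_derive_eq; rewrite /GRing.scale /= ?subr0 ?add0r; ring.
Qed.

Lemma loc_lip_cexp g (dg : R -> R) a (c0 c1 : C) :
  (forall z, a <= z -> is_derive z 1 g (dg z)) ->
  (forall b, exists2 K, 0 <= K & forall x, a <= x <= b -> `|g x| <= K /\ `|dg x| <= K) ->
  loc_lip (fun x => cexp (c0 + c1 * (g x)%:C)) a.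
Proof.
move=> hd h; apply: (@loc_lip_derive _ (fun x => c1 * (dg x)%:C * cexp (c0 + c1 * (g x)%:C))).
  by move=> z az; apply: derive_cexp; exact: hd.
move=> b; have [K K0 hK] := h b.
pose M := expR (nrm c0 + nrm c1 * K); have M0 : 0 <= M := expR_ge0 _.
have hM x : a <= x <= b -> nrm (cexp (c0 + c1 * (g x)%:C)) <= M.
  move=> /hK[h1 _]; rewrite nrm_cexp ler_expR (le_trans (ler_norm _)) //.
  rewrite (le_trans (nrm_Re _)) // (le_trans (nrmD _ _)) // lerD2l nrm_mul nrm_real.
  by rewrite ler_wpM2l ?nrm_ge0.
exists (M + nrm c1 * K * M); first by rewrite addr_ge0 ?mulr_ge0 ?nrm_ge0.
move=> x xb; have [h1 h2] := hK x xb; split.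
  by rewrite (le_trans (hM x xb)) // lerDl !mulr_ge0 ?nrm_ge0.
rewrite (nrm_mul (c1 * _)) (nrm_mul c1) nrm_real.
apply: (@le_trans _ _ (nrm c1 * K * M)); last by rewrite lerDr.
have h3 := hM x xb; have h4 := ler_wpM2l (nrm_ge0 c1) h2.
by apply: ler_pM; rewrite ?mulr_ge0 ?nrm_ge0.
Qed.

Lemma ln_curve a : 0 < a -> (forall z, a <= z -> is_derive z 1 (@ln R) z^-1) /\
  forall b, exists2 K, 0 <= K & forall x, a <= x <= b -> `|ln x| <= K /\ `|x^-1| <= K.
Proof.
move=> a0; split; first by move=> z az; apply: is_derive1_ln; exact: lt_le_trans az.
move=> b; exists (`|ln a| + `|ln b| + a^-1); first by rewrite !addr_ge0 // invr_ge0 ltW.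
move=> x /andP[ax xb]; have x0 := lt_le_trans a0 ax; have b0 := lt_le_trans x0 xb.
have h1 : ln a <= ln x by rewrite ler_ln.
have h2 : ln x <= ln b by rewrite ler_ln.
have h3 : a^-1 > 0 by rewrite invr_gt0.
have h4 : x^-1 <= a^-1 by rewrite lef_pV2.
have h5 : x^-1 > 0 by rewrite invr_gt0.
have [n1 n2 n3 n4] : [/\ ln a <= `|ln a|, - ln a <= `|ln a|, ln b <= `|ln b| & - ln b <= `|ln b|].
  by split; rewrite ?ler_norm // -normrN ler_norm.
by split; rewrite ler_norml; apply/andP; split; lra.
Qed.

Lemma id_curve a : (forall z, a <= z -> is_derive z 1 (@id R) 1) /\
  forall b, exists2 K, 0 <= K & forall x, a <= x <= b -> `|x| <= K /\ `|1 : R| <= K.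
Proof.
split; first by move=> z _; exact: is_derive_id.
move=> b; exists (`|a| + `|b| + 1); first by rewrite !addr_ge0.
move=> x /andP[ax xb].
have [n1 n2 n3 n4] : [/\ a <= `|a|, - a <= `|a|, b <= `|b| & - b <= `|b|].
  by split; rewrite ?ler_norm // -normrN ler_norm.
by split; rewrite ler_norml; apply/andP; split; lra.
Qed.

Lemma cpow_ray (z : C) t a : cpow z t a = cexp (z * (a%:C * 'i) + z * (ln t)%:C).
Proof.
rewrite /cpow /clog -mulrDr; congr (cexp (_ * _)).
by apply/eqP; rewrite eq_complex /=; apply/andP; split; apply/eqP; ring.
Qed.

Lemma cpow_arc (z : C) t a : cpow z t a = cexp (z * (ln t)%:C + z * 'i * a%:C).
Proof. by rewrite cpow_ray addrC; congr cexp; ring. Qed.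

Lemma loc_lip_cpow_ray (z : C) x a : 0 < a -> loc_lip (fun t => cpow z t x) a.
Proof.
move=> a0; have [h1 h2] := ln_curve a0.
by apply: loc_lip_eq (loc_lip_cexp _ _ h1 h2) => t _; rewrite cpow_ray.
Qed.

Lemma loc_lip_cpow_arc (z : C) r a : loc_lip (fun x => cpow z r x) a.
Proof.
have [h1 h2] := id_curve a.
by apply: loc_lip_eq (loc_lip_cexp _ _ h1 h2) => x _; rewrite cpow_arc.
Qed.

Lemma loc_lip_clog_ray x a : 0 < a -> loc_lip (fun t => clog t x) a.
Proof.
move=> a0; have [h1 h2] := ln_curve a0.
apply: loc_lip_eq (loc_lipD (loc_lip_cst (0 +i* x) a) (loc_lip_real h1 h2)) => t _.
by rewrite /clog; apply/eqP; rewrite eq_complex /= add0r addr0 !eqxx.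
Qed.

Lemma loc_lip_clog_arc r a : loc_lip (fun x => clog r x) a.
Proof.
have [h1 h2] := id_curve a.
apply: loc_lip_eq (loc_lipD (loc_lip_cst (ln r)%:C a)
  (loc_lipM (loc_lip_cst 'i a) (loc_lip_real h1 h2))) => x _.
by rewrite /clog; apply/eqP; rewrite eq_complex /=; apply/andP; split; apply/eqP; ring.
Qed.

Lemma polar_cpow t a : 0 < t -> polar t a = cpow 1 t a.
Proof.
move=> t0; rewrite /polar /cpow mul1r /clog /cexp /= expR0 mul1r lnK ?posrE //.
Qed.

End Curves.

(** * Improper and contour integrals *)

Section Improper.
Variables (R : realType) (n : nat) (theta : 'M[R]_n) (T : ncTorus theta).
Local Notation C := R[i].
Local Notation Zn := 'rV[int]_n.
Implicit Types (k l : Zn) (s e a b x y t : R) (u v : T) (G : R -> T -> T).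

Lemma powR_small (B e : R) : 0 <= B -> 0 < e -> exists X, 0 < X /\
  forall x, X <= x -> B * x `^ (- 2^-1) <= e.
Proof.
move=> B0 e0; pose Y := B / e + 1; have Y0 : 0 < Y by rewrite ltr_wpDl // divr_ge0 // ltW.
exists (Y ^+ 2); split=> [|x hx]; first exact: exprn_gt0.
have x0 : 0 < x by apply: lt_le_trans hx; exact: exprn_gt0.
have hY : Y <= x `^ 2^-1.
  rewrite -(ger0_norm (ltW Y0)) -sqrtr_sqr -powR12_sqrt ?sqr_ge0 //.
  by apply: ge0_ler_powR; rewrite ?nnegrE ?invr_ge0 ?sqr_ge0 ?(ltW x0).
rewrite powRN ler_pdivrMr ?powR_gt0 // (le_trans _ (ler_wpM2l (ltW e0) hY)) //.
by rewrite /Y mulrDr mulr1 mulrC divfK ?lerDl ?(ltW e0) // gt_eqF.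
Qed.

(** The limit exists pointwise by completeness of the C*-algebra. The decay estimate on coefficients
    of [J y - J x] holds in all weights and survives as [y] tends to infinity: this gives smoothness
    of [I u], with the [J y u] as approximants, and convergence in the operator topology. *)
Lemma improper_exists a G : 0 < a -> fam a G ->
  (forall s, exists s' M, 0 <= M /\ forall t u, a <= t -> Cinf u ->
     sn s (G t u) <= M * sn s' u * t `^ (- (3 / 2))) ->
  exists2 I, is_improper_integral G a I &
    forall u k B, Cinf u -> 0 <= B ->
      (forall t, a <= t -> nrm (coef (G t u) k) <= B * t `^ (- (3 / 2))) ->
      nrm (coef (I u) k) <= 8 * B * a `^ (- 2^-1).
Proof.
move=> a0 hG dec; have [J [hJ hF]] := integral_exists hG; have [G1 G2 G3] := hG.
have JC b u : a <= b -> Cinf u -> Cinf (J b u).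
  by move=> /hJ[_ [J1 _ _] _]; exact: J1.
have JL b : a <= b -> LCinf (J b) by move=> /hJ[].
have diff s : exists s' M, 0 <= M /\ forall x y u k, a <= x -> x <= y -> Cinf u ->
    jp s k * nrm (coef (J y u - J x u) k) <= M * sn s' u * x `^ (- 2^-1).
  have [s' [M [M0 hM]]] := dec s; exists s', (8 * M); split; first exact: mulr_ge0.
  move=> x y u k ax xy hu; have [Fs hFs] := hF u hu; have [hk hb] := hFs k.
  rewrite coefB !hb //; last exact: le_trans xy.
  rewrite opprB addrA subrK mulrC -ler_pdivlMr ?jp_gt0 //.
  have Mu0 : 0 <= M * sn s' u / jp s k by rewrite divr_ge0 ?jp_ge0 // mulr_ge0 ?sn_ge0.
  have := primitive_decay hk a0 Mu0 _ ax xy.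
  rewrite (_ : 8 * M * sn s' u * x `^ (- 2^-1) / jp s k =
    8 * (M * sn s' u / jp s k) * x `^ (- 2^-1)); last by ring.
  apply=> t at_; rewrite mulrAC; apply: jp_scale; apply: le_trans (hM t u at_ hu).
  by apply: sn_coord; apply/Cinf_wfin/G1.
have [Z Z0 hZ] := sn_dom T.
have cau u : Cinf u -> cvg (J b u @[b --> +oo]).
  move=> hu; have [s' [M [M0 hM]]] := diff (0 + 2 * n%:R).
  apply: cauchy_cvg; apply: cauchy_exP => e e0.
  have er : e = (complex.Re e)%:C.
    by case: e e0 => x y; rewrite ltcE /= => /andP[/eqP -> _].
  move: e0; rewrite er ltcR => e0.
  have BM : 0 <= M * sn s' u * Z by rewrite !mulr_ge0 ?sn_ge0.
  have [X [X0 hX]] := powR_small BM (divr_gt0 e0 (ltr0Sn _ 1)).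
  pose x := Num.max a X; have ax : a <= x by rewrite le_max lexx.
  have Xx : X <= x by rewrite le_max lexx orbT.
  exists (J x u); exists x; split; first exact: num_real.
  move=> y /ltW xy; rewrite -ball_normE /= nrmE ltcR nrmC.
  have cJJ := CinfB (JC y u (le_trans ax xy) hu) (JC x u ax hu).
  apply: le_lt_trans (nrm_le_sn (lexx 0) cJJ) _.
  apply: le_lt_trans (hZ 0 _ _ (fun k => hM x y u k ax xy hu)) _.
  rewrite mulrAC (le_lt_trans (hX x Xx)) //.
  by rewrite ltr_pdivrMr // ltr_pMr // ltr1n.
pose I u := lim (J b u @[b --> +oo]).
have cvI u : Cinf u -> J b u @[b --> +oo] --> I u := cau u.
have [K K0 hK] := coef_bound T.
have near_ge x : \forall y \near +oo, x <= y.
  by exists x; split; [exact: num_real|move=> y /ltW].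
have limc u x k B s : Cinf u -> a <= x -> 
    (forall y, x <= y -> jp s k * nrm (coef (J y u - J x u) k) <= B) ->
    jp s k * nrm (coef (I u - J x u) k) <= B.
  move=> hu ax h; apply/ler_addgt0Pr => e e0.
  have c0 : 0 < jp s k * K + 1 by rewrite ltr_wpDl // mulr_ge0 ?jp_ge0.
  have := cvI u hu; move/cvg_nrmP => /(_ _ (divr_gt0 e0 c0)) h1.
  have [y [y1 y2]] := filter_ex (filterI h1 (near_ge x)).
  rewrite -(subrK (J y u) (I u)) -addrA coefD [B + e]addrC.
  apply: le_trans (ler_wpM2l (jp_ge0 _ _) (nrmD _ _)) _; rewrite mulrDr lerD ?h //.
  apply: le_trans (ler_wpM2l (jp_ge0 _ _) (hK _ _)) _.
  apply: le_trans (ler_wpM2l (jp_ge0 _ _) (ler_wpM2l K0 (ltW y1))) _.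
  rewrite (mulrA (jp s k) K); apply/ltW/frac_lt => //; by rewrite mulr_ge0 ?jp_ge0.
have Idiff s : exists s' M, 0 <= M /\ forall x u k, a <= x -> Cinf u ->
    jp s k * nrm (coef (I u - J x u) k) <= M * sn s' u * x `^ (- 2^-1).
  have [s' [M [M0 hM]]] := diff s; exists s', M; split=> // x u k ax hu.
  by apply: limc => // y xy; exact: hM.
have Ja u k : Cinf u -> coef (J a u) k = 0.
  by move=> hu; have [Fs hFs] := hF u hu; have [_ ->] := hFs k; rewrite ?subrr.
have Ibd s : exists s' M, 0 <= M /\ forall u, Cinf u ->
    sn s (I u) <= M * sn s' u /\ wfin (coef (I u)).
  have [s' [M [M0 hM]]] := Idiff (s + 2 * n%:R).
  exists s', (M * a `^ (- 2^-1) * Z); split; first by rewrite !mulr_ge0 ?powR_ge0.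
  move=> u hu; split.
    rewrite mulrAC; apply: hZ => k; have := hM a u k (lexx a) hu.
    by rewrite coefB Ja // subr0 mulrAC.
  apply: wfin_dom => N; have [s1 [M1 [_ hM1]]] := Idiff N%:R.
  exists (M1 * sn s1 u * a `^ (- 2^-1)) => k; have := hM1 a u k (lexx a) hu.
  by rewrite coefB Ja // subr0 /jp powR_mulrn // ltW // wt_gt0.
have CI u : Cinf u -> Cinf (I u).
  move=> hu; have wI : wfin (coef (I u)) by have [s' [M [_ /(_ u hu)[]]]] := Ibd 0.
  apply/CinfP; split=> //; apply: fsummable_lim => // e e0.
  have [s' [M [M0 hM]]] := Idiff (0 + 2 * n%:R).
  have BM : 0 <= M * sn s' u * Z by rewrite !mulr_ge0 ?sn_ge0.
  have [X [X0 hX]] := powR_small BM e0.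
  have h1 := cvI u hu; move/cvg_nrmP: h1 => /(_ _ e0) h1.
  have [y [[y1 y2] y3]] := filter_ex (filterI (filterI h1 (near_ge X)) (near_ge a)).
  have cJ := JC y u y3 hu; exists (J y u); first exact: Cinf_fsum.
  split; first exact: ltW.
  have wIJ : wfin (coef (I u - J y u)) by apply: wfin_coefB => //; exact: Cinf_wfin.
  rewrite snE // lee_fin; apply: le_trans (hZ 0 _ _ (fun k => hM y u k y3 hu)) _.
  by rewrite mulrAC hX.
have LI : LCinf I.
  apply: LCinf_dominated => //.
    move=> c u v hu hv; apply: (cvg_lim (@norm_hausdorff _ _)).
    have : (fun b => c *: J b u + J b v) @ +oo --> c *: I u + I v.
      by apply: cvgD; [apply: cvgZr; exact: cvI|exact: cvI].
    apply: cvg_trans; apply: near_eq_cvg; apply: filterS (near_ge a) => b ab.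
    by have [_ J2 _] := JL b ab; rewrite J2.
  move=> s; have [s' [M [M0 hM]]] := Ibd s; exists s', M; split=> // u hu.
  by have [] := hM u hu.
exists I.
  exists J; split=> //; apply: cvg_LCinf_coef => //.
    by apply: filterS (near_ge a) => b; exact: JL.
  move=> s; have [s' [M [M0 hM]]] := Idiff s; exists s' => e e0.
  have [X [X0 hX]] := powR_small M0 e0.
  apply: filterS2 (near_ge a) (near_ge X) => x ax Xx u hu k.
  rewrite coefB nrmC -coefB (le_trans (hM x u k ax hu)) // mulrAC ler_wpM2r ?sn_ge0 //.
  exact: hX.
move=> u k B hu B0 hB.
have := @limc u a k (8 * B * a `^ (- 2^-1)) 0 hu (lexx a).
rewrite jp0 mul1r coefB Ja // subr0; apply => y ay.
have [Fs hFs] := hF u hu; have [hk hb] := hFs k.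
rewrite mul1r coefB Ja // subr0 hb //.
exact: (primitive_decay hk a0 B0 hB).
Qed.

Lemma fam_weight a (m : R -> C) G : loc_lip m a -> fam a G ->
  fam a (fun t u => m t *: G t u).
Proof.
move=> hm [G1 G2 G3]; split.
- by move=> x u ax hu; apply/CinfZ/G1.
- by move=> x c u v ax hu hv; rewrite G2 // scalerDr !scalerA mulrC.
move=> s b; have [s' [K [K0 h1 h2]]] := G3 s b; have [M M0 [m1 m2]] := hm b.
exists s', (2 * (M * K)); split; first by rewrite !mulr_ge0.
  move=> x u xb hu; have /andP[ax _] := xb.
  rewrite snZ; last exact/Cinf_wfin/G1.
  apply: le_trans (ler_pM (nrm_ge0 _) (sn_ge0 _ _) (m1 x xb) (h1 x u xb hu)) _.
  by rewrite [leLHS]mulrA ler_wpM2r ?sn_ge0 // ler_peMl ?mulr_ge0 // ler1n.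
move=> x y u xb yb hu; have /andP[ax _] := xb; have /andP[ay _] := yb.
have cx := G1 x u ax hu; have cy := G1 y u ay hu; have cxy := CinfB cx cy.
have -> : m x *: G x u - m y *: G y u = m x *: (G x u - G y u) + (m x - m y) *: G y u.
  by rewrite scalerBr scalerBl addrA subrK.
apply: le_trans (snD _ (Cinf_wfin (CinfZ _ cxy)) (Cinf_wfin (CinfZ _ cy))) _.
rewrite !snZ; [|exact: Cinf_wfin..].
have e1 := ler_pM (nrm_ge0 _) (sn_ge0 _ _) (m1 x xb) (h2 x y u xb yb hu).
have e2 := ler_pM (nrm_ge0 _) (sn_ge0 _ _) (m2 x y xb yb) (h1 y u yb hu).
apply: le_trans (lerD e1 e2) _; rewrite le_eqVlt; apply/orP; left; apply/eqP; ring.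
Qed.

Lemma integral_bound a b G I u k B : fam a G -> is_integral G a b I -> a <= b -> Cinf u ->
  (forall t, a <= t <= b -> nrm (coef (G t u) k) <= B) ->
  nrm (coef (I u) k) <= 2 * (b - a) * B.
Proof.
move=> hG hI ab hu hB; have [J [hJ hF]] := integral_exists hG.
have FM := mesh_filter_proper ab.
have -> : I u = J b u.
  apply: (cvg_LCinf_uniq hI (hJ b ab) hu); by apply: filterS (mesh_near a b).
have [Fs hFs] := hF u hu; have [hk ->] := hFs k => //.
exact: (primitive_bound hk (lexx a) ab).
Qed.

Lemma mesh_tag a b eta (p : tagged_partition R) : mesh_below a b eta p ->
  forall i : 'I_(tp_size p), a <= tp_tag p i <= b.
Proof.
move=> hp i; have [h1 /andP[h2 h3] h4] := mesh_points hp (ltn_ord i).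
by rewrite (le_trans h1 h2) (le_trans h3 h4).
Qed.

Lemma is_integral_lin (c : C) a b G G' I I' : a <= b ->
  is_integral G a b I -> is_integral G' a b I' ->
  is_integral (fun t u => c *: G t u + G' t u) a b (fun u => c *: I u + I' u).
Proof.
move=> ab h1 h2; have FM := mesh_filter_proper ab.
apply: (cvg_LCinf_eq _ _ (cvg_LCinf_lin c h1 h2)) => //.
apply: filterS (mesh_near a b) => p _ u _.
rewrite /riemann_sum scaler_sumr -big_split /=; apply: eq_bigr => i _.
by rewrite scalerDr !scalerA mulrC.
Qed.

Lemma is_integral_eq a b G G' I : a <= b ->
  (forall t u, a <= t <= b -> Cinf u -> G t u = G' t u) ->
  is_integral G a b I -> is_integral G' a b I.
Proof.
move=> ab h hI; have FM := mesh_filter_proper ab; apply: (cvg_LCinf_eq _ _ hI) => //.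
apply: filterS (mesh_near a b) => p hp u hu; apply: eq_bigr => i _.
by rewrite h //; exact: mesh_tag hp _.
Qed.

Lemma improper_lin (c : C) a G G' I I' :
  is_improper_integral G a I -> is_improper_integral G' a I' ->
  is_improper_integral (fun t u => c *: G t u + G' t u) a (fun u => c *: I u + I' u).
Proof.
move=> [J [hJ cJ]] [J' [hJ' cJ']]; exists (fun b u => c *: J b u + J' b u); split.
  by move=> b ab; apply: is_integral_lin => //; [exact: hJ|exact: hJ'].
exact: cvg_LCinf_lin.
Qed.

Lemma improper_eq a G G' I :
  (forall t u, a <= t -> Cinf u -> G t u = G' t u) ->
  is_improper_integral G a I -> is_improper_integral G' a I.
Proof.
move=> h [J [hJ cJ]]; exists J; split=> // b ab.
by apply: is_integral_eq (hJ b ab) => // t u /andP[at_ _]; exact: h.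
Qed.

Section Compose.
Variable Q : T -> T.
Hypotheses (Q_L : LCinf Q) (Q_dom : sn_dominated Q).

Lemma is_integral_comp a b G G' I I' : a <= b ->
  (forall t u, a <= t <= b -> Cinf u -> Cinf (G t u) /\ Q (G t u) = G' t u) ->
  is_integral G a b I -> is_integral G' a b I' -> forall u, Cinf u -> Q (I u) = I' u.
Proof.
move=> ab h h1 h2 u hu; have FM := mesh_filter_proper ab.
apply: (cvg_LCinf_comp h1 h2) => //; apply: filterS (mesh_near a b) => p hp.
have [_ QL _] := Q_L.
have Q0 : Q 0 = 0 by have := LCinf_scale 0 Q_L (Cinf0 T); rewrite !scale0r.
suff [] : Cinf (riemann_sum G p u) /\ Q (riemann_sum G p u) = riemann_sum G' p u by [].
rewrite /riemann_sum; elim/big_rec2: _ => [|i v v' _ [c1 c2]]; first by split; [exact: Cinf0|].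
have [h3 h4] := h _ _ (mesh_tag hp i) hu.
by split; [exact: Cinf_lin|rewrite QL // h4 c2].
Qed.

Lemma improper_comp a G G' I I' :
  (forall t u, a <= t -> Cinf u -> Cinf (G t u) /\ Q (G t u) = G' t u) ->
  is_improper_integral G a I -> is_improper_integral G' a I' ->
  forall u, Cinf u -> Q (I u) = I' u.
Proof.
move=> h [J [hJ cJ]] [J' [hJ' cJ']] u hu.
apply: (cvg_LCinf_comp cJ cJ') => //; exists a; split; first exact: num_real.
move=> b /ltW ab; apply: (is_integral_comp ab _ (hJ b ab) (hJ' b ab)) => //.
by move=> t v /andP[at_ _]; exact: h.
Qed.

End Compose.

Section Contour.
Variables (phi r : R).
Implicit Types (H : R -> R -> T -> T).

Lemma two_pi_le : phi - 2 * pi <= phi.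
Proof. by rewrite gerBl mulr_ge0 // pi_ge0. Qed.

Definition on_contour (Pr : R -> R -> Prop) :=
  [/\ forall t, r <= t -> Pr t phi, forall x, phi - 2 * pi <= x <= phi -> Pr r x &
      forall t, r <= t -> Pr t (phi - 2 * pi)].

Lemma contour_lin (c : C) H H' I I' :
  is_contour_integral phi r H I -> is_contour_integral phi r H' I' ->
  is_contour_integral phi r (fun t x u => c *: H t x u + H' t x u) (fun u => c *: I u + I' u).
Proof.
have dist (z : C) (y y' : T) : c *: (z *: y) + z *: y' = z *: (c *: y + y').
  by rewrite scalerDr !scalerA mulrC.
move=> [A [B [D [a1 a2 a3 a4]]]] [A' [B' [D' [b1 b2 b3 b4]]]].
exists (fun u => c *: A u + A' u), (fun u => c *: B u + B' u), (fun u => c *: D u + D' u).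
split.
- by apply: improper_eq (improper_lin c a1 b1) => t u _ _; exact: dist.
- by apply: is_integral_eq (is_integral_lin c two_pi_le a2 b2) => [|t u _ _];
    [exact: two_pi_le|exact: dist].
- by apply: improper_eq (improper_lin c a3 b3) => t u _ _; exact: dist.
- move=> u hu; rewrite a4 // b4 // !scalerDr !scalerN !opprD.
  by rewrite addrACA; congr (_ + _); rewrite addrACA.
Qed.

Lemma contour_eq H H' I :
  on_contour (fun t x => forall u, Cinf u -> H t x u = H' t x u) ->
  is_contour_integral phi r H I -> is_contour_integral phi r H' I.
Proof.
move=> [h1 h2 h3] [A [B [D [a1 a2 a3 a4]]]]; exists A, B, D; split=> //.
- by apply: improper_eq a1 => t u rt hu; rewrite h1.
- by apply: is_integral_eq two_pi_le _ a2 => t u rt hu; rewrite h2.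
- by apply: improper_eq a3 => t u rt hu; rewrite h3.
Qed.

Lemma contour_comp Q H H' I I' : LCinf Q -> sn_dominated Q ->
  on_contour (fun t x => forall u, Cinf u -> Cinf (H t x u) /\ Q (H t x u) = H' t x u) ->
  is_contour_integral phi r H I -> is_contour_integral phi r H' I' ->
  forall u, Cinf u -> Q (I u) = I' u.
Proof.
move=> QL Qd [h1 h2 h3] [A [B [D [a1 a2 a3 a4]]]] [A' [B' [D' [b1 b2 b3 b4]]]] u hu.
have [_ Q2 _] := QL.
have QZ (z : C) v : Cinf v -> Q (z *: v) = z *: Q v := LCinf_scale z QL.
have lim_C (I0 : Type) (F : set_system I0) S L v : cvg_LCinf F S L -> Cinf v -> Cinf (L v).
  by move=> [_ [L1 _ _] _]; exact: L1.
have CA : Cinf (A u) by have [J [_ cJ]] := a1; exact: lim_C cJ hu.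
have CB : Cinf (B u) by exact: lim_C a2 hu.
have CD : Cinf (D u) by have [J [_ cJ]] := a3; exact: lim_C cJ hu.
have e1 : Q (A u) = A' u.
  apply: (improper_comp QL Qd _ a1 b1) => // t v rt hv; have [c1 <-] := h1 t rt v hv.
  by split; [exact: CinfZ|rewrite QZ].
have e2 : Q (B u) = B' u.
  apply: (is_integral_comp QL Qd two_pi_le _ a2 b2) => // t v rt hv; have [c1 <-] := h2 t rt v hv.
  by split; [exact: CinfZ|rewrite QZ].
have e3 : Q (D u) = D' u.
  apply: (improper_comp QL Qd _ a3 b3) => // t v rt hv; have [c1 <-] := h3 t rt v hv.
  by split; [exact: CinfZ|rewrite QZ].
have QN v : Cinf v -> Q (- v) = - Q v by move=> hv; rewrite -scaleN1r QZ // scaleN1r.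
have QD v v' : Cinf v -> Cinf v' -> Q (v + v') = Q v + Q v'.
  by move=> hv hv'; rewrite -{1}[v]scale1r Q2 // scale1r.
have CNA := CinfN CA; have CNB := CinfN CB.
rewrite (a4 u hu) (b4 u hu) -e1 -e2 -e3 (QD _ _ (CinfD CNA CNB) CD) (QD _ _ CNA CNB).
by rewrite (QN _ CA) (QN _ CB).
Qed.

Lemma contour_uniq H H' I I' :
  on_contour (fun t x => forall u, Cinf u -> Cinf (H t x u) /\ H t x u = H' t x u) ->
  is_contour_integral phi r H I -> is_contour_integral phi r H' I' ->
  forall u, Cinf u -> I u = I' u.
Proof.
move=> h h1 h2 u hu; have [i1 i2] := LCinf_id T.
exact: (contour_comp i1 i2 h h1 h2).
Qed.

Hypothesis r0 : 0 < r.

Lemma nrm_arc x : nrm ('i * polar r x) = r.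
Proof. by rewrite nrm_mul nrm_polar gtr0_norm // /nrm normc_def /= expr0n expr1n add0r sqrtr1 mul1r. Qed.

(** In the final constant each ray contributes [8 r ^ (- 1/2)] and the circle twice its angle
    [2 pi]; the [r^-1] in the bound on the circle cancels the speed [r] of its parametrization. *)
Lemma contour_exists H :
  fam r (fun t => H t phi) -> fam (phi - 2 * pi) (fun x => H r x) ->
  fam r (fun t => H t (phi - 2 * pi)) ->
  (forall s, exists s' M, 0 <= M /\ forall t u, r <= t -> Cinf u ->
     sn s (H t phi u) <= M * sn s' u * t `^ (- (3 / 2))) ->
  (forall s, exists s' M, 0 <= M /\ forall t u, r <= t -> Cinf u ->
     sn s (H t (phi - 2 * pi) u) <= M * sn s' u * t `^ (- (3 / 2))) ->
  exists2 I, is_contour_integral phi r H I &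
    LCinf I /\ forall u k B, Cinf u -> 0 <= B ->
      (forall t, r <= t -> nrm (coef (H t phi u) k) <= B * t `^ (- (3 / 2))) ->
      (forall x, phi - 2 * pi <= x <= phi -> nrm (coef (H r x u) k) <= r^-1 * B) ->
      (forall t, r <= t -> nrm (coef (H t (phi - 2 * pi) u) k) <= B * t `^ (- (3 / 2))) ->
      nrm (coef (I u) k) <= (16 * r `^ (- 2^-1) + 4 * pi) * B.
Proof.
move=> f1 f2 f3 d1 d3.
have ray1 (z : T) : nrm (polar 1 phi *: z) = nrm z.
  by rewrite nrmZ nrm_polar normr1 mul1r.
have dec Hr : fam r Hr -> (forall s, exists s' M, 0 <= M /\ forall t u, r <= t -> Cinf u ->
     sn s (Hr t u) <= M * sn s' u * t `^ (- (3 / 2))) ->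
   forall s, exists s' M, 0 <= M /\ forall t u, r <= t -> Cinf u ->
     sn s (polar 1 phi *: Hr t u) <= M * sn s' u * t `^ (- (3 / 2)).
  move=> [g1 _ _] d s; have [s' [M [M0 hM]]] := d s; exists s', M; split=> // t u rt hu.
  by rewrite snZ ?nrm_polar ?normr1 ?mul1r; [exact: hM|exact/Cinf_wfin/g1].
have [A cA bA] := improper_exists r0 (fam_weight (loc_lip_cst (polar 1 phi) r) f1) (dec _ f1 d1).
have [D cD bD] := improper_exists r0 (fam_weight (loc_lip_cst (polar 1 phi) r) f3) (dec _ f3 d3).
have la : loc_lip (fun x => 'i * polar r x) (phi - 2 * pi).
  apply: loc_lipM (loc_lip_cst _ _) _.
  by apply: loc_lip_eq (loc_lip_cpow_arc 1 r _) => x _; rewrite polar_cpow.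
have fB := fam_weight la f2; have [J [hJ _]] := integral_exists fB.
have cB := hJ phi two_pi_le; set B := J phi in cB.
have LA : LCinf A by have [? [_ []]] := cA.
have LD : LCinf D by have [? [_ []]] := cD.
have LB : LCinf B by have [] := cB.
exists (fun u => - A u - B u + D u); first by exists A, B, D.
split.
  apply: LCinf_eq (LCinf_lin (-1) (LCinf_lin 1 LA LB) LD) => u _.
  by rewrite scale1r scaleN1r opprD.
move=> u k M hu M0 h1 h2 h3.
have e1 : nrm (coef (A u) k) <= 8 * M * r `^ (- 2^-1).
  apply: bA => // t rt; rewrite coefZ nrm_mul nrm_polar normr1 mul1r; exact: h1.
have e3 : nrm (coef (D u) k) <= 8 * M * r `^ (- 2^-1).
  apply: bD => // t rt; rewrite coefZ nrm_mul nrm_polar normr1 mul1r; exact: h3.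
have e2 : nrm (coef (B u) k) <= 2 * (phi - (phi - 2 * pi)) * M.
  apply: (integral_bound fB cB two_pi_le hu) => x xp.
  rewrite coefZ nrm_mul nrm_arc; apply: le_trans (ler_wpM2l (ltW r0) (h2 x xp)) _.
  by rewrite mulrA mulfV ?mul1r // gt_eqF.
rewrite coefD coefB coefN; apply: le_trans (nrmD _ _) _.
apply: (@le_trans _ _ (8 * M * r `^ (- 2^-1) + 2 * (phi - (phi - 2 * pi)) * M +
   8 * M * r `^ (- 2^-1))).
  by apply: lerD => //; apply: le_trans (nrmB _ _) _; rewrite nrmN lerD.
by rewrite le_eqVlt; apply/orP; left; apply/eqP; ring.
Qed.

End Contour.

End Improper.

(** * Contour integrals of the resolvent *)

Section ResolventFamilies.
Variables (R : realType) (n : nat) (theta : 'M[R]_n) (T : ncTorus theta).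
Local Notation C := R[i].
Implicit Types (s e a b x y t : R) (u v f : T) (G : R -> T -> T) (lam mu : C).

Definition sn_operator (Q : T -> T) :=
  [/\ forall u, Cinf u -> Cinf (Q u),
      forall (c : C) u v, Cinf u -> Cinf v -> Q (c *: u + v) = c *: Q u + Q v &
      sn_dominated Q].

Lemma LCinf_sn_operator Q : sn_operator Q -> LCinf Q.
Proof. by move=> [h1 h2 h3]; exact: LCinf_dominated. Qed.

Lemma sn_operator_id : sn_operator id.
Proof. by split=> //; case: (LCinf_id T). Qed.

Lemma fam_precomp a G Q : sn_operator Q -> fam a G -> fam a (fun t u => G t (Q u)).
Proof.
move=> [q1 q2 q3] [g1 g2 g3]; split.
- by move=> x u ax hu; apply: g1 => //; exact: q1.
- by move=> x c u v ax hu hv; rewrite q2 // g2 //; exact: q1.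
move=> s b; have [s1 [K [K0 h1 h2]]] := g3 s b; have [s2 [K' [K'0 h']]] := q3 s1.
exists s2, (K * K'); split; first exact: mulr_ge0.
  move=> x u xb hu; apply: le_trans (h1 x (Q u) xb (q1 u hu)) _.
  by rewrite -mulrA ler_wpM2l // h'.
move=> x y u xb yb hu; apply: le_trans (h2 x y (Q u) xb yb (q1 u hu)) _.
by rewrite ler_wpM2r // -mulrA ler_wpM2l // h'.
Qed.

Section Resolvents.
Variables (w : R) (P : T -> T).
Hypothesis P_op : sn_operator P.
Local Notation Rs := (resolvent w P).

Definition regular lam := lam != 0 /\ forall f, Cinf f ->
  [/\ Cinf (Rs lam f), P (Rs lam f) - lam *: Rs lam f = f & Rs lam (P f - lam *: f) = f].

Lemma resolvent_lin lam (c : C) u v : regular lam -> Cinf u -> Cinf v ->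
  Rs lam (c *: u + v) = c *: Rs lam u + Rs lam v.
Proof.
move=> [_ h] hu hv; have [u1 u2 _] := h u hu; have [v1 v2 _] := h v hv.
have [_ PL _] := P_op.
have hc := Cinf_lin c u1 v1; have [_ _] := h _ hc; rewrite PL // => <-; congr (Rs lam _).
transitivity (c *: (P (Rs lam u) - lam *: Rs lam u) + (P (Rs lam v) - lam *: Rs lam v)).
  by rewrite u2 v2.
by rewrite scalerBr (scalerDr lam (c *: _)) opprD !scalerA (mulrC c) addrACA.
Qed.

Lemma resolventE lam u : regular lam -> Cinf u -> Rs lam (P u) = u + lam *: Rs lam u.
Proof.
move=> hl hu; have [_ h] := hl; have [u1 u2 u3] := h u hu; have [PC _ _] := P_op.
have E : P u = lam *: u + (P u - lam *: u) by rewrite addrC subrK.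
rewrite {1}E resolvent_lin //; last by apply: CinfB; [exact: PC|exact: CinfZ].
by rewrite u3 addrC.
Qed.

Lemma resolvent_comm lam u : regular lam -> Cinf u -> P (Rs lam u) = Rs lam (P u).
Proof.
move=> hl hu; rewrite resolventE //; have [_ h] := hl; have [_ E _] := h u hu.
by rewrite -{2}E subrK.
Qed.

Lemma resolvent_identity lam mu u : regular lam -> regular mu -> Cinf u ->
  Rs lam u - Rs mu u = (lam - mu) *: Rs lam (Rs mu u).
Proof.
move=> hl hm hu; have [_ h] := hm; have [v1 v2 _] := h u hu; have [_ hL] := hl.
have [_ _ v3] := hL _ v1; have [PC _ _] := P_op.
have E : u = (lam - mu) *: Rs mu u + (P (Rs mu u) - lam *: Rs mu u).
  by rewrite -{1}v2 scalerBl [RHS]addrC addrA subrK.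
rewrite {1}E resolvent_lin //; last by apply: CinfB; [exact: PC|exact: CinfZ].
by rewrite v3 addrK.
Qed.

(** The Lipschitz bound is the resolvent identity; applying the bound on the resolvent twice
    explains the second index [s2]. *)
Lemma fam_resolvent (gam : R -> C) a : (forall x, a <= x -> regular (gam x)) ->
  loc_lip gam a ->
  (forall s b, exists s' K, 0 <= K /\ forall x, a <= x <= b -> forall f, Cinf f ->
     sn s (Rs (gam x) f) <= K * sn s' f) ->
  fam a (fun x u => Rs (gam x) u).
Proof.
move=> hreg hlip hbd; split.
- by move=> x u ax hu; have [_ h] := hreg x ax; have [] := h u hu.
- by move=> x c u v ax hu hv; apply: resolvent_lin => //; exact: hreg.
move=> s b; have [s1 [K1 [K10 h1]]] := hbd s b; have [s2 [K2 [K20 h2]]] := hbd s1 b.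
have [L L0 [_ hL]] := hlip b.
exists (Num.max s1 s2), (K1 + L * (K1 * K2)); split; first by rewrite addr_ge0 ?mulr_ge0.
  move=> x u xb hu; apply: le_trans (h1 x xb u hu) _; apply: ler_pM => //.
  - exact: sn_ge0.
  - by rewrite lerDl !mulr_ge0.
  - by apply: le_sn; [exact: Cinf_wfin|rewrite le_max lexx].
move=> x y u xb yb hu; have /andP[ax _] := xb; have /andP[ay _] := yb.
have [_ hy] := hreg y ay; have [cy _ _] := hy u hu.
have [_ hx] := hreg x ax; have [cx _ _] := hx _ cy.
rewrite resolvent_identity; [|exact: hreg|exact: hreg|exact: hu].
rewrite snZ; last exact: Cinf_wfin.
have e2 := le_trans (h1 x xb _ cy) (ler_wpM2l K10 (h2 y yb u hu)).
apply: le_trans (ler_pM (nrm_ge0 _) (sn_ge0 _ _) (hL x y xb yb) e2) _.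
have e3 : sn s2 u <= sn (Num.max s1 s2) u.
  by apply: le_sn; [exact: Cinf_wfin|rewrite le_max lexx orbT].
rewrite mulrAC; apply: ler_wpM2r => //.
rewrite !mulrA; apply: ler_pM; rewrite ?mulr_ge0 ?sn_ge0 //.
by rewrite -!mulrA lerDr.
Qed.

Section ContourFamilies.
Variables (phi r : R).
Hypothesis r0 : 0 < r.
Hypothesis ray_regular : forall t, r <= t -> regular (polar t phi).
Hypothesis arc_regular : forall x, regular (polar r x).
Hypothesis ray_bound : forall s, exists s' K, 0 <= K /\ forall t, r <= t ->
  forall f, Cinf f -> sn s (Rs (polar t phi) f) <= K * sn s' f.
Hypothesis arc_bound : forall s b, exists s' K, 0 <= K /\
  forall x, phi - 2 * pi <= x <= b -> forall f, Cinf f ->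
  sn s (Rs (polar r x) f) <= K * sn s' f.

Lemma polar_2pi t : polar t (phi - 2 * pi) = polar t phi.
Proof.
have -> : phi = phi - 2 * pi + pi *+ 2 by rewrite mulr_natl subrK.
by rewrite /polar /cexp /= cosD2pi sinD2pi mulr_natl addrK.
Qed.

Lemma fam_ray : fam r (fun t u => Rs (polar t phi) u).
Proof.
apply: fam_resolvent.
- exact: ray_regular.
- apply: loc_lip_eq (loc_lip_cpow_ray 1 phi r0) => t rt.
  by rewrite polar_cpow //; exact: lt_le_trans rt.
move=> s b; have [s' [K [K0 hK]]] := ray_bound s; exists s', K; split=> // x /andP[rx _].
exact: hK.
Qed.

Lemma fam_arc : fam (phi - 2 * pi) (fun x u => Rs (polar r x) u).
Proof.
apply: fam_resolvent => //.
by apply: loc_lip_eq (loc_lip_cpow_arc 1 r _) => t _; rewrite polar_cpow.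
Qed.

(* [(P - l)^-1 f = l^-1 ((P - l)^-1 (P f) - f)]. *)
Lemma ray_decay s : exists s' K, 0 <= K /\ forall t, r <= t ->
  forall f, Cinf f -> sn s (Rs (polar t phi) f) <= K * sn s' f * t^-1.
Proof.
have [PC _ Pd] := P_op; have [s1 [K1 [K10 h1]]] := ray_bound s.
have [s2 [K2 [K20 h2]]] := Pd s1.
exists (Num.max s s2), (1 + K1 * K2); split; first by rewrite addr_ge0 ?mulr_ge0.
move=> t rt f hf; have t0 : 0 < t := lt_le_trans r0 rt.
have hreg := ray_regular rt; have [_ h] := hreg; have [c1 _ _] := h f hf.
have [_ hp] := hreg; have [cp _ _] := hp _ (PC f hf).
rewrite ler_pdivlMr // mulrC.
have -> : t * sn s (Rs (polar t phi) f) = sn s (polar t phi *: Rs (polar t phi) f).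
  by rewrite snZ ?nrm_polar ?gtr0_norm //; exact: Cinf_wfin.
have -> : polar t phi *: Rs (polar t phi) f = Rs (polar t phi) (P f) - f.
  by rewrite resolventE // addrC addKr.
apply: le_trans (snB s (Cinf_wfin cp) (Cinf_wfin hf)) _.
have e1 := le_trans (h1 t rt _ (PC f hf)) (ler_wpM2l K10 (h2 f hf)).
have e3 : sn s2 f <= sn (Num.max s s2) f.
  by apply: le_sn; [exact: Cinf_wfin|rewrite le_max lexx orbT].
have e4 : sn s f <= sn (Num.max s s2) f.
  by apply: le_sn; [exact: Cinf_wfin|rewrite le_max lexx].
rewrite addrC mulrDl mul1r lerD // (le_trans e1) // mulrA ler_wpM2l //.
exact: mulr_ge0.
Qed.

(* Together with the decay [1 / t] of the resolvent, the exponent [- 1 / 2] makes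
   the integrals along the rays absolutely convergent. *)
Definition weight (m : R -> R -> C) B :=
  [/\ 0 <= B, loc_lip (fun t => m t phi) r, loc_lip (fun x => m r x) (phi - 2 * pi),
      loc_lip (fun t => m t (phi - 2 * pi)) r &
      forall t x, r <= t -> phi - 2 * pi <= x <= phi -> nrm (m t x) <= B * t `^ (- 2^-1)].

Section PreComposed.
(** [Q] is [P] in the integrands of the logarithm, and the identity in those that define the complex
    powers. *)
Variable Q : T -> T.
Hypothesis Q_op : sn_operator Q.
Local Notation integrand m := (fun t x u => m t x *: Rs (polar t x) (Q u)).

Lemma powR_half t : 0 < t -> t `^ (- 2^-1) * t^-1 = t `^ (- (3 / 2)).
Proof.
move=> t0; rewrite -(powRr1 (ltW t0)) -powRN powRr1 ?(ltW t0) //.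
rewrite -powRD ?(gt_eqF t0) ?implybT //; congr (_ `^ _); lra.
Qed.

Lemma weighted_decay s : exists s' K, 0 <= K /\ forall (m : R -> C) B, 0 <= B ->
  (forall t, r <= t -> nrm (m t) <= B * t `^ (- 2^-1)) -> forall t u, r <= t -> Cinf u ->
  sn s (m t *: Rs (polar t phi) (Q u)) <= K * B * sn s' u * t `^ (- (3 / 2)).
Proof.
have [q1 q2 q3] := Q_op; have [s1 [K1 [K10 h1]]] := ray_decay s.
have [s2 [K2 [K20 h2]]] := q3 s1; exists s2, (K1 * K2); split; first exact: mulr_ge0.
move=> m B B0 hm t u rt hu; have t0 : 0 < t := lt_le_trans r0 rt.
have cq := q1 u hu; have [_ h] := ray_regular rt; have [cr _ _] := h _ cq.
rewrite snZ; last exact: Cinf_wfin.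
have e1 : sn s (Rs (polar t phi) (Q u)) <= K1 * (K2 * sn s2 u) * t^-1.
  apply: le_trans (h1 t rt _ cq) _; rewrite ler_wpM2r ?invr_ge0 ?(ltW t0) //.
  by rewrite ler_wpM2l // h2.
apply: le_trans (ler_pM (nrm_ge0 _) (sn_ge0 _ _) (hm t rt) e1) _.
rewrite -powR_half // le_eqVlt; apply/orP; left; apply/eqP; ring.
Qed.

Lemma on_contour_regular (p : R -> R -> Prop) :
  (forall t x, r <= t -> phi - 2 * pi <= x <= phi -> regular (polar t x) -> p t x) ->
  on_contour phi r p.
Proof.
move=> h; have pp := two_pi_le phi; split.
- by move=> t rt; apply: h => //; [rewrite pp lexx|exact: ray_regular].
- by move=> x xp; apply: h.
- by move=> t rt; apply: h => //; [rewrite pp lexx|rewrite polar_2pi; exact: ray_regular].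
Qed.

Lemma regular_Cinf lam u : regular lam -> Cinf u -> Cinf (Rs lam (Q u)).
Proof. by have [q1 _ _] := Q_op; move=> [_ h] hu; have [] := h _ (q1 u hu). Qed.

Lemma contour_weight_exists m B : weight m B ->
  exists2 I, is_contour_integral phi r (integrand m) I &
    LCinf I /\ forall u k M, Cinf u -> 0 <= M ->
      (forall t, r <= t -> nrm (coef (integrand m t phi u) k) <= M * t `^ (- (3 / 2))) ->
      (forall x, phi - 2 * pi <= x <= phi -> nrm (coef (integrand m r x u) k) <= r^-1 * M) ->
      (forall t, r <= t ->
         nrm (coef (integrand m t (phi - 2 * pi) u) k) <= M * t `^ (- (3 / 2))) ->
      nrm (coef (I u) k) <= (16 * r `^ (- 2^-1) + 4 * pi) * M.
Proof.
move=> [B0 m1 m2 m3 m4].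
have F1 := fam_precomp Q_op fam_ray; have F2 := fam_precomp Q_op fam_arc.
have pp := two_pi_le phi.
apply: (@contour_exists _ _ _ T phi r r0 (integrand m)).
- exact: fam_weight m1 F1.
- exact: fam_weight m2 F2.
- under eq_fun do rewrite polar_2pi; exact: fam_weight m3 F1.
- move=> s; have [s' [K [K0 hK]]] := weighted_decay s; exists s', (K * B).
  split; first exact: mulr_ge0.
  by move=> t u rt hu; apply: (hK (fun t => m t phi)) => // t' rt'; apply: m4; rewrite ?lexx ?pp.
- move=> s; have [s' [K [K0 hK]]] := weighted_decay s; exists s', (K * B).
  split; first exact: mulr_ge0.
  move=> t u rt hu; rewrite polar_2pi; apply: (hK (fun t => m t (phi - 2 * pi))) => // t' rt'.
  by apply: m4; rewrite ?lexx ?pp.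
Qed.

Lemma contour_weight m B : weight m B -> exists I, is_contour_integral phi r (integrand m) I.
Proof. by move=> /contour_weight_exists[I hI _]; exists I. Qed.

(** Here [s'] and [K] do not depend on the weight, and the bound is linear in its constant [B]. For
    [quotient_weight h] this constant is proportional to [|h|], whence the convergence as [h] tends
    to 0. *)
Lemma contour_weight_bound s : exists s' K, 0 <= K /\ forall m B I, weight m B ->
  is_contour_integral phi r (integrand m) I -> LCinf I /\ forall u k, Cinf u ->
    jp s k * nrm (coef (I u) k) <= K * B * sn s' u.
Proof.
have [q1 q2 q3] := Q_op; have pp := two_pi_le phi.
have F1 := fam_precomp Q_op fam_ray; have F2 := fam_precomp Q_op fam_arc.
have [s1 [K1 [K10 h1]]] := weighted_decay s.
have [s2 [K2 [K20 h2]]] := arc_bound s phi; have [s3 [K3 [K30 h3]]] := q3 s2.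
(* [K1] serves the rays. On the circle the weight is bounded by its value at [r], and the factor [r]
   compensates the [r^-1] required there. *)
pose S := Num.max s1 s3; pose D := K1 + r * r `^ (- 2^-1) * (K2 * K3).
have D0 : 0 <= D by rewrite addr_ge0 // !mulr_ge0 ?powR_ge0 // ltW.
pose c0 := 16 * r `^ (- 2^-1) + 4 * pi.
have c00 : 0 <= c0 by rewrite addr_ge0 ?mulr_ge0 ?powR_ge0 ?pi_ge0.
exists S, (c0 * D); split; first exact: mulr_ge0.
move=> m B I hm hI; have [I' hI' [LI' bI']] := contour_weight_exists hm.
have [B0 m1 m2 m3 m4] := hm.
have E : forall u, Cinf u -> I u = I' u.
  apply: contour_uniq hI hI'; apply: on_contour_regular => t x _ _ hreg u hu; split=> //.
  by apply/CinfZ/regular_Cinf.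
split; first by apply: LCinf_eq LI' => u hu; rewrite E.
move=> u k hu; rewrite E //.
have S1 : sn s1 u <= sn S u by apply: le_sn; [exact: Cinf_wfin|rewrite le_max lexx].
have S3 : sn s3 u <= sn S u by apply: le_sn; [exact: Cinf_wfin|rewrite le_max lexx orbT].
have -> : c0 * D * B * sn S u = jp s k * (c0 * (D * B * sn S u / jp s k)).
  by field; rewrite gt_eqF // jp_gt0.
rewrite ler_wpM2l ?jp_ge0 //.
have coord v : Cinf v -> nrm (coef v k) <= sn s v / jp s k.
  by move=> hv; apply: jp_scale; apply: sn_coord; exact: Cinf_wfin.
have KD : K1 * B * sn s1 u <= D * B * sn S u.
  apply: ler_pM; rewrite ?mulr_ge0 ?sn_ge0 // ler_wpM2r //.
  by rewrite lerDl !mulr_ge0 ?powR_ge0 // ltW.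
have ja t v : r <= t -> sn s v <= K1 * B * sn s1 u * t `^ (- (3 / 2)) ->
    sn s v / jp s k <= D * B * sn S u / jp s k * t `^ (- (3 / 2)).
  move=> rt h; rewrite mulrAC ler_wpM2r ?invr_ge0 ?jp_ge0 // (le_trans h) //.
  by rewrite ler_wpM2r ?powR_ge0.
have cray t : r <= t -> Cinf (Rs (polar t phi) (Q u)).
  by move=> rt; have [_ h] := ray_regular rt; have [] := h _ (q1 u hu).
apply: bI' => //.
- by rewrite divr_ge0 ?jp_ge0 // mulr_ge0 ?sn_ge0 // mulr_ge0.
- move=> t rt; apply: le_trans (coord _ (CinfZ _ (cray t rt))) _; apply: ja => //.
  by apply: (h1 (fun t => m t phi)) => // t' rt'; apply: m4; rewrite ?lexx ?pp.
- move=> x xp; have [_ h] := arc_regular x; have [cx _ _] := h _ (q1 u hu).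
  apply: le_trans (coord _ (CinfZ _ cx)) _; rewrite mulrA ler_wpM2r ?invr_ge0 ?jp_ge0 //.
  rewrite snZ; last exact: Cinf_wfin.
  have e1 := le_trans (h2 x xp _ (q1 u hu)) (ler_wpM2l K20 (h3 u hu)).
  apply: le_trans (ler_pM (nrm_ge0 _) (sn_ge0 _ _) (m4 r x (lexx r) xp) e1) _.
  apply: (@le_trans _ _ (B * r `^ (- 2^-1) * (K2 * (K3 * sn S u)))).
    by rewrite ler_wpM2l ?mulr_ge0 ?powR_ge0 // ler_wpM2l // ler_wpM2l.
  have -> : B * r `^ (- 2^-1) * (K2 * (K3 * sn S u)) =
    r^-1 * (r * r `^ (- 2^-1) * (K2 * K3) * B * sn S u) by field; rewrite gt_eqF.
  rewrite ler_wpM2l ?invr_ge0 ?(ltW r0) // ler_wpM2r ?sn_ge0 // ler_wpM2r //.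
  by rewrite lerDr.
- move=> t rt; rewrite polar_2pi; apply: le_trans (coord _ (CinfZ _ (cray t rt))) _.
  apply: ja => //; apply: (h1 (fun t => m t (phi - 2 * pi))) => // t' rt'.
  by apply: m4; rewrite ?lexx ?pp.
Qed.

End PreComposed.

End ContourFamilies.

End Resolvents.

End ResolventFamilies.

(** * Scalar weights: powers and logarithm on the contour *)

Section Scalars.
Variables (R : realType).
Local Notation C := R[i].
Implicit Types (h z : C) (a b e t x y : R).

Lemma cexpD z z' : cexp (z + z') = cexp z * cexp z'.
Proof.
case: z z' => p q [p' q']; rewrite /cexp /= expRD cosD sinD.
by apply/eqP; rewrite eq_complex /=; apply/andP; split; apply/eqP; ring.
Qed.

Lemma cpowD z z' t x : cpow (z + z') t x = cpow z t x * cpow z' t x.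
Proof. by rewrite /cpow mulrDl cexpD. Qed.

Lemma cpow0 t x : cpow 0 t x = 1 :> C.
Proof. by rewrite /cpow mul0r /cexp /= expR0 cos0 sin0 mul1r. Qed.

Lemma nrm_cpowN1 t x : 0 < t -> nrm (cpow (- 1) t x : C) = t^-1.
Proof.
move=> t0; rewrite /cpow nrm_cexp /clog mulN1r /= expRN lnK ?posrE //.
Qed.

Lemma polarV t x : 0 < t -> (polar t x)^-1 = cpow (- 1) t x :> C.
Proof.
move=> t0; have : cpow (- 1) t x * polar t x = 1 :> C.
  by rewrite polar_cpow // -cpowD addNr cpow0.
have p0 : polar t x != 0 by apply: polar_neq0.
by move=> E; apply: (mulIf p0); rewrite mulVf // E.
Qed.

Lemma nrm_cexp_le z : nrm (cexp z) <= expR (nrm z).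
Proof. by rewrite nrm_cexp ler_expR (le_trans (ler_norm _)) // nrm_Re. Qed.

Lemma mean_primitiveZ (f F : R -> C) a z : z != 0 -> mean_primitive f F a ->
  mean_primitive (fun t => z * f t) (fun t => z * F t) a.
Proof.
move=> z0 hF x y c e ax xy h; have nz : 0 < nrm z.
  by rewrite lt_neqAle nrm_ge0 andbT eq_sym; apply: contra_neq z0 => /nrm_eq0.
have E : z * F y - z * F x - (y - x)%:C * c = z * (F y - F x - (y - x)%:C * (c / z)).
  by field.
rewrite E nrm_mul mulrC -ler_pdivlMr // -(mulrA _ e); apply: hF => // t txy.
rewrite ler_pdivlMr // mulrC -nrm_mul mulrBr (mulrC z (c / z)) divfK //.
exact: h.
Qed.

Lemma mean_primitive_cexp (g dg : R -> R) a (c0 c1 : C) :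
  (forall t, a <= t -> is_derive t 1 g (dg t)) ->
  mean_primitive (fun t => c1 * (dg t)%:C * cexp (c0 + c1 * (g t)%:C))
    (fun t => cexp (c0 + c1 * (g t)%:C)) a.
Proof.
move=> hd; have -> : (fun t => cexp (c0 + c1 * (g t)%:C)) =
    fun t => complex.Re (cexp (c0 + c1 * (g t)%:C)) +i* complex.Im (cexp (c0 + c1 * (g t)%:C)).
  by apply/funext => t; case: (cexp _).
by apply: mean_primitive_derive => t at_; have [] := derive_cexp c0 c1 (hd t at_).
Qed.

(** The function [exp (t z)] is a primitive of [z exp (t z)] on [[0, 1]]: the mean inequality bounds
    first its distance to 1, then the Taylor remainder. Each use costs a factor 2. *)
Lemma cexp_taylor z : nrm (cexp z - 1 - z) <= 4 * nrm z ^+ 2 * expR (nrm z).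
Proof.
pose F t := cexp (0 + z * t%:C); pose f t := z * 1%:C * F t.
have [d1 _] := id_curve (0 : R).
have hF : mean_primitive f F 0 by exact: (@mean_primitive_cexp id (fun=> 1) 0 0 z d1).
have F0 : F 0 = 1 by rewrite /F mulr0 addr0 /cexp /= expR0 cos0 sin0 mul1r.
have z0 := nrm_ge0 z; have E0 := expR_ge0 (nrm z).
have bF t : 0 <= t <= 1 -> nrm (f t) <= nrm z * expR (nrm z).
  move=> /andP[t0 t1]; rewrite /f mulr1 nrm_mul ler_wpM2l //.
  apply: le_trans (nrm_cexp_le _) _; rewrite ler_expR add0r nrm_mul nrm_real ger0_norm //.
  by rewrite ler_piMr.
have b1 t : 0 <= t <= 1 -> nrm (F t - F 0) <= 2 * (nrm z * expR (nrm z)).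
  move=> /andP[t0 t1]; apply: le_trans (primitive_bound (M := nrm z * expR (nrm z)) hF (lexx 0) t0 _) _.
    by move=> x /andP[x0 xt]; apply: bF; rewrite x0 (le_trans xt).
  by rewrite subr0 ler_wpM2r ?mulr_ge0 // ler_piMr.
have := hF 0 1 z (2 * nrm z ^+ 2 * expR (nrm z)) (lexx 0) ler01.
have F1 : F 1 = cexp z by rewrite /F add0r mulr1.
have E1 : (1 - 0)%:C * z = z by rewrite subr0 mul1r.
rewrite E1 F0 F1 => h; apply: le_trans (h _) _.
  move=> t t01; rewrite /f mulr1 -{2}[z]mulr1 -mulrBr nrm_mul -F0.
  apply: le_trans (ler_wpM2l z0 (b1 t t01)) _.
  by rewrite le_eqVlt; apply/orP; left; apply/eqP; ring.
by rewrite le_eqVlt; apply/orP; left; apply/eqP; ring.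
Qed.

Section Weights.
Variables (phi r : R).
Hypothesis r0 : 0 < r.

(** The constant of [clog_growth]: with [L] the modulus of the logarithm, the squared factor and the
    power, for [|h| <= 1/4], each cost [exp ((1 + L) / 4)]. The inner sum is the additive constant
    of [nrm_clog_le]. *)
Definition growth := 64 * expR ((1 + (2 * `|ln r| + `|phi| + 2 * pi)) / 2).

Lemma growth_ge0 : 0 <= growth. Proof. by rewrite mulr_ge0 ?expR_ge0. Qed.

(** For [t >= r], [|ln t|] is at most [ln t + 2 |ln r|]; without an absolute value on [ln t], the
    bound exponentiates to a power of [t]. *)
Lemma nrm_clog_le t x : r <= t -> phi - 2 * pi <= x <= phi ->
  nrm (clog t x) <= ln t + (2 * `|ln r| + `|phi| + 2 * pi).
Proof.
move=> rt /andP[x1 x2]; have t0 := lt_le_trans r0 rt; have pi0 := pi_ge0 R.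
apply: le_trans (nrm_le_ReIm _) _ => /=.
have h1 : ln r <= ln t by rewrite ler_ln.
have h2 : - ln r <= `|ln r| by rewrite -normrN ler_norm.
have n1 := normr_ge0 (ln r); have n2 := normr_ge0 phi.
have h3 : `|ln t| <= ln t + 2 * `|ln r| by rewrite ler_norml; apply/andP; split; lra.
have h4 : phi <= `|phi| by rewrite ler_norm.
have h5 : - phi <= `|phi| by rewrite -normrN ler_norm.
have h6 : `|x| <= `|phi| + 2 * pi by rewrite ler_norml; apply/andP; split; lra.
lra.
Qed.

(* [y ^ 2 <= 64 exp (y / 4)] turns the logarithmic factors into a power [t ^ (1/2)]. *)
Lemma clog_growth (h : C) t x : nrm h <= 4^-1 -> r <= t -> phi - 2 * pi <= x <= phi ->
  (1 + nrm (clog t x)) ^+ 2 * expR (nrm h * nrm (clog t x)) <= growth * t `^ 2^-1.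
Proof.
move=> hh rt xp; have t0 := lt_le_trans r0 rt.
have := nrm_clog_le rt xp; set A := 2 * _ + _ + _; set L := nrm _ => hL.
have L0 : 0 <= L := nrm_ge0 _.
have h1 : (1 + L) ^+ 2 <= 64 * expR ((1 + L) / 4).
  have e1 : (1 + L) / 8 <= expR ((1 + L) / 8).
    by apply: le_trans (expR_ge1Dx _); rewrite lerDr.
  have e0 : 0 <= (1 + L) / 8 by rewrite divr_ge0 // addr_ge0.
  have -> : (1 + L) / 4 = (1 + L) / 8 + (1 + L) / 8 by lra.
  have := ler_pM e0 e0 e1 e1; rewrite -expRD; lra.
have h2 : expR (nrm h * L) <= expR ((1 + L) / 4).
  rewrite ler_expR (le_trans (ler_wpM2r L0 hh)) //; lra.
apply: le_trans (ler_pM (sqr_ge0 _) (expR_ge0 _) h1 h2) _.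
rewrite -mulrA -expRD /growth -mulrA ler_wpM2l // /powR gt_eqF // -expRD ler_expR.
rewrite -/A; lra.
Qed.

Lemma powR_halfV t : 0 < t -> t `^ 2^-1 * t^-1 = t `^ (- 2^-1).
Proof.
move=> t0; rewrite -{2}(powRr1 (ltW t0)) -powRN -powRD ?(gt_eqF t0) ?implybT //.
by congr (_ `^ _); lra.
Qed.

Lemma nrm_cpow_le h t x : nrm (cpow h t x) <= expR (nrm h * nrm (clog t x)).
Proof. by rewrite -nrm_mul; exact: nrm_cexp_le. Qed.

Lemma weight_cpow h : nrm h <= 4^-1 -> weight phi r (cpow (h - 1)) growth.
Proof.
move=> hh; split; first exact: growth_ge0.
- exact: loc_lip_cpow_ray.
- exact: loc_lip_cpow_arc.
- exact: loc_lip_cpow_ray.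
move=> t x rt xp; have t0 := lt_le_trans r0 rt.
rewrite cpowD nrm_mul nrm_cpowN1 // -powR_halfV // mulrA ler_wpM2r ?invr_ge0 ?(ltW t0) //.
apply: le_trans (clog_growth hh rt xp); apply: le_trans (nrm_cpow_le _ _ _) _.
by rewrite ler_peMl ?expR_ge0 // exprn_ege1 // lerDl nrm_ge0.
Qed.

Definition log_weight t x : C := clog t x * (polar t x)^-1.

Lemma loc_lip_log : [/\ forall y, loc_lip (fun t => log_weight t y) r &
  forall y, loc_lip (fun x => log_weight r x) y].
Proof.
split=> y.
  apply: loc_lipM; first exact: loc_lip_clog_ray.
  apply: loc_lip_eq (loc_lip_cpow_ray (- 1) y r0) => t rt.
  by rewrite polarV //; exact: lt_le_trans rt.
apply: loc_lipM; first exact: loc_lip_clog_arc.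
by apply: loc_lip_eq (loc_lip_cpow_arc (- 1) r y) => x _; rewrite polarV.
Qed.

Lemma weight_log : weight phi r log_weight growth.
Proof.
have [l1 l2] := loc_lip_log; split; [exact: growth_ge0|exact: l1|exact: l2|exact: l1|].
move=> t x rt xp; have t0 := lt_le_trans r0 rt.
rewrite /log_weight polarV // nrm_mul nrm_cpowN1 // -powR_halfV // mulrA.
rewrite ler_wpM2r ?invr_ge0 ?(ltW t0) //.
have h4 : nrm (0 : C) <= 4^-1 by rewrite nrm0 invr_ge0.
apply: le_trans (clog_growth h4 rt xp); rewrite nrm0 mul0r expR0 mulr1.
by have := nrm_ge0 (clog t x); move: (nrm _) => L L0; nra.
Qed.

(** The error of the difference quotient at 0. The exponent [0 - 1] is the form in which [h - 1]
    appears for [h = 0]. *)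
Definition quotient_weight h t x : C :=
  h^-1 * (cpow (h - 1) t x - cpow (0 - 1) t x) - log_weight t x.

Lemma weight_quotient h : h != 0 -> nrm h <= 4^-1 ->
  weight phi r (quotient_weight h) (4 * nrm h * growth).
Proof.
move=> h0 hh; have [l1 l2] := loc_lip_log.
have lN f a : loc_lip f a -> loc_lip (fun x : R => - f x : C) a.
  move=> hf; apply: loc_lip_eq (loc_lipM (loc_lip_cst (- 1) a) hf) => x _.
  by rewrite mulN1r.
have n0 := nrm_ge0 h.
split; first by rewrite !mulr_ge0 // growth_ge0.
- apply/loc_lipD/lN/l1; apply: loc_lipM (loc_lip_cst _ _) _.
  by apply: loc_lipD; [|apply: lN]; exact: loc_lip_cpow_ray.
- apply/loc_lipD/lN/l2; apply: loc_lipM (loc_lip_cst _ _) _.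
  by apply: loc_lipD; [|apply: lN]; exact: loc_lip_cpow_arc.
- apply/loc_lipD/lN/l1; apply: loc_lipM (loc_lip_cst _ _) _.
  by apply: loc_lipD; [|apply: lN]; exact: loc_lip_cpow_ray.
move=> t x rt xp; have t0 := lt_le_trans r0 rt.
have -> : quotient_weight h t x =
    h^-1 * (cexp (h * clog t x) - 1 - h * clog t x) * cpow (- 1) t x.
  rewrite /quotient_weight /log_weight polarV // !cpowD cpow0 -/(cpow h t x).
  by field.
have nh : nrm h != 0 by apply: contra_neq h0 => /nrm_eq0.
rewrite nrm_mul nrm_cpowN1 // (nrm_mul h^-1) -powR_halfV // [leRHS]mulrA.
rewrite ler_wpM2r ?invr_ge0 ?(ltW t0) // nrm_inv; apply: le_trans (ler_wpM2l _ (cexp_taylor _)) _.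
  by rewrite invr_ge0.
rewrite nrm_mul; have := clog_growth hh rt xp; set L := nrm (clog t x) => hL.
have L0 : 0 <= L := nrm_ge0 _.
have -> : (nrm h)^-1 * (4 * (nrm h * L) ^+ 2 * expR (nrm h * L)) =
    4 * nrm h * (L ^+ 2 * expR (nrm h * L)) by field.
rewrite -[leRHS]mulrA ler_wpM2l ?mulr_ge0 // (le_trans _ hL) // ler_wpM2r ?expR_ge0 //.
nra.
Qed.

End Weights.

End Scalars.

(** * Contour integral of a scalar power *)

Section ScalarIntegrals.
Variables (R : realType) (n : nat) (theta : 'M[R]_n) (T : ncTorus theta).
Local Notation C := R[i].
Implicit Types (u v : T) (a b e t x y : R) (h z : C) (m F : R -> C).

Lemma fam_id a : fam a (fun _ u => u).
Proof.
split=> // s b; exists s, 1; split=> // [x u _ _|x y u _ _ hu].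
  by rewrite mul1r.
by rewrite subrr sn0 mul1r mulr_ge0 ?sn_ge0.
Qed.

Lemma is_integral_scalar m F a b : loc_lip m a -> mean_primitive m F a -> a <= b ->
  is_integral (fun t (u : T) => m t *: u) a b (fun u => (F b - F a) *: u).
Proof.
move=> hm hF ab; have FM := mesh_filter_proper ab.
have [K K0 [_ hK]] := hm b.
have X0 : 0 <= 2 * (b - a) * K by rewrite !mulr_ge0 // subr_ge0.
have X1 : 0 < 2 * (b - a) * K + 1 by rewrite ltr_wpDl.
apply: cvg_LCinf_coef.
- by apply: filterS (mesh_near a b) => p; apply: LCinf_riemann (fam_weight hm (fam_id a)).
- exact: LCinfZ (LCinf_id T).1.
move=> s; exists s => e e0.
exists (e / (2 * (b - a) * K + 1)); first exact: divr_gt0.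
move=> p hp u hu k; rewrite coefB coef_riemann coefZ.
under eq_bigr do rewrite coefZ mulrA.
rewrite -mulr_suml -mulrBl nrm_mul mulrCA; apply: ler_pM; rewrite ?nrm_ge0 ?mulr_ge0 ?jp_ge0 //.
- exact: nrm_ge0.
- apply: le_trans (riemann_scalar hF K0 hK hp) _.
  by rewrite (mulrA _ K) ltW // frac_lt.
- by apply: sn_coord; exact: Cinf_wfin.
Qed.

Lemma improper_scalar m F a (c : C) : loc_lip m a -> mean_primitive m F a ->
  (forall e, 0 < e -> \forall b \near +oo, nrm (F b - c) <= e) ->
  is_improper_integral (fun t (u : T) => m t *: u) a (fun u => (c - F a) *: u).
Proof.
move=> hm hF hc; exists (fun b u => (F b - F a) *: u); split.
  by move=> b ab; exact: is_integral_scalar.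
apply: cvg_LCinf_coef.
- by near=> b; exact: LCinfZ (LCinf_id T).1.
- exact: LCinfZ (LCinf_id T).1.
move=> s; exists s => e e0; apply: filterS (hc e e0) => b hb u hu k.
rewrite -scalerBl opprB addrA subrK coefZ nrm_mul mulrCA.
apply: ler_pM; rewrite ?nrm_ge0 ?mulr_ge0 ?jp_ge0 ?nrm_ge0 //.
by apply: sn_coord; exact: Cinf_wfin.
Unshelve. all: by end_near.
Qed.

Lemma cpow_small h x : complex.Re h < 0 ->
  forall e, 0 < e -> \forall b \near +oo, nrm (cpow h b x / h - 0) <= e.
Proof.
move=> h0 e e0; have hn : 0 < nrm h.
  rewrite lt_neqAle nrm_ge0 andbT eq_sym; apply/eqP => /nrm_eq0 E.
  by move: h0; rewrite E ltxx.
(* [X] solves [Re h * X - Im h * x = ln (e |h|)]; the division by [Re h < 0] turns the upper bound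
   on the modulus into a lower bound on [ln b]. *)
pose X := (ln (e * nrm h) + complex.Im h * x) / complex.Re h.
exists (expR X); split; first exact: num_real.
move=> b hb; have b0 : 0 < b := lt_trans (expR_gt0 _) hb.
rewrite subr0 nrm_mul nrm_inv ler_pdivrMr // /cpow nrm_cexp /clog.
rewrite -[leRHS]lnK ?posrE ?mulr_gt0 // ler_expR.
case: h h0 hn @X hb => p q /= p0 hn hb.
have : (ln (e * nrm (p +i* q)) + q * x) / p < ln b by rewrite -ltr_expR lnK // posrE.
rewrite ltr_ndivrMr // => /ltW; lra.
Qed.

Lemma mean_primitive_eq (f f' F : R -> C) a : (forall t, a <= t -> f t = f' t) ->
  mean_primitive f F a -> mean_primitive f' F a.
Proof.
move=> E hF x y c e ax xy h; apply: hF => // t /[dup] /andP[xt _] txy.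
by rewrite E ?h // (le_trans ax).
Qed.

Lemma primitive_ray h x a : h != 0 -> 0 < a ->
  mean_primitive (fun t => polar 1 x * cpow (h - 1) t x) (fun t => h^-1 * cpow h t x) a.
Proof.
move=> hn a0; have [d1 _] := ln_curve a0.
have := mean_primitiveZ (invr_neq0 hn) (@mean_primitive_cexp _ (@ln R) (fun t => t^-1) a (h * (x%:C * 'i)) h d1).
rewrite (_ : (fun t => h^-1 * cexp _) = fun t => h^-1 * cpow h t x); last first.
  by apply/funext => t; rewrite cpow_ray.
apply: mean_primitive_eq => t at_; have t0 := lt_le_trans a0 at_.
rewrite -cpow_ray cpowD -polarV // (polar_split t) fmorphV.
have p1 : polar 1 x != 0 :> C by apply: polar_neq0.
have tn : t%:C != 0 by rewrite fmorph_eq0 gt_eqF.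
by field; rewrite hn p1 tn.
Qed.

Lemma primitive_arc h r a : h != 0 -> 0 < r ->
  mean_primitive (fun x => 'i * polar r x * cpow (h - 1) r x) (fun x => h^-1 * cpow h r x) a.
Proof.
move=> hn r0; have [d1 _] := id_curve a.
have := mean_primitiveZ (invr_neq0 hn)
  (@mean_primitive_cexp _ id (fun=> 1) a (h * (ln r)%:C) (h * 'i) d1).
rewrite (_ : (fun t => h^-1 * cexp _) = fun t => h^-1 * cpow h r t); last first.
  by apply/funext => t; rewrite cpow_arc.
apply: mean_primitive_eq => x _; rewrite -cpow_arc cpowD -polarV //.
have p1 : polar r x != 0 :> C by apply: polar_neq0.
by field; rewrite hn p1.
Qed.

(* The antiderivative [l ^ h / h] takes the same values at the two ends of the
   circle as at the feet of the two rays, and vanishes at infinity. *)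
Lemma contour_cpow phi r h : 0 < r -> complex.Re h < 0 ->
  is_contour_integral phi r (fun t x u => cpow (h - 1) t x *: u) (fun=> 0 : T).
Proof.
move=> r0 h0; have hn : h != 0 by apply: contraTneq h0 => ->; rewrite /= ltxx.
have ray x : is_improper_integral
    (fun t (u : T) => polar 1 x *: (cpow (h - 1) t x *: u)) r
    (fun u => (0 - h^-1 * cpow h r x) *: u).
  have lm : loc_lip (fun t => polar 1 x * cpow (h - 1) t x) r.
    by apply: loc_lipM; [exact: loc_lip_cst|exact: loc_lip_cpow_ray].
  have cv e : 0 < e -> \forall b \near +oo, nrm (h^-1 * cpow h b x - 0) <= e.
    by move=> e0; apply: filterS (cpow_small x h0 e0) => b; rewrite mulrC.
  apply: improper_eq _ (improper_scalar lm (primitive_ray hn r0) cv) => t u _ _.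
  by rewrite scalerA.
have ray' : polar 1 (phi - 2 * pi) = polar 1 phi :> C by exact: polar_2pi.
exists (fun u => (0 - h^-1 * cpow h r phi) *: u),
  (fun u => (h^-1 * cpow h r phi - h^-1 * cpow h r (phi - 2 * pi)) *: u),
  (fun u => (0 - h^-1 * cpow h r (phi - 2 * pi)) *: u); split.
- exact: ray.
- have la : loc_lip (fun x => 'i * polar r x * cpow (h - 1) r x) (phi - 2 * pi).
    apply: loc_lipM (loc_lip_cpow_arc _ _ _); apply: loc_lipM (loc_lip_cst _ _) _.
    by apply: loc_lip_eq (loc_lip_cpow_arc 1 r _) => x _; rewrite polar_cpow.
  apply: is_integral_eq (two_pi_le phi) _
    (is_integral_scalar la (primitive_arc hn r0) (two_pi_le phi)) => x u _ _.
  by rewrite scalerA.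
- by have := ray (phi - 2 * pi); rewrite ray'.
move=> u _; set A := h^-1 * cpow h r phi; set B := h^-1 * cpow h r (phi - 2 * pi).
rewrite -!(scaleNr _ u) -!(scalerDl u).
by rewrite (_ : - (0 - A) - (A - B) + (0 - B) = 0) ?scale0r //; ring.
Qed.

End ScalarIntegrals.

(** * The logarithm *)

Section LogFormula.
Variables (R : realType) (n : nat) (theta : 'M[R]_n) (T : ncTorus theta).
Local Notation C := R[i].
Implicit Types (u v : T) (h : C).

Lemma near_nrm (d : R) : 0 < d -> \forall h \near (0 : C^o)^', h != 0 /\ nrm (h : C) <= d.
Proof.
move=> d0; rewrite /dnbhs /within /=; exists d%:C; first by rewrite /= ltcR.
move=> h /=; rewrite sub0r normrN => hd h0; split=> //.
by apply/ltW; rewrite -ltcR -nrmE.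
Qed.

Variables (w : R) (P : T -> T) (phi r : R).
Hypothesis P_op : sn_operator P.
Hypothesis r0 : 0 < r.
Local Notation Rs := (resolvent w P).
Hypothesis ray_regular : forall t, r <= t -> regular w P (polar t phi).
Hypothesis arc_regular : forall x, regular w P (polar r x).
Hypothesis ray_bound : forall s, exists s' K, 0 <= K /\ forall t, r <= t ->
  forall f, Cinf f -> sn s (Rs (polar t phi) f) <= K * sn s' f.
Hypothesis arc_bound : forall s b, exists s' K, 0 <= K /\
  forall x, phi - 2 * pi <= x <= b -> forall f, Cinf f ->
  sn s (Rs (polar r x) f) <= K * sn s' f.

Let on_reg := on_contour_regular ray_regular arc_regular.

(** [neg_power] selects an unspecified contour integral; [contour_uniq] and [contour_comp] then
    relate it to those that are constructed. *)
Lemma neg_powerP z J :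
  is_contour_integral phi r (fun t x u => cpow z t x *: Rs (polar t x) u) J ->
  exists2 I, is_contour_integral phi r (fun t x u => cpow z t x *: Rs (polar t x) u) I &
    neg_power w P phi r z = fun u => i_over_2pi R *: I u.
Proof.
move=> hJ; rewrite /neg_power; set S := [set S | _].
have [I [hI E]] : S (xget (fun=> 0) S).
  by apply: xgetPex; exists (fun u => i_over_2pi R *: J u), J.
by exists I.
Qed.

(* For [Re h >= 0], [P] is moved inside the integral. For [Re h < 0] the power is
   defined without a factor [P], and [P (P - l)^-1 = 1 + l (P - l)^-1] with the
   vanishing of the integral of [l ^ (h - 1)] gives the same formula. *)
Lemma complex_power_near0 h L : nrm h <= 4^-1 ->
  is_contour_integral phi r (fun t x u => cpow (h - 1) t x *: Rs (polar t x) (P u)) L ->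
  forall u, Cinf u -> complex_power w P phi r h u = i_over_2pi R *: L u.
Proof.
move=> hh hL u hu; have [PC PL Pd] := P_op; rewrite /complex_power /power_shift.
have [h0|h0] := ltP (complex.Re h) 0.
  rewrite [iter _ _ _]/= subr0.
  have hK : is_contour_integral phi r (fun t x u => cpow h t x *: Rs (polar t x) u)
      (fun u => -1 *: 0 + L u).
    apply: contour_eq _ (contour_lin (-1) (contour_cpow T phi r0 h0) hL).
    apply: on_reg => t x rt _ hreg v hv.
    rewrite resolventE // scaleN1r scalerDr addKr scalerA polar_cpow ?(lt_le_trans r0) //.
    by rewrite -cpowD subrK.
  have [I hI ->] := neg_powerP hK.
  rewrite (contour_uniq _ hI hK hu) ?scaler0 ?add0r //.
  apply: on_reg => t x _ _ [_ hreg] v hv; split=> //.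
  by apply: CinfZ; have [] := hreg v hv.
(* As [Re h <= |h| <= 1/4], the shift is [1]: one factor [P] is applied to the power of exponent
   [h - 1]. The case [h = 0] is included. *)
have -> : Num.truncn (complex.Re h) = 0%N.
  have h1 : complex.Re h < 1.
    apply: le_lt_trans (le_trans (ler_norm _) (le_trans (nrm_Re h) hh)) _.
    by rewrite invf_lt1 // ltr1n.
  have /andP[h2 _] := truncn_itv h0; have := le_lt_trans h2 h1.
  by rewrite ltrn1 ltnS leqn0 => /eqP.
have [J hJ] := contour_weight P_op r0 ray_regular arc_regular ray_bound arc_bound
  (sn_operator_id T) (weight_cpow phi r0 hh).
have [I hI E] := neg_powerP hJ; rewrite /= E.
have [? [? [_ hb]]] := contour_weight_bound P_op r0 ray_regular arc_regular ray_bound arc_bound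
  (sn_operator_id T) 0.
have [[IC _ _] _] := hb _ _ _ (weight_cpow phi r0 hh) hI.
have LP := LCinf_sn_operator P_op.
rewrite (LCinf_scale _ LP); last exact: IC.
congr (_ *: _); apply: (contour_comp LP Pd _ hI hL hu).
apply: on_reg => t x _ _ hreg v hv; have [_ hr] := hreg; have [cr _ _] := hr v hv.
by split; [exact: CinfZ|rewrite LCinf_scale // resolvent_comm].
Qed.

Theorem log_formula : exists I, is_contour_integral phi r
    (fun t x u => (clog t x * (polar t x)^-1) *: P (Rs (polar t x) u)) I /\
  forall u, Cinf u -> log_phi w P phi r u = i_over_2pi R *: I u.
Proof.
pose H (m : R -> R -> C) (t x : R) u := m t x *: Rs (polar t x) (P u).
have ex m B : weight phi r m B -> exists I, is_contour_integral phi r (H m) I.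
  exact: (contour_weight P_op r0 ray_regular arc_regular ray_bound arc_bound P_op).
have [I hI] := ex _ _ (weight_log phi r0); exists I; split.
  apply: contour_eq hI; apply: on_reg => t x rt _ hreg u hu.
  by rewrite /H resolvent_comm.
have [L hL] : exists L : C -> T -> T, forall h, nrm h <= 4^-1 ->
    is_contour_integral phi r (H (cpow (h - 1))) (L h).
  suff hs h : exists Lh, nrm h <= 4^-1 -> is_contour_integral phi r (H (cpow (h - 1))) Lh.
    by have [L hL] := boolp.choice hs; exists L.
  have [hh|nh] := boolP (nrm h <= 4^-1); last by exists (fun=> 0).
  by have [Lh] := ex _ _ (weight_cpow phi r0 hh); exists Lh.
have n0 : nrm (0 : C) <= 4^-1 by rewrite nrm0 invr_ge0.
(* [D h] is the contour integral for [quotient_weight h]; [-2 *: I u + I u] stands for [- I u], in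
   the shape that [contour_lin] produces. *)
pose D h u := h^-1 *: (-1 *: L 0 u + L h u) + (-2 *: I u + I u).
have hD h : nrm h <= 4^-1 -> is_contour_integral phi r (H (quotient_weight h)) (D h).
  move=> hh; have := contour_lin h^-1 (contour_lin (-1) (hL 0 n0) (hL h hh)) (contour_lin (-2) hI hI).
  apply: contour_eq; apply: on_reg => t x _ _ _ u _; rewrite /H.
  rewrite !scalerA -!(scalerDl (Rs _ _)) scalerA -scalerDl; congr (_ *: _).
  rewrite /quotient_weight /log_weight; ring.
have bd := contour_weight_bound P_op r0 ray_regular arc_regular ray_bound arc_bound P_op.
have LI : LCinf I.
  by have [? [? [_ hb]]] := bd 0; have [] := hb _ _ _ (weight_log phi r0) hI.
have LL h : nrm h <= 4^-1 -> LCinf (L h).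
  by move=> hh; have [? [? [_ hb]]] := bd 0; have [] := hb _ _ _ (weight_cpow phi r0 hh) (hL h hh).
pose c := i_over_2pi R.
have CP h u : nrm h <= 4^-1 -> Cinf u -> complex_power w P phi r h u = c *: L h u.
  by move=> hh hu; exact: complex_power_near0 (hL h hh) u hu.
pose q h u := h^-1 *: (complex_power w P phi r h u - complex_power w P phi r 0 u).
have qE h u : nrm h <= 4^-1 -> Cinf u -> q h u = c *: (D h u + I u).
  move=> hh hu; rewrite /q !CP // /D -scalerBr scalerA mulrC -scalerA; congr (_ *: _).
  have E0 : -2 *: I u + I u + I u = 0.
    by rewrite scaleNr scaler_nat -addrA -mulr2n addNr.
  by rewrite -(addrA (h^-1 *: _)) E0 addr0 scaleN1r (addrC (- L 0 u)).
have cq : cvg_LCinf (0 : C^o)^' q (fun u => c *: I u).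
  have near4 : \forall h \near (0 : C^o)^', h != 0 /\ nrm (h : C) <= 4^-1.
    by apply: near_nrm; rewrite invr_gt0.
  apply: cvg_LCinf_coef.
  - apply: filterS near4 => h [h0 hh].
    apply: (@LCinf_eq _ _ _ _ (fun u => c *: (h^-1 *: (-1 *: L 0 u + L h u)))).
      by move=> u hu; rewrite /q !CP // -scalerBr scaleN1r addrC scalerA mulrC -scalerA.
    by apply/LCinfZ/LCinfZ/LCinf_lin; exact: LL.
  - exact: LCinfZ.
  move=> s; have [s' [K [K0 hK]]] := bd s; exists s' => e e0.
  pose X := nrm c * (K * (4 * growth phi r)).
  have X0 : 0 <= X by rewrite !mulr_ge0 ?nrm_ge0 // growth_ge0.
  have X1 : 0 < X + 1 by rewrite ltr_wpDl.
  apply: filterS2 near4 (near_nrm (divr_gt0 e0 X1)) => h [h0 hh] [_ he] u hu k.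
  have [_ hb] := hK _ _ _ (weight_quotient phi r0 h0 hh) (hD h hh).
  rewrite qE // -scalerBr addrK coefZ nrm_mul mulrCA.
  apply: le_trans (ler_wpM2l (nrm_ge0 _) (hb u k hu)) _.
  have -> : nrm c * (K * (4 * nrm h * growth phi r) * sn s' u) = X * nrm h * sn s' u.
    by rewrite /X; ring.
  rewrite ler_wpM2r ?sn_ge0 // (le_trans (ler_wpM2l X0 he)) //; exact/ltW/frac_lt.
move=> u hu; rewrite /log_phi; set S := [set S | _].
have hS : S (xget (fun=> 0) S) by apply: xgetPex; exists (fun u => c *: I u).
by apply: (cvg_LCinf_uniq hS cq hu); apply: nearW.
Qed.

End LogFormula.

(** * From symbols to the hypotheses of the estimates *)

Section Instance.
Variables (R : realType) (n : nat) (theta : 'M[R]_n) (T : ncTorus theta).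
Local Notation C := R[i].
Local Notation Zn := 'rV[int]_n.
Local Notation lat := (lattice R).
Implicit Types (k : Zn) (s e t x : R) (xi : 'rV[R]_n).

Lemma enorm_jp s : exists2 K, 0 <= K & forall k, k != 0 ->
  1 <= enorm (lat k) /\ enorm (lat k) `^ s <= K * jp s k.
Proof.
exists (n%:R `^ s + 2 `^ (- s)); first by rewrite addr_ge0 ?powR_ge0.
move=> k k0; have l1 := lat_ge1 R k0; have l2 := sup_le_enorm (lat k).
have E1 : 1 <= enorm (lat k) := le_trans l1 l2; split=> //.
have E0 : 0 <= enorm (lat k) := le_trans ler01 E1.
rewrite mulrDl; have W0 := ltW (wt_gt0 R k).
have [s0|s0] := leP 0 s.
  apply: (@le_trans _ _ (n%:R `^ s * jp s k)); last first.
    by rewrite lerDl mulr_ge0 ?powR_ge0 // jp_ge0.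
  rewrite /jp -powRM //; apply: ge0_ler_powR; rewrite ?nnegrE ?mulr_ge0 //.
  by apply: le_trans (enorm_le_sup _) _; rewrite ler_wpM2l // lerDr.
apply: (@le_trans _ _ (2 `^ (- s) * jp s k)); last first.
  by rewrite lerDr mulr_ge0 ?powR_ge0 // jp_ge0.
have -> : enorm (lat k) `^ s = (enorm (lat k) `^ (- s))^-1 by rewrite powRN invrK.
have -> : jp s k = (jp (- s) k)^-1 by rewrite jpN invrK.
rewrite ler_pdivlMr ?jp_gt0 // [leLHS]mulrC ler_pdivrMr ?powR_gt0 ?(lt_le_trans ltr01) //.
rewrite /jp -powRM //; apply: ge0_ler_powR; rewrite ?nnegrE ?mulr_ge0 //.
  by rewrite oppr_ge0 ltW.
by rewrite /wt; lra.
Qed.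

Lemma mderiv0 (f : 'rV[R]_n -> T) : mderiv [ffun=> 0%N] f = f.
Proof. by rewrite /mderiv /mcompose; elim: (enum _) => //= j s ->; rewrite ffunE. Qed.

Lemma cexp_real x : cexp x%:C = (expR x)%:C :> C.
Proof. by rewrite /cexp /= cos0 sin0 mulr1. Qed.

(** The arc [polar r] is the primitive of [primitive_arc] for [h = 1], whose derivative has modulus
    [r]; the mean inequality adds the factor 2. *)
Lemma polar_lip r x y : 0 < r -> nrm (polar r x - polar r y : C) <= 2 * r * `|x - y|.
Proof.
move=> r0; wlog xy : x y / x <= y => [H|].
  by have [/H//|/ltW/H] := leP x y; rewrite nrmC (distrC y).
have hF := primitive_arc (a := x) (oner_neq0 C) r0.
have := primitive_bound (M := r) hF (lexx x) xy.
rewrite invr1 !mul1r -!polar_cpow // nrmC mulrAC distrC ger0_norm ?subr_ge0 //; apply.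
by move=> t _; rewrite subrr cpow0 mulr1 nrm_arc.
Qed.

(** The symbol expansion is taken with one term and no derivative in [xi], for the finitely many
    derivations that control [sn s]; the supremum [B] over them exists because they are finite in
    number. *)
Lemma quantizes_sn (w : R) (P : T -> T) rho rhoh : quantizes w%:C P rho rhoh ->
  forall s, exists2 K, 0 <= K &
    forall k, k != 0 -> sn s (rho (lat k) - rhoh 0%N (lat k)) <= K * jp (w - 1) k.
Proof.
move=> [[h1 h2 h3] _] s; have [gs [K [K0 hK]]] := sn_le_delta T s.
have [E E0 hE] := enorm_jp (w - 1).
have /boolp.choice [M hM] := fun g => h3 1%N g [ffun=> 0%N].
pose B := \sum_(g <- gs) `|M g|; have B0 : 0 <= B by apply: sumr_ge0.
exists (K * (B * E)); first by rewrite !mulr_ge0.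
move=> k k0; have [e1 e2] := hE k k0.
have lk : lat k != 0 by rewrite lat_eq0.
have CC : Cinf (rho (lat k) - rhoh 0%N (lat k)).
  have [hh _] := h2 0%N.
  by apply: CinfB; [have [[] ] := h1 [::] (lat k) I|have [[]] := hh [::] (lat k) lk].
rewrite -mulrA; apply: hK => // g ggs.
have := hM g (lat k) e1; rewrite mderiv0 big_ord1 /msize big1 ?subr0; last first.
  by move=> j _; rewrite ffunE.
move=> h; apply: (le_trans h); rewrite -mulrA.
apply: le_trans (ler_wpM2r (powR_ge0 _ _) (_ : M g <= B)) _.
  by rewrite (le_trans (ler_norm _)) // /B (big_rem g) //= lerDl sumr_ge0.
by rewrite ler_wpM2l.
Qed.

End Instance.


Theorem proposition8p3 (R : realType) (n : nat) (hn : (2 <= n)%N)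
    (theta : 'M[R]_n) (htheta : theta^T = - theta) (T : ncTorus theta)
    (w : R) (hw : 0 < w) (P : T -> T) (hP : Psi w%:C P)
    (hell : elliptic w%:C P) (hTheta : Theta w P !=set0)
    (phi : R) (hphi : ray phi `<=` checkTheta w P)
    (r : R) (hr : 0 < r) (hr0 : (r%:E < gap_radius w P)%E) :
  exists I : T -> T,
    is_contour_integral phi r
      (fun t a u =>
         (clog t a * (polar t a)^-1) *: P (resolvent w P (polar t a) u)) I /\
    (forall u, Cinf u -> log_phi w P phi r u = i_over_2pi R *: I u).
Proof.
pose sigma := principal_symbol w%:C P.
(* The principal symbol is a value of [xget], so it is the leading term of some full symbol of [P];
   this [rho] is the one kept below. *)
have [rho [rhoh [hq hs]]] : exists rho rhoh,
    quantizes w%:C P rho rhoh /\ sigma = rhoh 0%N.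
  rewrite /sigma /principal_symbol; set S := [set sigma | _].
  have : S (xget (fun=> 0) S).
    by apply: xgetPex; have [rho [rhoh h]] := hP; exists (rhoh 0%N), rho, rhoh.
  by [].
have [[rho_smooth rhoh_hom _] PE] := hq.
have [sigma_smooth sigma_h] : homogeneous (w%:C - 0%:R) sigma by rewrite hs; exact: rhoh_hom.
have sigma_cvg (xi : 'rV[R]_n) : xi != 0 -> cvg_Cinf (nbhs xi) sigma (sigma xi).
  by move=> x0; have [] := sigma_smooth [::] xi x0.
have sigma_Cinf (xi : 'rV[R]_n) : xi != 0 -> Cinf (sigma xi) by move=> /sigma_cvg[].
have sigma_cont (xi : 'rV[R]_n) : xi != 0 -> forall s e, 0 < e ->
    \forall eta \near xi, sn s (sigma eta - sigma xi) <= e.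
  by move=> x0 s e e0; exact: cvg_Cinf_sn (sigma_cvg xi x0) e0.
have sigma_hom t (xi : 'rV[R]_n) : 0 < t -> xi != 0 -> sigma (t *: xi) = (t `^ w)%:C *: sigma xi.
  move=> t0 x0; rewrite sigma_h // subr0 -rmorphM /= cexp_real /powR gt_eqF //.
have hray t : 0 < t -> checkTheta w P (polar t phi) by move=> t0; apply: hphi; exists t.
(* Ellipticity gives [t = 0], and the ray being contained in [Theta w P] gives [t > 0]. *)
have sigma_inv (xi : 'rV[R]_n) : xi != 0 -> forall t, 0 <= t -> exists b, inv_at sigma phi xi t b.
  move=> x0 t; rewrite le_eqVlt => /predU1P[<-|t0].
    have [b hb [b1 b2]] := hell xi x0; exists b.
    by rewrite /inv_at /polar mul0r scale0r subr0.
  have [[_ hT] _] := hray t t0; have [b hb [b1 b2]] := hT xi x0.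
  by exists b.
have a_Cinf (k : 'rV[int]_n) : Cinf (rho (lattice R k)).
  by have [[]] := rho_smooth [::] (lattice R k) I.
have a_sigma s : exists2 K, 0 <= K & forall k : 'rV[int]_n, k != 0 ->
    sn s (rho (lattice R k) - sigma (lattice R k)) <= K * jp (w - 1) k.
  rewrite hs; exact: (quantizes_sn hq s).
have a_bd := a_bound hw sigma_Cinf sigma_cont sigma_hom a_Cinf a_sigma.
have P_op : sn_operator P.
  split.
  - exact: P_Cinf a_Cinf a_bd PE.
  - exact: P_lin a_Cinf a_bd PE.
  - by move=> s; have [A A0 hA] := P_bound a_Cinf a_bd PE s; exists (s + w), A.
have ray_Sp t : 0 < t -> ~ Sp w P (polar t phi).
  move=> t0 hSp; have [_] := hray t t0; apply; exists 1, (polar t phi).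
  by rewrite mul1r.
(* A spectral point on the circle is nonzero and has modulus [r], which lies below the infimum
   defining [gap_radius]. *)
have arc_Sp x : ~ Sp w P (polar r x).
  move=> hSp; move: hr0; rewrite ltNge => /negP; apply.
  apply: ereal_inf_lbound; exists (polar r x); last by rewrite nrm_polar gtr0_norm.
  by split=> //; exact: polar_neq0.
have reg lam : lam != 0 -> ~ Sp w P lam -> regular w P lam.
  move=> l0 hl; split=> // f hf.
  have [h1 _ h2] := resolvent_spec hw sigma_Cinf sigma_cont sigma_hom sigma_inv a_Cinf a_sigma
    PE l0 hl hf.
  split=> //; exact: (resolvent_left hw sigma_Cinf sigma_cont sigma_hom sigma_inv a_Cinf a_sigma
    PE l0 hl hf).
apply: (log_formula P_op hr).
- by move=> t rt; have t0 := lt_le_trans hr rt; apply: reg (ray_Sp t t0); exact: polar_neq0.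
- by move=> x; apply: reg (arc_Sp x); exact: polar_neq0.
(* [resolvent_ray] is stated for nonnegative weights; a negative [s] is dominated by the weight
   0. *)
- move=> s; have s0 : 0 <= Num.max s 0 by rewrite le_max lexx orbT.
  have [s' [K [K0 hK]]] := resolvent_ray hw sigma_Cinf sigma_cont sigma_hom sigma_inv a_Cinf
    a_sigma PE hr s0 ray_Sp.
  exists s', K; split=> // t rt f hf; apply: le_trans (hK t rt f hf).
  have t0 := lt_le_trans hr rt; have [_ h] := reg _ (polar_neq0 phi t0) (ray_Sp t t0).
  by apply: le_sn; [have [/Cinf_wfin] := h f hf|rewrite le_max lexx].
move=> s b.
exact: (resolvent_compact hw sigma_Cinf sigma_cont sigma_hom sigma_inv a_Cinf a_sigma PE s
  (fun x y => polar_lip x y hr) (fun x _ => arc_Sp x) (fun x => polar_neq0 x hr)).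
Qed.
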